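(* Probability distributions of measurement results on $O(\log N)$ qubits in the HC1Q model on $N$ qubits can be classically sampled in polynomial time within a $1/poly(N)$ L1-norm error. That is, for every constant $c>0$ and every polynomial $r$ there is a classical probabilistic polynomial-time algorithm which, given the description of an HC1Q circuit on $N$ qubits (with $poly(N)$ gates) and a set $K$ of $k\le c\log N$ of its qubits, outputs $z\in\{0,1\}^k$ with probability $q_z$ such that $$\sum_{z\in\{0,1\}^k}|p_z-q_z|\le\frac{1}{r(N)},$$ where $p_z$ is the probability that the final computational-basis measurement of the qubits in $K$ in the HC1Q circuit yields $z$.
   Context: $H$ is the one-qubit Hadamard gate and $I$ the one-qubit identity. An HC1Q (Hadamard-classical circuit with one-qubit) circuit on $N$ qubits is the following: start from $|0^N\rangle$; apply $H^{\otimes(N-1)}\otimes I$ (Hadamard on every qubit except the last); apply coherently a polynomial-time uniformly-generated classical reversible circuit $C:\{0,1\}^N\to\{0,1\}^N$ (built from polynomially many classical reversible gates such as $X$, CNOT, Toffoli acting on the $N$ wires, viewed as the permutation unitary $|w\rangle\mapsto|C(w)\rangle$); apply $H^{\otimes(N-1)}\otimes I$ again; finally measure all qubits in the computational basis. *)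

(* Defs.v *)
(* MathComp / MathComp-Analysis. *)
From HB Require Import structures.
From mathcomp Require Import all_boot all_order all_algebra all_fingroup.
From mathcomp Require Import reals exp complex.

Set Implicit Arguments.
Unset Strict Implicit.
Unset Printing Implicit Defensive.

Import Order.TTheory GRing.Theory Num.Theory.
Local Open Scope ring_scope.
Local Open Scope complex_scope.

(** * Classical reversible circuits *)

Record gate_kind := GateKind {
  arity : nat;
  gate_perm : {perm arity.-tuple bool} }.

(* A finite gate set is a family [G : 'I_m -> gate_kind], for instance
   X, CNOT and Toffoli.  A gate of a circuit on [N] wires is a kind together
   with the wires it acts on; these have to be pairwise distinct, see
   [wf_circuit]. *)
Definition gate m (G : 'I_m -> gate_kind) (N : nat) : Type :=
  {i : 'I_m & (arity (G i)).-tuple 'I_N}.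

Definition apply_gate m (G : 'I_m -> gate_kind) N
    (g : gate G N) (w : N.-tuple bool) : N.-tuple bool :=
  let ws := tagged g in
  let y := gate_perm (G (tag g)) [tuple of map (tnth w) ws] in
  [tuple if j \in ws then nth false y (index j ws) else tnth w j | j < N].

Definition circuit m (G : 'I_m -> gate_kind) (N : nat) : Type := seq (gate G N).

Definition wf_circuit m (G : 'I_m -> gate_kind) N (C : circuit G N) : bool :=
  all (fun g : gate G N => uniq (tagged g)) C.

Definition eval_circuit m (G : 'I_m -> gate_kind) N
    (C : circuit G N) (w : N.-tuple bool) : N.-tuple bool :=
  foldl (fun v g => apply_gate g v) w C.

(** * The HC1Q model *)

(* States and operators on [N] qubits are given by their coefficients in the
   computational basis. *)
Definition state (R : realType) (N : nat) : Type := N.-tuple bool -> R[i].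
Definition operator (R : realType) (N : nat) : Type :=
  N.-tuple bool -> N.-tuple bool -> R[i].

Definition apply_op (R : realType) N (U : operator R N) (psi : state R N) :
    state R N :=
  fun x => \sum_y U x y * psi y.

Definition ket0 (R : realType) N : state R N :=
  fun x => (x == [tuple of nseq N false])%:R.

Definition hadamard (R : realType) (a b : bool) : R[i] :=
  ((-1) ^+ (a && b) / Num.sqrt 2)%:C.

Definition id1 (R : realType) (a b : bool) : R[i] := (a == b)%:R.

(* The tensor product of H on the first [n] qubits and I on the last one. *)
Definition hadamard_layer (R : realType) n : operator R n.+1 :=
  fun x y => \prod_(j < n.+1)
    (if j == ord_max then id1 R else hadamard R) (tnth x j) (tnth y j).

Definition circuit_op (R : realType) m (G : 'I_m -> gate_kind) N
    (C : circuit G N) : operator R N :=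
  fun x y => (x == eval_circuit C y)%:R.

Definition hc1q_state (R : realType) m (G : 'I_m -> gate_kind) n
    (C : circuit G n.+1) : state R n.+1 :=
  apply_op (@hadamard_layer R n)
    (apply_op (circuit_op R C)
      (apply_op (@hadamard_layer R n) (@ket0 R n.+1))).

(* The outcome on the qubits in [K] is read in increasing order of wires. *)
Definition hc1q_prob (R : realType) m (G : 'I_m -> gate_kind) n
    (C : circuit G n.+1) (K : {set 'I_n.+1}) (z : seq bool) : R :=
  \sum_(x : n.+1.-tuple bool | [seq tnth x j | j <- enum K] == z)
    Normc.normc (hc1q_state R C x) ^+ 2.

(** * Descriptions as bit strings *)

Definition unary (n : nat) : seq bool := nseq n true ++ [:: false].

Definition encode_gate m (G : 'I_m -> gate_kind) N (g : gate G N) : seq bool :=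
  unary (tag g) ++ flatten [seq unary (val j) | j <- tagged g].

(* The number of wires, the characteristic vector of [K], the gates in order
   of application. *)
Definition encode m (G : 'I_m -> gate_kind) N
    (C : circuit G N) (K : {set 'I_N}) : seq bool :=
  unary N ++ [seq j \in K | j <- enum 'I_N]
    ++ flatten [seq true :: encode_gate g | g <- C] ++ [:: false].

(** * Probabilistic multitape Turing machines *)

Inductive move := MoveLeft | Stay | MoveRight.

(* Cells contain a bit or a blank ([None]).  [tleft] lists the cells to the
   left of the head, nearest first; [tright] lists the scanned cell and the
   cells to its right.  All cells not listed are blank. *)
Record tape := Tape { tleft : seq (option bool); tright : seq (option bool) }.

Definition scanned (t : tape) : option bool := head None (tright t).

Definition write_move (a : option bool) (d : move) (t : tape) : tape :=
  let l := tleft t in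
  let r := behead (tright t) in
  match d with
  | MoveLeft => Tape (behead l) (head None l :: a :: r)
  | Stay => Tape l (a :: r)
  | MoveRight => Tape (a :: l) r
  end.

(* The machine has [ntapes.+1] tapes and two transition functions, one for each
   outcome of the fair coin that is tossed at every step. *)
Record ptm := PTM {
  ntapes : nat;
  control : finType;
  start : control;
  halting : pred control;
  delta : bool -> control -> {ffun 'I_ntapes.+1 -> option bool} ->
          control * {ffun 'I_ntapes.+1 -> option bool * move} }.

Definition config (M : ptm) : Type := (control M * ('I_(ntapes M).+1 -> tape))%type.

Definition halted (M : ptm) (c : config M) : bool := halting c.1.

Definition step (M : ptm) (c : config M) (b : bool) : config M :=
  if halted c then c else
  let d := delta b c.1 [ffun i => scanned (c.2 i)] in
  (d.1, fun i => write_move (d.2 i).1 (d.2 i).2 (c.2 i)).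

(* The input is on tape 0, with the head on its first symbol; the other tapes
   are blank. *)
Definition init (M : ptm) (w : seq bool) : config M :=
  (start M, fun i => Tape [::] (if i == ord0 then map Some w else [::])).

Definition run (M : ptm) (w : seq bool) (coins : seq bool) : config M :=
  foldl (@step M) (init M w) coins.

Fixpoint read_bits (s : seq (option bool)) : seq bool :=
  if s is Some b :: s' then b :: read_bits s' else [::].

(* The output is the word on tape 0 that starts at the head and ends before the
   first blank. *)
Definition output (M : ptm) (c : config M) : seq bool :=
  read_bits (tright (c.2 ord0)).

(* On every input and for all coin tosses. *)
Definition runs_in_time (M : ptm) (T : nat -> nat) : Prop :=
  forall (w : seq bool) (coins : (T (size w)).-tuple bool), halted (run M w coins).

Definition output_prob (R : realType) (M : ptm) (T : nat -> nat)
    (w z : seq bool) : R :=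
  #|[set coins : (T (size w)).-tuple bool | output (run M w coins) == z]|%:R
    / 2 ^+ T (size w).

(* All possible outputs on input [w] are in [L]. *)
Definition outputs_in (M : ptm) (T : nat -> nat) (w : seq bool)
    (L : pred (seq bool)) : Prop :=
  forall coins : (T (size w)).-tuple bool, L (output (run M w coins)).

(* Main.v *)
(* Let V be the group of the words supported on the front wires in K, of order
   2^k <= poly(N), and let f(w) = 1 if the preimage of w under C ends in 0 and
   f(w) = 0 otherwise.  In the sum of the squared amplitudes the sum over the
   unobserved front qubits forces the two words of the square to agree there, and
   p_z becomes the sum of (sum_(s in V) f(v+s) (-1)^(x.s))^2 over all v and all x
   with outcome z, divided by 2 4^n 2^k.  The inner sum D is an integer, |D| <= 2^k,
   and is computed exactly by enumerating V and running C backwards.  Hence rejection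
   sampling is possible: draw v, x and a sign uniformly and accept if two uniform
   numbers below 2^k are both at least 2^k - max(+-D, 0).  One attempt accepts with
   probability 1/(4 2^k), and conditionally on this its outcome has exactly the law p,
   so that the error after A attempts is at most 2 (1 - 1/(4 2^k))^A; a suitable
   A = (N+1)^d is enough by Bernoulli's inequality.

   The Turing machine is compiled from a language of programs on tapes, whose loops
   run along a tape that their body leaves fixed; N^d rounds are d nested loops.  The
   machine prepares its tapes, fills one with coin tosses, and then runs
   deterministically. *)
Require Import Defs.
From HB Require Import structures.
From mathcomp Require Import all_boot all_order all_algebra all_fingroup.
From mathcomp Require Import boolp reals exp complex.
From mathcomp Require Import zify ring lra.

Set Implicit Arguments.
Unset Strict Implicit.
Unset Printing Implicit Defensive.

(** Two numbers are drawn because the acceptance probability has to be a square: one uniform number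
    below 2^k is at least 2^k - max(D, 0) with probability max(D, 0)/2^k, and both are with the
    square of this. The sign is drawn because D may be negative: max(D, 0)^2 + max(-D, 0)^2 = D^2.
    The program draws no separate sign bit; the character ignores the last wire, so the last bit of
    the random word x serves as the sign.

    The machine never computes 2^k or a logarithm. The exponent d depends on c and r only and is
    built into the program. The (N+1)^d rounds serve twice: as the number of attempts, and as a
    supply of rounds for the enumeration of V, where the carry out of the counter makes the surplus
    rounds idle.

    All coins are tossed onto a tape before the first one is used. A program is therefore a
    deterministic function on stores with an exactly known running time, and the law of the output
    is an average over one fixed slice of the coin sequence.

    The machine must halt in time on every string, also on one that encodes no circuit, so every
    loop is bounded by the length of some tape and never by the meaning of the input. *)

(* The reversed word left of the head, and the word from the scanned cell on. *)
Definition zipper : Type := (seq bool * seq bool)%type.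

(** Only [Append] and [Push] can lengthen a word, at its right or left end. The other instructions
    leave a blank cell alone, so blanks never come to lie inside a word. *)
Inductive instr :=
  Keep | Forward | Over of bool | OverF of bool | Append of bool | Push of bool.

Definition scan (z : zipper) : option bool := ohead z.2.

Definition do_act (a : instr) (z : zipper) : zipper :=
  match a with
  | Keep => z
  | Forward => if z.2 is b :: v then (b :: z.1, v) else z
  | Over b => if z.2 is _ :: v then (z.1, b :: v) else z
  | OverF b => if z.2 is _ :: v then (b :: z.1, v) else z
  | Append b => (b :: z.1, behead z.2)
  | Push b => (behead z.1, b :: z.2)
  end.

Definition rewind (z : zipper) : zipper := ([::], catrev z.1 z.2).

Definition upd (X : eqType) A (f : X -> A) (x : X) (a : A) : X -> A :=
  fun y => if y == x then a else f y.

(** * A loop language on tapes and its compilation to control steps *)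

Section Language.

Variables X D : finType.

Definition view : Type := X -> option bool.

Inductive prog :=
| Do of (D -> view -> D * (X -> instr))
| Seq of prog & prog
| If of (D -> view -> bool) & prog & prog
| Rewind of X
| For of X & pred bool & prog.

Definition store : Type := (D * (X -> zipper))%type.

Definition view_of (s : store) : view := fun x => scan (s.2 x).

Definition forward (x : X) (s : store) : store :=
  (s.1, upd s.2 x (do_act Forward (s.2 x))).

Definition rounds (P : pred bool) (z : zipper) : nat := find (predC P) z.2.

Fixpoint den (p : prog) (s : store) : store :=
  match p with
  | Do f => let r := f s.1 (view_of s) in (r.1, fun x => do_act (r.2 x) (s.2 x))
  | Seq p q => den q (den p s)
  | If b p q => if b s.1 (view_of s) then den p s else den q s
  | Rewind x => (s.1, upd s.2 x (rewind (s.2 x)))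
  | For x P p => iter (rounds P (s.2 x)) (fun s => forward x (den p s)) s
  end.

(** The exact number of machine steps. [Do] takes two because [Push] first moves and then writes.
    [Rewind] takes one step to leave the scanned cell, one per cell on its left, and one to return
    from the blank. A round of [For] adds a test and an advance, and one last test ends the loop. *)
Fixpoint time (p : prog) (s : store) : nat :=
  match p with
  | Do _ => 2
  | Seq p q => time p s + time q (den p s)
  | If b p q => (if b s.1 (view_of s) then time p s else time q s).+1
  | Rewind x => (size (s.2 x).1).+2
  | For x P p =>
      (\sum_(i < rounds P (s.2 x))
         (time p (iter i (fun s => forward x (den p s)) s)).+2).+1
  end.

Fixpoint fixes (x : X) (p : prog) : Prop :=
  match p with
  | Do f => forall d v, match (f d v).2 x with Keep | Over _ => True | _ => False end
  | Seq p q | If _ p q => fixes x p /\ fixes x q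
  | Rewind y => y != x
  | For y _ p => y != x /\ fixes x p
  end.

(* [den] fixes the number of rounds of a loop when the loop is entered; the machine
   tests the scanned cell in each round.  They agree if the body does not change the
   tape of the loop beyond its head. *)
Fixpoint wf (p : prog) : Prop :=
  match p with
  | Do _ | Rewind _ => True
  | Seq p q | If _ p q => wf p /\ wf q
  | For x _ p => fixes x p /\ wf p
  end.

Definition same_but_head (z z' : zipper) : Prop :=
  [/\ z'.1 = z.1, behead z'.2 = behead z.2 & size z'.2 = size z.2].

Lemma fixesP x p s : fixes x p -> same_but_head (s.2 x) ((den p s).2 x).
Proof.
elim: p s => [f|p IHp q IHq|b p IHp q IHq|y|y P p IHp] s /=.
- move=> /(_ s.1 (view_of s)); case: (f _ _) => d a /=.
  by case: (a x) => // b _; rewrite /same_but_head; case: (s.2 x) => u [|? ?].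
- move=> [hp hq]; have [e1 e2 e3] := IHp s hp; have [f1 f2 f3] := IHq (den p s) hq.
  by split; [rewrite f1|rewrite f2|rewrite f3].
- by move=> [hp hq]; case: ifP => _; [apply: IHp|apply: IHq].
- by move=> yx; rewrite /upd eq_sym (negPf yx).
- move=> [yx /IHp h]; have {}h s' := h s'; elim: (rounds _ _) => [|k IH] //=.
  set s' := iter _ _ _ in IH *; have [f1 f2 f3] := h s'; case: IH => e1 e2 e3.
  by rewrite /forward /upd /= eq_sym (negPf yx); split; [rewrite f1|rewrite f2|rewrite f3].
Qed.

(** For [Do], [Some g] is the second step, with the bits that [Push] still has to write. For [If],
    [None] is the test. For [Rewind], [false] is the first step. For [For], [None] is the test,
    [Some None] the advance, and the rest is the body. *)
Fixpoint ctrl (p : prog) : finType :=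
  match p with
  | Do _ => option {ffun X -> option bool} : finType
  | Seq p q => (ctrl p + ctrl q)%type : finType
  | If _ p q => option (ctrl p + ctrl q)%type : finType
  | Rewind _ => bool : finType
  | For _ _ p => option (option (ctrl p)) : finType
  end.

Fixpoint entry (p : prog) : ctrl p :=
  match p with
  | Do _ => None
  | Seq p _ => inl (entry p)
  | If _ _ _ => None
  | Rewind _ => false
  | For _ _ _ => None
  end.

Definition act_move (a : instr) (o : option bool) : option bool * move :=
  match a, o with
  | Keep, _ => (o, Stay)
  | Forward, Some _ => (o, MoveRight)
  | Over b, Some _ => (Some b, Stay)
  | OverF b, Some _ => (Some b, MoveRight)
  | Append b, _ => (Some b, MoveRight)
  | Push _, _ => (o, MoveLeft)
  | _, None => (None, Stay)
  end.

Definition pushed (a : instr) : option bool := if a is Push b then Some b else None.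

Definition idle (v : view) : X -> option bool * move := fun x => (v x, Stay).

Definition alone (v : view) (x : X) (m : move) : X -> option bool * move :=
  fun y => (v y, if y == x then m else Stay).

(** A next control of [None] means exit. In [For] the exit of the body, wrapped in [Some], is
    literally the control [Some None] that advances the loop tape. *)
Fixpoint ctrl_step (p : prog) :
    ctrl p -> D -> view -> option (ctrl p) * D * (X -> option bool * move) :=
  match p return ctrl p -> D -> view ->
    option (ctrl p) * D * (X -> option bool * move) with
  | Do f => fun k d v =>
      if k is Some g then
        (None, d, fun x => (if g x is Some b then Some b else v x, Stay))
      else let r := f d v in
        (Some (Some [ffun x => pushed (r.2 x)]), r.1,
         fun x => act_move (r.2 x) (v x))
  | Seq p q => fun k d v =>
      match k with
      | inl k => let: (k', d', a) := ctrl_step k d v in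
          (Some (if k' is Some k'' then inl k'' else inr (entry q)), d', a)
      | inr k => let: (k', d', a) := ctrl_step k d v in (omap inr k', d', a)
      end
  | If b p q => fun k d v =>
      match k with
      | None => (Some (Some (if b d v then inl (entry p) else inr (entry q))),
                 d, idle v)
      | Some (inl k) => let: (k', d', a) := ctrl_step k d v in
          (omap (fun k => Some (inl k)) k', d', a)
      | Some (inr k) => let: (k', d', a) := ctrl_step k d v in
          (omap (fun k => Some (inr k)) k', d', a)
      end
  | Rewind x => fun k d v =>
      if k && ~~ v x then (None, d, alone v x MoveRight)
      else (Some true, d, alone v x MoveLeft)
  | For x P p => fun k d v =>
      match k with
      | None =>
          ((if v x is Some b then if P b then Some (Some (Some (entry p))) else None
            else None), d, idle v)
      | Some None => (Some None, d, alone v x MoveRight)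
      | Some (Some k) => let: (k', d', a) := ctrl_step k d v in
          (Some (Some k'), d', a)
      end
  end.

Definition move_all (a : X -> option bool * move) (T : X -> tape) : X -> tape :=
  fun x => write_move (a x).1 (a x).2 (T x).

Definition view_tapes (T : X -> tape) : view := fun x => scanned (T x).

Inductive reach (p : prog) :
    ctrl p -> D -> (X -> tape) -> nat -> D -> (X -> tape) -> Prop :=
| ReachExit k d T d' a :
    ctrl_step k d (view_tapes T) = (None, d', a) ->
    reach k d T 1 d' (move_all a T)
| ReachStep k d T k' d' a n d2 T2 :
    ctrl_step k d (view_tapes T) = (Some k', d', a) ->
    reach k' d' (move_all a T) n d2 T2 -> reach k d T n.+1 d2 T2.

(** Equality up to trailing blanks: merely staying on an unlisted cell already makes the machine
    list a blank there. *)
Definition blank_eq (l l' : seq (option bool)) : Prop := nth None l =1 nth None l'.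

Definition represents (t : tape) (z : zipper) : Prop :=
  blank_eq (tleft t) (map some z.1) /\ blank_eq (tright t) (map some z.2).

Definition represents_all (T : X -> tape) (Z : X -> zipper) : Prop :=
  forall x, represents (T x) (Z x).

Lemma blank_eq_cons a l l' : blank_eq l l' -> blank_eq (a :: l) (a :: l').
Proof. by move=> h [|i] //=; apply: h. Qed.

Lemma blank_eq_behead l l' : blank_eq l l' -> blank_eq (behead l) (behead l').
Proof. by move=> h i; rewrite !nth_behead h. Qed.

Lemma blank_eq_head l l' : blank_eq l l' -> head None l = head None l'.
Proof. by move=> /(_ 0); rewrite !nth0. Qed.

Lemma blank_eq_trans l1 l2 l3 : blank_eq l1 l2 -> blank_eq l2 l3 -> blank_eq l1 l3.
Proof. by move=> h h' i; rewrite h h'. Qed.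

Lemma blank_eq_None : blank_eq [:: None] [::].
Proof. by case=> [|[]]. Qed.

Lemma blank_eq_split l : blank_eq (head None l :: behead l) l.
Proof. by case: l => //; apply: blank_eq_None. Qed.

Lemma represents_scan t z : represents t z -> scanned t = scan z.
Proof. by case=> _ /blank_eq_head; rewrite /scanned /scan => ->; case: z.2. Qed.

Lemma represents_view T Z : represents_all T Z -> view_tapes T = (fun x => scan (Z x)).
Proof. by move=> h; apply: funext => x; apply: represents_scan. Qed.

Lemma represents_stay t z : represents t z -> represents (write_move (scanned t) Stay t) z.
Proof.
case=> hl hr; split=> //=; exact: blank_eq_trans (blank_eq_split _) hr.
Qed.

(** Moving left and writing on the new cell cannot share a machine step, so [Push] leaves its bit to
    the second one. Every other instruction is complete after one step, and the second rewrites the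
    scanned symbol. *)
Lemma represents_two_steps a t z : represents t z ->
  let o := act_move a (scan z) in
  let t' := write_move o.1 o.2 t in
  represents (write_move (if pushed a is Some b then Some b else scanned t') Stay t')
    (do_act a z).
Proof.
move=> h; have hs := represents_scan h.
case: z h hs => u v h hs.
have st := represents_stay h; case: (h); rewrite [_.1]/= [_.2]/= => hl hr.
case: a => [|| b | b | b | b] o t'.
- by refine (@represents_stay t' _ _); rewrite /t' /o /= -hs.
- refine (@represents_stay t' _ _); rewrite /t' /o /=.
  case: v {o t'} h hs st hr => [|b v] /= h hs st hr; first by rewrite hs in st.
  by split=> /=; [exact: blank_eq_cons | exact: blank_eq_behead hr].
- refine (@represents_stay t' _ _); rewrite /t' /o /=.
  case: v {o t'} h hs st hr => [|c v] /= h hs st hr.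
    by rewrite hs in st.
  by split=> //=; apply: blank_eq_cons; exact: blank_eq_behead hr.
- refine (@represents_stay t' _ _); rewrite /t' /o /=.
  case: v {o t'} h hs st hr => [|c v] /= h hs st hr.
    by rewrite hs in st.
  by split=> /=; [exact: blank_eq_cons | exact: blank_eq_behead hr].
- refine (@represents_stay t' _ _); rewrite /t' /o /=; split=> /=; first exact: blank_eq_cons.
  by have := blank_eq_behead hr; case: (v).
- rewrite /t' /o /= -hs; split => /=; first by have := blank_eq_behead hl; case: (u).
  by apply: blank_eq_cons; exact: blank_eq_trans (blank_eq_split _) hr.
Qed.

Lemma reach_seq_right p q k d T n d' T' :
  @reach q k d T n d' T' -> @reach (Seq p q) (inr k) d T n d' T'.
Proof.
elim=> {k d T n d' T'} [k d T d' a e|k d T k' d' a n d2 T2 e _ IH].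
  by apply: ReachExit; rewrite /= e.
by apply: ReachStep IH; rewrite /= e.
Qed.

Lemma reach_seq p q k d T n d' T' n2 d2 T2 :
  @reach p k d T n d' T' -> @reach q (entry q) d' T' n2 d2 T2 ->
  @reach (Seq p q) (inl k) d T (n + n2) d2 T2.
Proof.
move=> h; elim: h => {k d T n d' T'} [k d T d' a e|k d T k' d' a n d3 T3 e _ IH] h2.
  by apply: (@ReachStep (Seq p q)) (reach_seq_right p h2); rewrite /= e.
by apply: (@ReachStep (Seq p q)) (IH h2); rewrite /= e.
Qed.

Lemma reach_if_left b p q k d T n d' T' :
  @reach p k d T n d' T' -> @reach (If b p q) (Some (inl k)) d T n d' T'.
Proof.
elim=> {k d T n d' T'} [k d T d' a e|k d T k' d' a n d2 T2 e _ IH].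
  by apply: ReachExit; rewrite /= e.
by apply: ReachStep IH; rewrite /= e.
Qed.

Lemma reach_if_right b p q k d T n d' T' :
  @reach q k d T n d' T' -> @reach (If b p q) (Some (inr k)) d T n d' T'.
Proof.
elim=> {k d T n d' T'} [k d T d' a e|k d T k' d' a n d2 T2 e _ IH].
  by apply: ReachExit; rewrite /= e.
by apply: ReachStep IH; rewrite /= e.
Qed.

Lemma reach_for_body x P p k d T n d' T' n2 d2 T2 :
  @reach p k d T n d' T' -> @reach (For x P p) (Some None) d' T' n2 d2 T2 ->
  @reach (For x P p) (Some (Some k)) d T (n + n2) d2 T2.
Proof.
move=> h; elim: h => {k d T n d' T'} [k d T d' a e|k d T k' d' a n d3 T3 e _ IH] h2.
  by apply: (@ReachStep (For x P p)) h2; rewrite /= e.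
by apply: (@ReachStep (For x P p)) (IH h2); rewrite /= e.
Qed.

Lemma represents_idle T Z :
  represents_all T Z -> represents_all (move_all (idle (view_tapes T)) T) Z.
Proof. by move=> h x; apply: represents_stay. Qed.

Lemma represents_alone T Z x m z : represents_all T Z ->
  represents (write_move (scanned (T x)) m (T x)) z ->
  represents_all (move_all (alone (view_tapes T) x m) T) (upd Z x z).
Proof.
move=> h hx y; rewrite /move_all /alone /upd /=.
by case: eqP => [->|_] //; apply: represents_stay.
Qed.

(* The head may sit on the blank cell left of the word, a position that no
   zipper describes; hence the option cells in [blank_eq]. *)
Lemma reach_rewind_loop x d T (Z : X -> zipper) u r :
  (forall y, y != x -> represents (T y) (Z y)) ->
  blank_eq (tleft (T x)) (map some (behead u)) ->
  blank_eq (tright (T x)) (ohead u :: map some r) ->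
  exists2 T', represents_all T' (upd Z x ([::], catrev u r)) &
    @reach (Rewind x) true d T (size u).+1 d T'.
Proof.
elim: u r T => [|b u IH] r T hy hl hr.
  exists (move_all (alone (view_tapes T) x MoveRight) T); last first.
    by apply: ReachExit; rewrite /= /view_tapes /scanned (blank_eq_head hr).
  move=> y; rewrite /move_all /alone /upd /=; case: eqP => [->|/eqP /hy]; last first.
    exact: represents_stay.
  split=> /=; last exact: blank_eq_behead hr.
  rewrite /view_tapes /scanned (blank_eq_head hr) /=.
  apply: blank_eq_trans blank_eq_None; exact: blank_eq_cons.
have [|||T' hT' rT'] := IH (b :: r) (move_all (alone (view_tapes T) x MoveLeft) T).
- by move=> y yx; rewrite /move_all /alone (negPf yx); apply/represents_stay/hy.
- by rewrite /move_all /alone eqxx /=; have := blank_eq_behead hl; case: (u).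
- rewrite /move_all /alone eqxx /= /view_tapes (blank_eq_head hl).
  have -> : head None [seq some i | i <- u] = ohead u by case: (u).
  apply: blank_eq_cons; apply: blank_eq_trans (blank_eq_split _) _.
  exact: hr.
exists T' => //; apply: ReachStep rT'.
by rewrite /= /view_tapes /scanned (blank_eq_head hr).
Qed.

Lemma reach_rewind x d T Z : represents_all T Z ->
  exists2 T', represents_all T' (upd Z x (rewind (Z x))) &
    @reach (Rewind x) false d T (size (Z x).1).+2 d T'.
Proof.
move=> h; case: (h x) => hl hr.
pose T1 := move_all (alone (view_tapes T) x MoveLeft) T.
have [|||T' hT' rT'] := @reach_rewind_loop x d T1 Z (Z x).1 (Z x).2.
- by move=> y yx; rewrite /T1 /move_all /alone (negPf yx); apply/represents_stay/h.
- by rewrite /T1 /move_all /alone eqxx /=; have := blank_eq_behead hl; case: (Z x).1.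
- rewrite /T1 /move_all /alone eqxx /= /view_tapes (blank_eq_head hl).
  have -> : head None [seq some i | i <- (Z x).1] = ohead (Z x).1 by case: (Z x).1.
  by apply: blank_eq_cons; apply: blank_eq_trans (blank_eq_split _) _.
by exists T' => //; apply: ReachStep rT'.
Qed.

Lemma find_behead (P : pred bool) v v' : behead v = behead v' ->
  size v = size v' -> forall n, find P v = n.+1 -> find P (behead v') = n.
Proof. by case: v v' => [|a v] [|b v'] //= -> _ n; case: (P a) => // -[]. Qed.

(** A positive count puts the first failing cell strictly beyond the head, where the body changes
    nothing; the advance takes one cell off the count. *)
Lemma rounds_forward P z z' k : rounds P z = k.+1 -> same_but_head z z' ->
  rounds P (do_act Forward z') = k.
Proof.
case: z z' => u v [u' v'] /=; rewrite /rounds /= => hk [_ /= e es].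
have := find_behead (esym e) (esym es) hk.
by case: v' e es => [|b v'] //= e es; case: v hk e es.
Qed.

Lemma roundsS P z k : rounds P z = k.+1 -> exists2 b, scan z = Some b & P b.
Proof.
case: z => u [|b v] //; rewrite /rounds /=; case: ifP => //= /negbFE Pb _.
by exists b.
Qed.

Lemma rounds0 P z : rounds P z = 0 ->
  (if scan z is Some b then P b else false) = false.
Proof. by case: z => u [|b v] //; rewrite /rounds /scan /=; case: (P b). Qed.

Lemma represents_forward T Z x : represents_all T Z -> scan (Z x) != None ->
  represents_all (move_all (alone (view_tapes T) x MoveRight) T)
    (upd Z x (do_act Forward (Z x))).
Proof.
move=> h hx; apply: represents_alone => //.
have := h x; case: (Z x) hx => u [|b v] //= _ [hl hr].
rewrite /scanned (blank_eq_head hr); split; first exact: blank_eq_cons.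
exact: blank_eq_behead hr.
Qed.

(** Induction on the program, and for [For] on the number of rounds left. That the path has exactly
    [time p s] steps matters later: it fixes the place of the random bits in the coin sequence. *)
Lemma reach_den p s T : wf p -> represents_all T s.2 ->
  exists2 T', represents_all T' (den p s).2 &
    reach (entry p) s.1 T (time p s) (den p s).1 T'.
Proof.
elim: p s T => [f|p IHp q IHq|b p IHp q IHq|x|x P p IHp] s T /=.
- move=> _ h; have ev := represents_view h.
  set r := f s.1 _.
  set T1 := move_all (fun x => act_move (r.2 x) (scan (s.2 x))) T.
  exists (move_all (fun x => (if pushed (r.2 x) is Some b then Some b
                              else view_tapes T1 x, Stay)) T1).
    move=> x; rewrite [X in represents X]/move_all /=; have := represents_two_steps (r.2 x) (h x).
    by [].
  apply: (@ReachStep (Do f)); first by rewrite /= ev /=.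
  rewrite -/T1; set a := (X in move_all X T1).
  have -> : a = fun x => (if [ffun x => pushed (r.2 x)] x is Some b then Some b
                              else view_tapes T1 x, Stay).
    by apply: funext => x; rewrite /a ffunE.
  exact: (@ReachExit (Do f) (Some [ffun x => pushed (r.2 x)]) r.1 T1 r.1 _ erefl).
- move=> [wp wq] h; have [T1 h1 r1] := IHp s T wp h.
  have [T2 h2 r2] := IHq _ T1 wq h1.
  by exists T2 => //; apply: reach_seq r1 r2.
- move=> [wp wq] h; have ev := represents_view h.
  have hi := represents_idle h.
  case: ifP => hb; [have [T1 h1 r1] := IHp s _ wp hi|have [T1 h1 r1] := IHq s _ wq hi];
    exists T1 => //.
    by apply: (@ReachStep (If b p q)) (reach_if_left b q r1); rewrite /= ev hb.
  by apply: (@ReachStep (If b p q)) (reach_if_right b p r1); rewrite /= ev hb.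
- by move=> _; apply: reach_rewind.
- move=> [fx wp]; move ek : (rounds _ _) => k; elim: k s T ek => [|k IHk] s T ek h.
    rewrite big_ord0 /=; exists (move_all (idle (view_tapes T)) T).
      exact: represents_idle.
    apply: (@ReachExit (For x P p)); rewrite /=; congr (_, _, _).
    rewrite (represents_view h); have := rounds0 ek.
    by case: (scan _) => // b ->.
  have ev := represents_view h; have hi := represents_idle h.
  have [b eb Pb] := roundsS ek.
  have [T1 h1 r1] := IHp s _ wp hi.
  have sb := fixesP s fx.
  have h2 : represents_all (move_all (alone (view_tapes T1) x MoveRight) T1)
     (forward x (den p s)).2.
    apply: represents_forward => //; case: sb => _ _.
    by move: eb; rewrite /scan; case: (s.2 x).2 => // ? ? _; case: ((den p s).2 x).2.
  have [|T2 h3 r2] := IHk (forward x (den p s)) _ _ h2.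
    by rewrite /forward /= /upd eqxx; apply: rounds_forward ek sb.
  exists T2; first by rewrite iterSr.
  have -> : (\sum_(i < k.+1) (time p (iter i (fun s0 => forward x (den p s0)) s)).+2).+1
    = (time p s + (\sum_(i < k) (time p (iter i (fun s0 => forward x (den p s0))
         (forward x (den p s)))).+2).+1.+1).+1.
    rewrite big_ord_recl /= !addSn !addnS; do !congr S; congr (_ + _).
    by apply: eq_bigr => i _; rewrite -iterSr.
  rewrite iterSr.
  apply: (@ReachStep (For x P p)) (reach_for_body r1 _); first by rewrite /= ev eb Pb.
  by apply: (@ReachStep (For x P p)) r2.
Qed.

End Language.

(** * Polynomial time bounds *)

(** The base [n.+1] is positive, so powers are monotone in the exponent also at 0. *)
Definition poly_bounded (f : nat -> nat) : Prop :=
  exists C d, forall n, f n <= C * n.+1 ^ d.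

Lemma poly_bounded_const a : poly_bounded (fun=> a).
Proof. by exists a, 0 => n; rewrite expn0 muln1. Qed.

Lemma poly_bounded_id : poly_bounded id.
Proof. by exists 1, 1 => n; rewrite mul1n expn1. Qed.

Lemma poly_bounded_add f g :
  poly_bounded f -> poly_bounded g -> poly_bounded (fun n => f n + g n).
Proof.
move=> [C [d hf]] [C' [d' hg]]; exists (C + C'), (d + d') => n.
rewrite mulnDl; apply: leq_add; [apply: leq_trans (hf n) _|apply: leq_trans (hg n) _];
  rewrite leq_mul // leq_pexp2l // ?leq_addr ?leq_addl //.
Qed.

Lemma poly_bounded_mul f g :
  poly_bounded f -> poly_bounded g -> poly_bounded (fun n => f n * g n).
Proof.
move=> [C [d hf]] [C' [d' hg]]; exists (C * C'), (d + d') => n.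
by rewrite expnD mulnACA leq_mul.
Qed.

Lemma poly_bounded_exp f k : poly_bounded f -> poly_bounded (fun n => f n ^ k).
Proof.
move=> hf; elim: k => [|k IH]; first by exists 1, 0 => n; rewrite expn0.
have [C [d h]] := poly_bounded_mul hf IH.
by exists C, d => n; rewrite expnS.
Qed.

Lemma poly_bounded_succ f : poly_bounded f -> poly_bounded (fun n => (f n).+1).
Proof. by move=> /poly_bounded_add /(_ (poly_bounded_const 1))[C [d h]];
  exists C, d => n; rewrite -addn1. Qed.

(** * Running time of programs *)

Section Cost.

Variables X D : finType.
Implicit Types (p q : prog X D) (s : store X D).

Definition tape_size (z : zipper) : nat := size z.1 + size z.2.

Definition grows (a : instr) : bool :=
  match a with Append _ | Push _ => true | _ => false end.

(** All loops and rewinds run on tapes in [L], and these never grow. Their initial lengths thus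
    bound every loop throughout the run, while the tapes outside [L] may grow freely. *)
Fixpoint safe (L : pred X) p : Prop :=
  match p with
  | Do f => forall d v x, L x -> ~~ grows ((f d v).2 x)
  | Seq p q | If _ p q => safe L p /\ safe L q
  | Rewind x => L x
  | For x _ p => L x /\ safe L p
  end.

Fixpoint cost_bound p (n : nat) : nat :=
  match p with
  | Do _ => 2
  | Seq p q => cost_bound p n + cost_bound q n
  | If _ p q => (cost_bound p n + cost_bound q n).+1
  | Rewind _ => n.+2
  | For _ _ p => (n * (cost_bound p n).+2).+1
  end.

Lemma tape_size_act a z : tape_size (do_act a z) <= (tape_size z).+1.
Proof.
case: a z => [||b|b|b|b] [[|a u] [|c v]];
  rewrite /tape_size /= ?(addnS, addSn, addn0, add0n) //;
  do ?[exact: leqnn | exact: leqnSn | apply: leqW].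
Qed.

Lemma tape_size_stable a z : ~~ grows a -> tape_size (do_act a z) = tape_size z.
Proof.
by case: a z => [||b|b|b|b] [u [|c v]] //= _; rewrite /tape_size /= ?addSn ?addnS.
Qed.

Lemma tape_size_rewind z : tape_size (rewind z) = tape_size z.
Proof. by rewrite /tape_size /= catrevE size_cat size_rev add0n. Qed.

Lemma forward_at (x y : X) s :
  (forward x s).2 y = if y == x then do_act Forward (s.2 x) else s.2 y.
Proof. by []. Qed.

(** An instruction adds at most one cell to a tape, so time bounds space. This gives the input size
    of the second program in a sequence. *)
Lemma den_size p s x : tape_size ((den p s).2 x) <= tape_size (s.2 x) + time p s.
Proof.
elim: p s => [f|p IHp q IHq|b p IHp q IHq|y|y P p IHp] s /=.
- by rewrite addn2 ltnW // ltnS tape_size_act.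
- by rewrite addnA; apply: leq_trans (IHq _) _; rewrite leq_add2r.
- by case: ifP => _; rewrite addnS leqW // ?IHp ?IHq.
- by rewrite /upd; case: eqP => [->|_]; rewrite ?tape_size_rewind leq_addr.
- rewrite addnS leqW //; elim: (rounds _ _) => [|k IH]; first by rewrite big_ord0 addn0.
  rewrite big_ord_recr [X in _ <= X]/= iterS; set s' := iter _ _ _ in IH *.
  rewrite addnA; apply: leq_trans (leq_add IH (leqnn _)).
  rewrite !addnS; apply: (@leq_trans (tape_size ((den p s').2 x)).+1).
    by rewrite forward_at; case: eqP => [->|_]; [exact: tape_size_act|exact: leqnSn].
  by rewrite ltnS leqW.
Qed.

Lemma safe_size L p s x : safe L p -> L x -> tape_size ((den p s).2 x) = tape_size (s.2 x).
Proof.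
elim: p s => [f|p IHp q IHq|b p IHp q IHq|y|y P p IHp] s /=.
- by move=> h Lx; rewrite tape_size_stable // h.
- by move=> [sp sq] Lx; rewrite IHq // IHp.
- by move=> [sp sq] Lx; case: ifP => _; rewrite ?IHp ?IHq.
- by move=> _ _; rewrite /upd; case: eqP => [->|_]; rewrite ?tape_size_rewind.
- move=> [Ly sp] Lx; elim: (rounds _ _) => // k IH.
  rewrite iterS forward_at; case: eqP => [e|_]; last by rewrite IHp.
  by subst y; rewrite tape_size_stable // IHp.
Qed.

Lemma safe_time L p s n : safe L p -> (forall x, L x -> tape_size (s.2 x) <= n) ->
  time p s <= cost_bound p n.
Proof.
elim: p s => [f|p IHp q IHq|b p IHp q IHq|y|y P p IHp] s //=.
- move=> [sp sq] h; apply: leq_add; first exact: IHp.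
  by apply: IHq => // x Lx; rewrite (safe_size _ sp) // h.
- move=> [sp sq] h; rewrite ltnS; case: ifP => _.
    exact: leq_trans (IHp s sp h) (leq_addr _ _).
  exact: leq_trans (IHq s sq h) (leq_addl _ _).
- by move=> Ly h; rewrite !ltnS; apply: leq_trans (h y Ly); apply: leq_addr.
- move=> [Ly sp] h; rewrite ltnS.
  apply: (@leq_trans (\sum_(i < rounds P (s.2 y)) (cost_bound p n).+2)).
    apply: leq_sum => i _; rewrite !ltnS; apply: IHp => // x Lx.
    suff -> : forall k, tape_size ((iter k (fun s => forward y (den p s)) s).2 x)
      = tape_size (s.2 x) by apply: h.
    elim=> // k IH; rewrite iterS forward_at; case: eqP => [e|_]; last by rewrite (safe_size _ sp).
    by subst y; rewrite tape_size_stable // (safe_size _ sp).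
  rewrite sum_nat_const card_ord leq_mul2r; apply/orP; right.
  apply: leq_trans (h y Ly); apply: leq_trans (find_size _ _) (leq_addl _ _).
Qed.

Lemma cost_bound_poly p : poly_bounded (cost_bound p).
Proof.
elim: p => [f|p IHp q IHq|b p IHp q IHq|y|y P p IHp] /=.
- exact: poly_bounded_const.
- exact: poly_bounded_add.
- by apply: poly_bounded_succ; apply: poly_bounded_add.
- by do 2 apply: poly_bounded_succ; apply: poly_bounded_id.
- apply: poly_bounded_succ; apply: poly_bounded_mul; first exact: poly_bounded_id.
  by do 2 apply: poly_bounded_succ.
Qed.

Definition polytime p : Prop :=
  exists2 f, poly_bounded f &
    forall n s, (forall x, tape_size (s.2 x) <= n) -> time p s <= f n.

Lemma polytime_safe L p : safe L p -> polytime p.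
Proof.
move=> sp; exists (cost_bound p); first exact: cost_bound_poly.
by move=> n s h; apply: safe_time sp _ => x _.
Qed.

(** A tape grown in one phase may drive a loop of the next, as [TH] does in [prepare], so no single
    [L] makes the whole program [safe]. The phases are bounded one by one: the second starts on
    tapes of size at most [n + f n]. *)
Lemma polytime_seq p q : polytime p -> polytime q -> polytime (Seq p q).
Proof.
move=> [f pf hf] [g [C [d pg]] hg].
exists (fun n => f n + C * (n + f n).+1 ^ d).
  apply: poly_bounded_add => //; apply: poly_bounded_mul; first exact: poly_bounded_const.
  apply: poly_bounded_exp; apply: poly_bounded_succ; apply: poly_bounded_add => //.
  exact: poly_bounded_id.
move=> n s h /=; apply: leq_add; first exact: hf.
apply: leq_trans (pg _); apply: hg => x.
by apply: leq_trans (den_size _ _ _) _; apply: leq_add; [apply: h|apply: hf].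
Qed.

End Cost.

(** * Compilation to probabilistic Turing machines *)

Section Machine.

Variables (X D : finType) (x0 xr : X) (d0 : D) (p q : prog X D).

(* Tape [ord0] holds [x0]; the slot that [enum_rank] gives to [x0] is unused. *)
Definition tape_index (x : X) : 'I_#|X|.+1 :=
  if x == x0 then ord0 else lift ord0 (enum_rank x).

Definition tape_name (i : 'I_#|X|.+1) : option X := [pick x | tape_index x == i].

Lemma tape_index_inj : injective tape_index.
Proof.
move=> x y; rewrite /tape_index; case: eqP => [->|_]; case: eqP => [->|_] //.
by move=> /lift_inj /enum_rank_inj.
Qed.

Lemma tape_indexK x : tape_name (tape_index x) = Some x.
Proof.
rewrite /tape_name; case: pickP => [y /eqP /tape_index_inj -> //|/(_ x)].
by rewrite eqxx.
Qed.

(** Only the middle control, of type [unit], looks at the coin: it overwrites the cells of [xr] one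
    after another and passes to [q] at the first blank. *)
Definition machine_delta (coin : bool) (c : option (ctrl p + (unit + ctrl q)) * D)
    (o : {ffun 'I_#|X|.+1 -> option bool}) :
    (option (ctrl p + (unit + ctrl q)) * D) * {ffun 'I_#|X|.+1 -> option bool * move} :=
  let v := fun x => o (tape_index x) in
  let: (k', d', a) :=
    match c.1 with
    | None => (None, c.2, idle v)
    | Some (inl k) => let: (k', d', a) := ctrl_step k c.2 v in
        (Some (if k' is Some k'' then inl k'' else inr (inl tt)), d', a)
    | Some (inr (inl u)) =>
        if v xr then
          (c.1, c.2, fun y => if y == xr then (Some coin, MoveRight) else (v y, Stay))
        else (Some (inr (inr (entry q))), c.2, idle v)
    | Some (inr (inr k)) => let: (k', d', a) := ctrl_step k c.2 v in
        (omap (fun k => inr (inr k)) k', d', a)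
    end in
  ((k', d'), [ffun i => if tape_name i is Some x then a x else (o i, Stay)]).

Definition machine : ptm :=
  @PTM #|X| (option (ctrl p + (unit + ctrl q)) * D)%type
    (Some (inl (entry p)), d0) (fun c => ~~ c.1) machine_delta.

Definition named (tau : 'I_#|X|.+1 -> tape) : X -> tape := fun x => tau (tape_index x).

Lemma named_step (a : X -> option bool * move) o tau :
  named (fun i => write_move
      ([ffun i => if tape_name i is Some x then a x else (o i, Stay)] i).1
      ([ffun i => if tape_name i is Some x then a x else (o i, Stay)] i).2 (tau i))
  = move_all a (named tau).
Proof. by apply: funext => x; rewrite /named !ffunE tape_indexK. Qed.

Lemma named_view (tau : 'I_#|X|.+1 -> tape) :
  (fun x => [ffun i => scanned (tau i)] (tape_index x)) = view_tapes (named tau).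
Proof. by apply: funext => x; rewrite ffunE. Qed.

Definition conf k d tau : config machine := ((k, d), tau).

Lemma run_first k d T n d' T' tau coins :
  @reach _ _ p k d T n d' T' -> named tau = T -> size coins = n ->
  exists2 tau', foldl (@step machine) (conf (Some (inl k)) d tau) coins
    = conf (Some (inr (inl tt))) d' tau' & named tau' = T'.
Proof.
move=> h; elim: h tau coins => {k d T n d' T'}
  [k d T d' a e|k d T k' d' a n d2 T2 e _ IH] tau [|b coins] //= et; subst T.
  move=> /eqP; rewrite eqSS size_eq0 => /eqP ->.
  rewrite /step /= /halted /= /machine_delta /= named_view e /=.
  by eexists; first by []; rewrite named_step.
move=> [es]; rewrite /step /= /halted /= /machine_delta /= named_view e /=.
by apply: IH => //; rewrite named_step.
Qed.

Lemma run_last k d T n d' T' tau coins :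
  @reach _ _ q k d T n d' T' -> named tau = T -> size coins = n ->
  exists2 tau', foldl (@step machine) (conf (Some (inr (inr k))) d tau) coins
    = conf None d' tau' & named tau' = T'.
Proof.
move=> h; elim: h tau coins => {k d T n d' T'}
  [k d T d' a e|k d T k' d' a n d2 T2 e _ IH] tau [|b coins] //= et; subst T.
  move=> /eqP; rewrite eqSS size_eq0 => /eqP ->.
  rewrite /step /= /halted /= /machine_delta /= named_view e /=.
  by eexists; first by []; rewrite named_step.
move=> [es]; rewrite /step /= /halted /= /machine_delta /= named_view e /=.
by apply: IH => //; rewrite named_step.
Qed.

(** The last toss [b] is spent on the step that finds the blank. *)
Lemma run_coins d tau Z coins b : represents_all (named tau) Z ->
  size coins = size (Z xr).2 ->
  exists2 tau', foldl (@step machine) (conf (Some (inr (inl tt))) d tau) (rcons coins b)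
    = conf (Some (inr (inr (entry q)))) d tau' &
    represents_all (named tau') (upd Z xr (catrev coins (Z xr).1, [::])).
Proof.
have scan_xr tau0 Z0 : represents_all (named tau0) Z0 ->
    [ffun i => scanned (tau0 i)] (tape_index xr) = scan (Z0 xr).
  by move=> h; rewrite ffunE; apply: (represents_scan (h xr)).
elim: coins tau Z => [|a coins IH] tau Z h /= es.
  rewrite /step /= /halted /= /machine_delta /= (scan_xr _ _ h).
  case ez : (Z xr) es => [u [|c v]] //= _.
  eexists; first by [].
  rewrite named_view named_step.
  have -> : upd Z xr (u, [::]) = Z by apply: funext => y; rewrite /upd; case: eqP => // ->.
  exact: represents_idle.
case ez : (Z xr) es => [u [|c v]] //= [es].
rewrite {2}/step /= /halted /= /machine_delta /= (scan_xr _ _ h) ez /=.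
set tau1 := (fun i : 'I_ _ => _).
have h1 : represents_all (named tau1) (upd Z xr (a :: u, v)).
  rewrite /tau1 named_step => y; rewrite /move_all /upd; case: eqP => [->|_] /=.
    case: (h xr); rewrite ez => hl hr; split=> /=; first exact: blank_eq_cons.
    exact: blank_eq_behead hr.
  by rewrite ffunE; apply: represents_stay (h y).
have [|tau' e' h'] := IH tau1 _ h1; first by rewrite /upd eqxx.
exists tau' => //; move=> y; have := h' y; rewrite /upd eqxx.
by case: eqP.
Qed.

Definition start_state (w : seq bool) : store X D :=
  (d0, upd (fun=> ([::], [::])) x0 ([::], w)).

Definition middle_state w (rho : seq bool) : store X D :=
  let s := den p (start_state w) in
  (s.1, upd s.2 xr (catrev rho (s.2 xr).1, [::])).

Definition coins_needed w : nat := size ((den p (start_state w)).2 xr).2.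

Definition final_tape w rho : seq bool := ((den q (middle_state w rho)).2 x0).2.

Lemma named_init w :
  represents_all (named (@init machine w).2) (start_state w).2.
Proof.
by move=> x; rewrite /named /tape_index /start_state /upd /=; case: (x == x0); split.
Qed.

Lemma read_bits_map l v : blank_eq l (map some v) -> read_bits l = v.
Proof.
elim: v l => [|b v IH] [|a l] h //; have := h 0 => //= ->//=.
by rewrite IH // => i; exact: (h i.+1).
Qed.

Lemma foldl_halted (c : config machine) coins : halted c -> foldl (@step machine) c coins = c.
Proof. by move=> h; elim: coins => //= b coins IH; rewrite [step c b]/step h IH. Qed.

(** The first phase is deterministic, so its duration [t1] and the number [n] of cells to fill do
    not depend on the coins; the random word sits at a fixed place among them. Surplus coins find
    the machine halted. *)
Theorem machine_run w coins (t1 := time p (start_state w)) (n := coins_needed w)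
    (rho := take n (drop t1 coins)) : wf p -> wf q ->
  t1 + n.+1 + time q (middle_state w rho) <= size coins ->
  halted (run machine w coins) /\ output (run machine w coins) = final_tape w rho.
Proof.
move=> wp wq hs.
have [T1 h1 r1] := reach_den wp (@named_init w).
have s1 : size (take t1 coins) = t1.
  by rewrite size_takel // -(leq_add2r (n.+1 + time q (middle_state w rho)))
    addnA (leq_trans hs) // leq_addr.
have [tau1 e1 n1] := run_first r1 erefl s1.
have hn : n.+1 + time q (middle_state w rho) <= size (drop t1 coins).
  by rewrite size_drop leq_subRL ?addnA //; apply: leq_trans hs; rewrite -addnA leq_addr.
have sr : size rho = n.
  by rewrite size_takel //; apply: leq_trans hn; rewrite addSn leqW // leq_addr.
set c2 := drop n (drop t1 coins).
have s2 : time q (middle_state w rho) < size c2.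
  by rewrite size_drop ltn_subRL; move: hn; rewrite addSn.
case ec : c2 s2 => [//|b c3] /=; rewrite ltnS => s3.
rewrite -n1 in h1.
have [tau2 e2 h2] := run_coins (den p (start_state w)).1 b h1 sr.
have [T3 h3 r3] := @reach_den _ _ q (middle_state w rho) _ wq h2.
have [tau3 e3 n3] := run_last r3 erefl (size_takel s3).
have -> : run machine w coins = conf None (den q (middle_state w rho)).1 tau3.
  rewrite /run -(cat_take_drop t1 coins) foldl_cat.
  have -> : init machine w = conf (Some (inl (entry p))) (start_state w).1 (init machine w).2.
    by [].
  rewrite e1 -(cat_take_drop n (drop t1 coins)) -/rho -/c2 ec -cat_rcons foldl_cat e2.
  by rewrite -(cat_take_drop (time q (middle_state w rho)) c3) foldl_cat e3 foldl_halted.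
split=> //; rewrite /output /=; apply: read_bits_map.
have := h3 x0; rewrite -n3 /named /tape_index eqxx; by case.
Qed.

Hypotheses (wf_p : wf p) (wf_q : wf q) (fast_p : polytime p) (fast_q : polytime q).

(** Nothing is assumed about [w]: the bound has to hold for strings that encode no circuit as well.
    The polynomial is C'(X + 1)^d'. *)
Theorem machine_poly : exists T : {poly nat}, forall w rho,
  size rho = coins_needed w ->
  time p (start_state w) + (coins_needed w).+1 + time q (middle_state w rho)
    <= (horner T (size w)).
Proof.
case: fast_p => f pf hf; case: fast_q => g [C [d pg]] hg.
have [C' [d' h]] : poly_bounded (fun n => f n + (n + f n).+1 + C * (n + f n).+1 ^ d).
  have hh : poly_bounded (fun n => (n + f n).+1).
    apply: poly_bounded_succ; apply: poly_bounded_add => //; exact: poly_bounded_id.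
  apply: poly_bounded_add; first exact: poly_bounded_add.
  apply: poly_bounded_mul; first exact: poly_bounded_const.
  exact: poly_bounded_exp.
exists (C'%:P * ('X + 1%:P) ^+ d')%R => w rho sr.
have -> : (horner (C'%:P * ('X + 1%:P) ^+ d')%R (size w)) = C' * (size w).+1 ^ d'.
  rewrite hornerM hornerC horner_exp hornerD hornerX hornerC.
  by rewrite -addn1.
apply: leq_trans (h _).
have s0 x : tape_size ((start_state w).2 x) <= size w.
  by rewrite /start_state /= /upd; case: eqP => //= _; rewrite /tape_size add0n.
have t1 := hf _ _ s0.
have s1 x : tape_size ((den p (start_state w)).2 x) <= size w + f (size w).
  by apply: leq_trans (den_size _ _ _) _; apply: leq_add.
apply: leq_add; first apply: leq_add => //.
  by rewrite ltnS; apply: leq_trans (s1 xr); apply: leq_addl.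
apply: leq_trans (pg _); apply: hg => x; rewrite /middle_state /= /upd.
case: eqP => [_|_] //; apply: leq_trans (s1 xr).
by rewrite /tape_size /= catrevE size_cat size_rev sr /coins_needed addn0 addnC.
Qed.

End Machine.

(** * The sampling program *)

(* All words indexed by the wires are stored in reverse order, because they are
   built by pushing: cell 0 belongs to the last wire.
   [TI] input, later output; [TU] the number of wires in unary; [TH] fuel for the
   loop over the gates; [TK] characteristic word of K; [TM] the same without the
   last wire; [TV], [TZ], [TX], [TJ] the four random words of an attempt; [TS] the
   counter; [TW] the word on which the inverse circuit is run; [TO] the accepted
   outcome; [TA], [TB] two unary counters (head positions); [TR] random bits;
   [TG] one cell per gate; [TF] fuel for the nested loops; [TQ] for each gate and
   each of its slots the indicator word of the wire (one copy to read, one copy to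
   write); [TT] for each gate the indicator of its kind. *)
Inductive name (m ar d : nat) :=
  TI | TU | TH | TK | TM | TV | TZ | TX | TJ | TS | TW | TO | TA | TB | TR | TG
| TF of bool & 'I_d | TQ of bool & 'I_ar | TT of 'I_m.

Arguments TI {m ar d}. Arguments TU {m ar d}. Arguments TH {m ar d}.
Arguments TK {m ar d}. Arguments TM {m ar d}. Arguments TV {m ar d}.
Arguments TZ {m ar d}. Arguments TX {m ar d}. Arguments TJ {m ar d}.
Arguments TS {m ar d}. Arguments TW {m ar d}. Arguments TO {m ar d}.
Arguments TA {m ar d}. Arguments TB {m ar d}. Arguments TR {m ar d}.
Arguments TG {m ar d}. Arguments TF {m ar d}. Arguments TQ {m ar d}.
Arguments TT {m ar d}.

Section NameFinite.
Variables m ar d : nat.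
Let code_type : Type := ('I_16 + (bool * 'I_d + (bool * 'I_ar + 'I_m)))%type.
Definition name_code (x : name m ar d) : code_type :=
  match x with
  | TI => inl (@Ordinal 16 0 isT) | TU => inl (@Ordinal 16 1 isT)
  | TH => inl (@Ordinal 16 2 isT) | TK => inl (@Ordinal 16 3 isT)
  | TM => inl (@Ordinal 16 4 isT) | TV => inl (@Ordinal 16 5 isT)
  | TZ => inl (@Ordinal 16 6 isT) | TX => inl (@Ordinal 16 7 isT)
  | TJ => inl (@Ordinal 16 8 isT) | TS => inl (@Ordinal 16 9 isT)
  | TW => inl (@Ordinal 16 10 isT) | TO => inl (@Ordinal 16 11 isT)
  | TA => inl (@Ordinal 16 12 isT) | TB => inl (@Ordinal 16 13 isT)
  | TR => inl (@Ordinal 16 14 isT) | TG => inl (@Ordinal 16 15 isT)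
  | TF b j => inr (inl (b, j))
  | TQ b l => inr (inr (inl (b, l)))
  | TT i => inr (inr (inr i))
  end.
Definition name_decode (c : code_type) : name m ar d :=
  match c with
  | inl k => nth TI [:: TI; TU; TH; TK; TM; TV; TZ; TX; TJ; TS; TW; TO; TA; TB; TR; TG] k
  | inr (inl (b, j)) => TF b j
  | inr (inr (inl (b, l))) => TQ b l
  | inr (inr (inr i)) => TT i
  end.
Lemma name_codeK : cancel name_code name_decode. Proof. by case. Qed.
HB.instance Definition _ := Finite.copy (name m ar d) (can_type name_codeK).
End NameFinite.

(** [par], [ge1] and [ge2] accumulate along a sweep: the sign of the term, and whether the counter
    is at least each of the two random numbers. [carry] is the carry into the counter and afterwards
    tells whether it overflowed. [fin] records that some attempt has accepted. [slots] holds the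
    bits on the wires of the current gate; [kind] counts the gate index while it is read, with one
    spare value. *)
Record regs (m ar : nat) := Regs {
  par : bool; ge1 : bool; ge2 : bool; carry : bool; fin : bool;
  slots : {ffun 'I_ar -> bool}; kind : 'I_m.+1 }.

Section RegsFinite.
Variables m ar : nat.
Definition regs_code (r : regs m ar) :=
  (par r, ge1 r, ge2 r, carry r, fin r, slots r, kind r).
Definition regs_decode
    (t : bool * bool * bool * bool * bool * {ffun 'I_ar -> bool} * 'I_m.+1) :
    regs m ar :=
  let: (a, b, c, e, f, g, h) := t in Regs a b c e f g h.
Lemma regs_codeK : cancel regs_code regs_decode. Proof. by case. Qed.
HB.instance Definition _ := Finite.copy (regs m ar) (can_type regs_codeK).
End RegsFinite.

Section Program.

Variables (m : nat) (G : 'I_m -> gate_kind) (d : nat).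

Definition max_arity : nat := \max_(i < m) arity (G i).

Local Notation X := (name m max_arity d).
Local Notation D := (regs m max_arity).
Local Notation prog := (prog X D).
Implicit Types (r : D) (v : view X).

Definition act (f : view X -> X -> instr) : prog := Do (fun r v => (r, f v)).

Definition skip : prog := act (fun _ _ => Keep).

Definition rewinds (P : pred X) : prog :=
  foldr (fun x => Seq (Rewind D x)) skip (enum P).

(** Two families of fuel tapes are needed because the enumeration of the counter runs inside the
    loop over the attempts. *)
Definition nest (b : bool) (body : prog) : prog :=
  foldr (fun j p => Seq (For (TF b j) predT p) (Rewind D (TF b j))) body (enum 'I_d).

(** The encoding does not announce the number of gates, so a first pass measures the whole input on
    [TH]. The delimiter of the unary number contributes the extra cell that makes the fuel tapes N +
    1 long. *)
Definition read_size : prog :=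
  Seq (Seq (For TI predT (act (fun v y => if y is TH then Append true else Keep)))
           (Rewind D TI))
  (Seq (Seq (For TI id (act (fun v y =>
               match y with TU | TF _ _ => Append true | _ => Keep end)))
            (act (fun v y =>
               match y with TI => Forward | TF _ _ => Append true | _ => Keep end)))
       (rewinds (fun y => match y with TU | TF _ _ | TH => true | _ => false end))).

Definition read_mask : prog :=
  Seq (Seq (For TU predT (act (fun v y =>
         match y with
         | TI => Forward
         | TK | TM => Push (v TI == Some true)
         | TV | TZ | TX | TJ | TS | TW | TO => Push false
         | _ => Keep
         end)))
       (Rewind D TU))
      (act (fun v y => if y is TM then Over false else Keep)).

Definition set_kind (k : 'I_m.+1) r : D :=
  Regs (par r) (ge1 r) (ge2 r) (carry r) (fin r) (slots r) k.

Definition gate_arity (k : nat) : nat :=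
  if insub k is Some i then arity (G i) else 0.

Definition push_slot (l : 'I_max_arity) (b : bool) (y : X) : instr :=
  if y is TQ _ l' then (if l' == l then Push b else Keep) else Keep.

(** The head of [TU] follows the unary wire number; what is left of [TU] then pads the row to length
    N. A slot beyond the arity gets a row without a mark, so that all rows of a gate have the same
    length. *)
Definition read_slot (l : 'I_max_arity) : prog :=
  Seq (If (fun r v => l < gate_arity (kind r))
         (Seq (For TI id (act (fun v y => if y is TU then Forward else push_slot l false y)))
              (act (fun v y =>
                 match y with TU | TI => Forward | _ => push_slot l true y end)))
         skip)
      (Seq (For TU predT (act (fun v y => push_slot l false y))) (Rewind D TU)).

(** The kind is counted in a register that saturates at [m], so it stays finite on malformed input
    too. *)
Definition read_gate : prog :=
  Seq (Do (fun r v => (set_kind ord0 r, fun y => if y is TI then Forward else Keep)))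
  (Seq (For TI id (Do (fun r v => (set_kind (inord (minn (kind r).+1 m)) r, fun=> Keep))))
  (Seq (act (fun v y => if y is TI then Forward else Keep))
  (Seq (foldr (fun l => Seq (read_slot l)) skip (enum 'I_max_arity))
       (Do (fun r v => (r, fun y =>
          match y with TG => Push true | TT i => Push (i == kind r :> nat) | _ => Keep end)))))).

Definition read_gates : prog :=
  For TH predT (If (fun r v => v TI == Some true) read_gate skip).

(** Four cells per wire, for the four random words of an attempt. *)
Definition push_random : prog :=
  Seq (For TU predT
        (let p := act (fun v y => if y is TR then Append true else Keep) in
         Seq p (Seq p (Seq p p))))
      (Rewind D TU).

(** Two cells per round: one term can advance [TB] twice, once for a negative sign and once for the
    comparison with the random numbers. *)
Definition push_counters : prog :=
  let p := act (fun v y => match y with TA | TB => Append true | _ => Keep end) in Seq p p.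

Definition prepare : prog :=
  Seq read_size (Seq read_mask (Seq read_gates
    (Seq (Seq (nest false push_random) (nest true push_counters))
         (rewinds (fun y => match y with TR | TA | TB => true | _ => false end))))).

Definition load (x : X) : prog :=
  Seq (For TU predT (act (fun v y =>
         if y == x then OverF (v TR == Some true)
         else if y is TR then Forward else Keep)))
      (rewinds (fun y => (y == x) || (y == TU))).

Definition set_slots (f : 'I_max_arity -> bool) r : D :=
  Regs (par r) (ge1 r) (ge2 r) (carry r) (fin r) [ffun l => f l] (kind r).

Definition unpermute (i : 'I_m) (f : nat -> bool) : seq bool :=
  (gate_perm (G i))^-1%g [tuple f l | l < arity (G i)].

Definition slot_bit r (l : nat) : bool := if insub l is Some l' then slots r l' else false.

(** The heads on the rows advance together with [TW], so after both passes they stand at the rows of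
    the next gate and no gate has to be addressed. Pushing has put the last gate on top, which is
    the order in which the inverse circuit needs them. *)
Definition undo_gate : prog :=
  Seq (For TW predT (Do (fun r v =>
        (set_slots (fun l => if v (TQ false l) == Some true then v TW == Some true
                             else slots r l) r,
         fun y => if y is TQ false _ then Forward else Keep))))
  (Seq (Rewind D TW)
  (Seq (Do (fun r v =>
        (if [pick i | v (TT i) == Some true] is Some i then
           set_slots (fun l => nth false (unpermute i (slot_bit r)) l) r
         else r,
         fun y => if y is TT _ then Forward else Keep)))
  (Seq (For TW predT (Do (fun r v => (r, fun y =>
         match y with
         | TQ true _ => Forward
         | TW => if [pick l | v (TQ true l) == Some true] is Some l then Over (slots r l)
                 else Keep
         | _ => Keep
         end))))
       (Rewind D TW)))).

Definition undo_circuit : prog :=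
  Seq (For TG predT undo_gate)
      (rewinds (fun y => match y with TG | TT _ | TQ _ _ => true | _ => false end)).

(** [TZ] carries the word x of the character, and its cell 0, the last wire, supplies the random
    sign with which [par] starts. Cells come least significant first, so in a comparison a later
    differing cell overrides the earlier ones; the initial [true] lets equality count. *)
Definition sweep : prog :=
  Seq (Do (fun r v =>
        (Regs (v TZ == Some true) true true (carry r) (fin r) (slots r) (kind r), fun=> Keep)))
  (Seq (For TU predT (Do (fun r v =>
        let k := v TM == Some true in
        let s := v TS == Some true in
        (Regs (par r (+) [&& k, s & v TZ == Some true])
           (if k && (s != (v TX == Some true)) then s else ge1 r)
           (if k && (s != (v TJ == Some true)) then s else ge2 r)
           (carry r) (fin r) (slots r) (kind r),
         fun y => match y with
         | TW => OverF ((v TV == Some true) (+) (k && s))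
         | TV | TS | TM | TZ | TX | TJ => Forward
         | _ => Keep end))))
       (rewinds (fun y =>
          match y with TU | TW | TV | TS | TM | TZ | TX | TJ => true | _ => false end))).

Definition set_carry (b : bool) r : D :=
  Regs (par r) (ge1 r) (ge2 r) b (fin r) (slots r) (kind r).

Definition increment : prog :=
  Seq (For TM predT (Do (fun r v =>
        let k := v TM == Some true in
        let s := v TS == Some true in
        (set_carry (if k then carry r && s else carry r) r,
         fun y => if y is TS then OverF (if k then s (+) carry r else s) else Keep))))
      (rewinds (fun y => match y with TM | TS => true | _ => false end)).

(* The first cell of [TW] holds the last bit of the preimage, so a zero counts a term
   of the sum: on [TA] if it is positive and on [TB] if it is negative.  The second
   step counts on [TB] the words that are at least one of the two random words. *)
Definition record_term : prog :=
  Seq (Do (fun r v => (r, fun y =>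
        match y with
        | TA => if (v TW == Some false) && ~~ par r then Forward else Keep
        | TB => if (v TW == Some false) && par r then Forward else Keep
        | _ => Keep
        end)))
      (Do (fun r v => (set_carry true r, fun y =>
        if y is TB then (if ge1 r || ge2 r then Forward else Keep) else Keep))).

Definition term : prog := Seq sweep (Seq undo_circuit (Seq record_term increment)).

(** The last wire of the outcome is read off v and the front wires off x; the restriction to K is
    left to [print]. *)
Definition accept : prog :=
  Seq (Do (fun r v => (Regs (par r) (ge1 r) (ge2 r) (carry r) true (slots r) (kind r),
                       fun=> Keep)))
  (Seq (For TU predT (act (fun v y =>
         match y with TO => OverF (v TZ == Some true) | TZ => Forward | _ => Keep end)))
  (Seq (rewinds (fun y => match y with TU | TO | TZ => true | _ => false end))
       (act (fun v y => if y is TO then Over (v TV == Some true) else Keep)))).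

(* [TA] is exhausted first, or at the same time, exactly if its count is not less. *)
Definition decide : prog :=
  Seq (For TB predT (act (fun v y => if y is TA then Forward else Keep)))
  (Seq (If (fun r v => (v TA == None) && ~~ fin r) accept skip)
       (rewinds (fun y => match y with TA | TB => true | _ => false end))).

(** After 2^k terms the counter has overflowed: [carry] makes the remaining rounds idle, and the
    counter is back at zero for the next attempt. *)
Definition attempt : prog :=
  Seq (Seq (load TV) (Seq (load TZ) (Seq (load TX) (load TJ))))
  (Seq (Do (fun r v => (set_carry false r, fun=> Keep)))
  (Seq (nest true (If (fun r v => ~~ carry r) term skip)) decide)).

Definition print : prog :=
  For TK predT (act (fun v y =>
    match y with
    | TI => if v TK == Some true then Push (v TO == Some true) else Keep
    | TO => Forward
    | _ => Keep
    end)).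

(** The loop on [TI] takes its head past the rest of the input, which would otherwise be read as a
    continuation of the output. *)
Definition sample : prog :=
  Seq (Seq (Rewind D TR) (Seq (nest false attempt) (For TI predT skip))) print.

Lemma wf_rewinds P : wf (rewinds P).
Proof. by rewrite /rewinds; elim: (enum P). Qed.

Lemma fixes_rewinds x P : ~~ P x -> fixes x (rewinds P).
Proof.
move=> Px; rewrite /rewinds.
have : x \notin enum P by rewrite mem_enum.
by elim: (enum P) => //= y s IH; rewrite in_cons negb_or eq_sym => /andP[? /IH].
Qed.

Lemma safe_rewinds L P : subpred P L -> safe L (rewinds P).
Proof.
move=> PL; rewrite /rewinds; have : all L (enum P).
  by apply/allP => x; rewrite mem_enum; apply: PL.
by elim: (enum P) => //= y s IH /andP[? /IH].
Qed.

Lemma fixes_nest x b body : (forall j, x <> TF b j) -> fixes x body -> fixes x (nest b body).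
Proof.
move=> hx fx; rewrite /nest; elim: (enum 'I_d) => //= j s IH.
by do !split=> //; apply/eqP => e; apply: (hx j).
Qed.

Lemma wf_nest b body : (forall j, fixes (TF b j) body) -> wf body -> wf (nest b body).
Proof.
move=> fx wb; rewrite /nest; elim: (enum 'I_d) (enum_uniq 'I_d) => //= j s IH /andP[js us].
do !split=> //; last exact: IH.
elim: s js {IH us} => //= k s IH; rewrite in_cons negb_or => /andP[jk js].
have e : TF b k != TF b j :> X by apply: contraNneq jk => -[->].
by do !split=> //; apply: IH.
Qed.

Lemma safe_nest (L : pred X) b body :
  (forall j, L (TF b j)) -> safe L body -> safe L (nest b body).
Proof. by move=> hL sb; rewrite /nest; elim: (enum 'I_d) => //= j s IH. Qed.

Ltac solve_wf :=
  repeat first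
    [ exact: wf_rewinds
    | match goal with |- wf (nest _ _) => apply: wf_nest end
    | match goal with |- fixes _ (nest _ _) => apply: fixes_nest end
    | match goal with |- fixes _ (rewinds _) => apply: fixes_rewinds end
    | split | done
    | match goal with |- forall j : ordinal _, _ => move=> ? end
    | progress rewrite /= ].

Lemma fixes_slots : fixes TH (foldr (fun l => Seq (read_slot l)) skip (enum 'I_max_arity)).
Proof. by elim: (enum _) => //= l' s IH; do !split. Qed.

Lemma wf_slots : wf (foldr (fun l => Seq (read_slot l)) skip (enum 'I_max_arity)).
Proof. by elim: (enum _) => //= l s IH; do !split. Qed.

Lemma wf_prepare : wf prepare.
Proof.
rewrite /prepare; solve_wf.
- exact: fixes_slots.
- exact: wf_slots.
Qed.

Lemma wf_sample : wf sample.
Proof.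
rewrite /sample; solve_wf.
all: move=> r v; by case: pickP.
Qed.

Lemma polytime_prepare : polytime prepare.
Proof.
rewrite /prepare; apply: polytime_seq; last apply: polytime_seq;
  last apply: polytime_seq; last apply: polytime_seq.
- apply: polytime_seq; last apply: polytime_seq.
  + apply: (@polytime_safe _ _ (pred1 TI)); do !split=> //=.
    by move=> _ _ y /eqP ->.
  + apply: (@polytime_safe _ _ (pred1 TI)); do !split=> //=;
    by move=> _ _ y /eqP ->.
  + by apply: (@polytime_safe _ _ predT); apply: safe_rewinds.
- apply: polytime_seq.
    apply: (@polytime_safe _ _ (pred1 TU)); do !split=> //=.
    by move=> _ _ y /eqP ->.
  apply: (@polytime_safe _ _ predT) => /= _ _ y _; by case: y.
- apply: (@polytime_safe _ _ (fun y : X => match y with TH | TI | TU => true | _ => false end)).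
  have h : safe (fun y : X => match y with TH | TI | TU => true | _ => false end)
    (foldr (fun l => Seq (read_slot l)) skip (enum 'I_max_arity)).
    elim: (enum _) => //= l s IH; by do !split=> //=; move=> ? ? y; case: y.
  do !split=> //=; by move=> ? ? y; case: y.
- apply: (@polytime_safe _ _ (fun y : X => match y with TF _ _ | TU => true | _ => false end)).
  apply: conj; apply: safe_nest => //.
    by do !split=> //; move=> ? ? y; case: y.
  by do !split=> //; move=> ? ? y; case: y.
- by apply: (@polytime_safe _ _ predT); apply: safe_rewinds.
Qed.

Lemma safe_stable (f : view X -> X -> instr) (L : pred X) :
  (forall v y, ~~ grows (f v y)) -> safe L (act f).
Proof. by move=> h r v y _; apply: h. Qed.

Lemma polytime_sample : polytime sample.
Proof.
rewrite /sample; apply: polytime_seq; last first.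
  apply: (@polytime_safe _ _ (pred1 TK)); split=> //=.
  by move=> _ _ y /eqP ->.
(* Before printing no instruction lengthens a tape, so every tape may drive loops. *)
apply: (@polytime_safe _ _ predT).
have hl x : safe predT (load x).
  apply: conj; last exact: safe_rewinds.
  by apply: conj => //; apply: safe_stable => v y; case: ifP => // _; case: y.
apply: conj; first by [].
apply: conj; last by [].
apply: safe_nest => //; apply: conj; first by do 3 (apply: conj; first exact: hl); apply: hl.
apply: conj => //; apply: conj.
  apply: safe_nest => //; apply: conj; last by [].
  apply: conj; last apply: conj.
  - apply: conj => //; apply: conj; last exact: safe_rewinds.
    by apply: conj => // r v y _; case: y.
  - apply: conj; last exact: safe_rewinds.
    apply: conj => //; do !apply: conj => //; move=> r v y _ /=.
    + by case: y => // -[].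
    + by case: y.
    + by case: y => // [|[]] //; case: pickP.
  - apply: conj; first by do !apply: conj=> // r v y _; case: y => //=; case: ifP.
    by apply: conj; [apply: conj=> // r v y _; case: y|exact: safe_rewinds].
apply: conj; first by apply: conj=> //; apply: safe_stable => v y; case: y.
apply: conj; last exact: safe_rewinds.
apply: conj=> //; apply: conj=> //; apply: conj.
  by apply: conj=> //; apply: safe_stable => v y; case: y.
apply: conj; first exact: safe_rewinds.
by apply: safe_stable => v y; case: y.
Qed.

End Program.

(** * Correctness of the parsing programs *)

Section GenericSpecs.

Variables X D : finType.
Implicit Types (p : prog X D) (s : store X D).

Lemma store_ext s s' : s.1 = s'.1 -> s.2 =1 s'.2 -> s = s'.
Proof. by case: s s' => r T [r' T'] /= -> /funext ->. Qed.

Lemma rounds_all z : rounds predT z = size z.2.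
Proof. by rewrite /rounds; elim: z.2 => //= b v ->. Qed.

Lemma rounds_unary u k v : rounds id (u, nseq k true ++ false :: v) = k.
Proof. by rewrite /rounds /=; elim: k => //= k ->. Qed.

Lemma den_for x p s : den (For x predT p) s =
  iter (size (s.2 x).2) (fun s => forward x (den p s)) s.
Proof. by rewrite /= rounds_all. Qed.

Lemma den_seq p q s : den (Seq p q) s = den q (den p s).
Proof. by []. Qed.

Lemma catrevK (A : Type) (v : seq A) : catrev (catrev v [::]) [::] = v.
Proof. by rewrite !catrevE !cats0 revK. Qed.

Lemma nseq_catS (A : Type) k (a : A) t : nseq k a ++ a :: t = nseq k.+1 a ++ t.
Proof. by elim: k => //= k ->. Qed.

Lemma catrev_nseq (A : Type) k (a : A) t : catrev (nseq k a) t = nseq k a ++ t.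
Proof. by elim: k t => //= k IH t; rewrite IH nseq_catS. Qed.

End GenericSpecs.

Section Parsing.

Variables (m : nat) (G : 'I_m -> gate_kind) (d : nat).

Local Notation ar := (max_arity G).
Local Notation X := (name m ar d).
Local Notation D := (regs m ar).
Local Notation prog := (prog X D).
Implicit Types (s : store X D).

Lemma den_skip s : den (skip G d) s = s.
Proof. by apply: store_ext. Qed.

Lemma den_rewinds P s :
  den (rewinds (P : pred X)) s = (s.1, fun y => if P y then rewind (s.2 y) else s.2 y).
Proof.
rewrite /rewinds.
suff h l : uniq l -> den (foldr (fun x => Seq (Rewind D x)) (skip G d) l) s =
    (s.1, fun y => if y \in l then rewind (s.2 y) else s.2 y).
  by rewrite h ?enum_uniq //; apply: store_ext => //= y; rewrite mem_enum.
elim: l s => [|x l IH] s /=; first by move=> _; apply: store_ext.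
move=> /andP[xl ul]; rewrite IH //; apply: store_ext => //= y.
rewrite in_cons /upd; case: eqP => [->|_] //=.
by rewrite (negPf xl).
Qed.

Definition insensitive b (P : store X D -> Prop) : Prop := forall s s', s.1 = s'.1 ->
  (forall y, (forall j, y <> TF b j) -> s.2 y = s'.2 y) -> P s -> P s'.

(** The invariant counts the completed rounds. It must not see the fuel tapes, whose heads move
    between two rounds, and the body must leave them alone. *)
Lemma nest_rule b (body : prog) (P : nat -> store X D -> Prop) k s :
  (forall i, insensitive b (P i)) ->
  (forall i s, P i s -> P i.+1 (den body s)) ->
  (forall s j, (den body s).2 (TF b j) = s.2 (TF b j)) ->
  (forall j, s.2 (TF b j) = ([::], nseq k true)) ->
  P 0 s ->
  P (k ^ d) (den (nest b body) s) /\
  (forall j, (den (nest b body) s).2 (TF b j) = ([::], nseq k true)).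
Proof.
move=> ins step frame; rewrite /nest.
set nl := foldr _ body.
have fr l s0 j : j \notin l -> (den (nl l) s0).2 (TF b j) = s0.2 (TF b j).
  elim: l s0 => [|i l IH] s0; first by move=> _; apply: frame.
  rewrite in_cons negb_or => /andP[ji jl].
  have e : TF b j == TF b i :> X = false by apply/eqP => -[]; apply/eqP.
  rewrite [nl _]/= den_seq -/(nl l) den_for [LHS]/= /upd e.
  by elim: (size _) => //= n IHn; rewrite /upd e IH.
(* Generalised to a sublist of the loops and to any number [i] of rounds already done, because an
   inner loop is entered anew in each round of an outer one. *)
suff h l i s0 : uniq l -> (forall j, j \in l -> s0.2 (TF b j) = ([::], nseq k true)) ->
    P i s0 -> P (i + k ^ size l) (den (nl l) s0) /\
    (forall j, (den (nl l) s0).2 (TF b j) = s0.2 (TF b j)).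
  move=> hs h0; have [h1 h2] := h (enum 'I_d) 0 s (enum_uniq 'I_d) (fun j _ => hs j) h0.
  rewrite add0n -cardE card_ord in h1; split=> // j; by rewrite h2 hs.
elim: l i s0 => [|x l IH] i s0.
  by move=> _ _ Pi; rewrite expn0 addn1; split; [apply: step|move=> j; apply: frame].
move=> /= /andP[xl ul] hs Pi.
rewrite -/nl rounds_all (hs x (mem_head _ _)) size_nseq /=.
have main n : n <= k -> let s' := iter n (fun s => forward (TF b x) (den (nl l) s)) s0 in
    [/\ P (i + n * k ^ size l) s', s'.2 (TF b x) = (nseq n true, nseq (k - n) true)
      & forall j, j != x -> s'.2 (TF b j) = s0.2 (TF b j)].
  elim: n => [|n IHn] /=.
    by rewrite addn0 subn0; split=> //; apply: hs; rewrite mem_head.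
  move=> nk; have [h1 h2 h3] := IHn (ltnW nk).
  set s1 := iter _ _ _ in h1 h2 h3 *.
  have [|g1 g2] := IH _ s1 ul _ h1.
    move=> j jl; rewrite h3; last by apply: contraNneq xl => <-.
    by apply: hs; rewrite in_cons jl orbT.
  split.
  - rewrite mulSn addnCA addnC; apply: ins (g1) => //= y hy; rewrite /upd.
    by case: eqP => // e; case: (hy x).
  - rewrite /upd eqxx g2 h2 -[k - n]prednK ?subn_gt0 //=.
    by rewrite subnS.
  - by move=> j jx; rewrite /upd (_ : TF b j == TF b x = false) ?g2 ?h3 //;
      apply/eqP => -[]; apply/eqP.
have [h1 h2 h3] := main k (leqnn k).
split.
  rewrite expnS; apply: ins h1 => //= y hy; rewrite /upd.
  by case: eqP => // e; case: (hy x).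
move=> j; rewrite /upd; case: eqP => [[->]|/eqP jx].
  by rewrite h2 subnn hs ?mem_head // /rewind /= catrev_nseq cats0.
by rewrite h3 //; apply: contraNneq jx => ->.
Qed.

Lemma copy_loop w s u h : s.2 TI = (u, w) -> s.2 TH = (h, [::]) ->
  den (For TI predT (act (fun v y => if y is TH then Append true else Keep))) s =
  (s.1, fun y => match y with
     | TI => (catrev w u, [::]) | TH => (nseq (size w) true ++ h, [::]) | _ => s.2 y end).
Proof.
rewrite den_for => e1; rewrite e1 [size _]/=.
elim: w s u h e1 => [|b w IH] s u h e1 e2.
  by apply: store_ext => //; case => * /=; rewrite ?e1 ?e2.
rewrite [size _]/= iterSr (IH _ (b :: u) (true :: h)); first last.
- by rewrite /= /upd /= e2.
- by rewrite /= /upd /= e1.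
apply: store_ext => //; case => //=.
by rewrite nseq_catS.
Qed.

Lemma den_for_unary x (p : prog) s u k r : s.2 x = (u, nseq k true ++ false :: r) ->
  den (For x id p) s = iter k (fun s => forward x (den p s)) s.
Proof. by move=> /= ->; rewrite rounds_unary. Qed.

Lemma size_loop k s u r a f :
  s.2 TI = (u, nseq k true ++ false :: r) -> s.2 TU = (a, [::]) ->
  (forall b j, s.2 (TF b j) = (f, [::])) ->
  den (For TI id (act (fun v y =>
    match y with TU | TF _ _ => Append true | _ => Keep end))) s =
  (s.1, fun y => match y with
     | TI => (nseq k true ++ u, false :: r) | TU => (nseq k true ++ a, [::])
     | TF _ _ => (nseq k true ++ f, [::]) | _ => s.2 y end).
Proof.
move=> e1; rewrite (den_for_unary _ e1).
elim: k s u a f e1 => [|k IH] s u a f e1 e2 e3.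
  by apply: store_ext => //; case => * /=; rewrite ?e1 ?e2 ?e3.
rewrite iterSr (IH _ (true :: u) (true :: a) (true :: f)); first last.
- by move=> b j; rewrite /= /upd /= e3.
- by rewrite /= /upd /= e2.
- by rewrite /= /upd /= e1.
by apply: store_ext => //; case => //= *; rewrite nseq_catS.
Qed.

Lemma den_read_size d0 N r (w := nseq N true ++ false :: r) :
  den (read_size G d) (start_state TI d0 w) =
  (d0, fun y => match y with
     | TI => (false :: nseq N true, r) | TU => ([::], nseq N true)
     | TF _ _ => ([::], nseq N.+1 true) | TH => ([::], nseq (size w) true)
     | _ => ([::], [::]) end).
Proof.
rewrite /read_size !den_seq (copy_loop (w := w) (u := [::]) (h := [::])) //.
rewrite (size_loop (k := N) (u := [::]) (r := r) (a := [::]) (f := [::])) //; last first.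
  by rewrite [LHS]/= /upd /= /rewind /= catrevK.
rewrite den_rewinds; apply: store_ext => //.
by case => *; rewrite /= /upd /= /rewind /= ?cats0 ?catrev_nseq ?cats0 ?nseq_catS ?cats0.
Qed.

Definition blank_word (y : X) : bool :=
  match y with TV | TZ | TX | TJ | TS | TW | TO => true | _ => false end.

Lemma mask_loop w k s u0 u r kv z :
  s.2 TU = (u0, w) -> s.2 TI = (u, k ++ r) -> size k = size w ->
  s.2 TK = ([::], kv) -> s.2 TM = ([::], kv) ->
  (forall y, blank_word y -> s.2 y = ([::], nseq z false)) ->
  den (For TU predT (act (fun v y =>
         match y with
         | TI => Forward
         | TK | TM => Push (v TI == Some true)
         | TV | TZ | TX | TJ | TS | TW | TO => Push false
         | _ => Keep
         end))) s =
  (s.1, fun y => match y with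
     | TU => (catrev w u0, [::]) | TI => (catrev k u, r)
     | TK | TM => ([::], catrev k kv)
     | TV | TZ | TX | TJ | TS | TW | TO => ([::], nseq (size w + z) false)
     | _ => s.2 y end).
Proof.
rewrite den_for => e1; rewrite e1 [size _]/=.
elim: w k s u0 u kv z e1 => [|b w IH] [|a k] s u0 u kv z e1 e2 // ek e3 e4 e5.
  by apply: store_ext => //; case => * //=; rewrite ?e1 ?e2 ?e3 ?e4 // e5.
case: ek => ek; rewrite [size _]/= iterSr (IH k _ (b :: u0) (a :: u) (a :: kv) z.+1) //; first last.
- by case=> //= _; rewrite /upd /= e5.
- by rewrite /= /upd /= e4 /view_of e2 /=; case: (a).
- by rewrite /= /upd /= e3 /view_of e2 /=; case: (a).
- by rewrite /= /upd /= e2.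
- by rewrite /= /upd /= e1.
by apply: store_ext => //; case => //= *; rewrite addnS.
Qed.

Lemma den_read_mask N k s u r : size k = N.+1 ->
  s.2 TU = ([::], nseq N.+1 true) -> s.2 TI = (u, k ++ r) ->
  s.2 TK = ([::], [::]) -> s.2 TM = ([::], [::]) ->
  (forall y, blank_word y -> s.2 y = ([::], [::])) ->
  den (read_mask G d) s =
  (s.1, fun y => match y with
     | TI => (catrev k u, r)
     | TK => ([::], rev k) | TM => ([::], false :: behead (rev k))
     | TV | TZ | TX | TJ | TS | TW | TO => ([::], nseq N.+1 false)
     | _ => s.2 y end).
Proof.
move=> sk e1 e2 e3 e4 e5; rewrite /read_mask !den_seq.
rewrite (mask_loop (z := 0) e1 e2 _ e3 e4) ?size_nseq //.
apply: store_ext => //; case => //=; rewrite /upd /= ?addn0 //.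
  by rewrite e1 -[in RHS](catrevK (nseq N.+1 true)).
by rewrite -/(rev k); case E: (rev k) => [|//]; move: sk; rewrite -size_rev E.
Qed.

(* [None] stands for a slot beyond the arity of the gate. *)
Definition slot_code (o : option nat) : seq bool := if o is Some w then unary w else [::].

(** The indicator word in wire order; pushing it with [catrev] leaves it on the tape in the reversed
    order of all other words. *)
Definition slot_row (N : nat) (o : option nat) : seq bool :=
  if o is Some w then nseq w false ++ true :: nseq (N - w.+1) false else nseq N false.

Lemma wire_loop l k s u0 w u r (q : bool -> seq bool) :
  s.2 TI = (u, nseq k true ++ false :: r) -> s.2 TU = (u0, nseq k true ++ w) ->
  (forall b, s.2 (TQ b l) = ([::], q b)) ->
  den (For TI id (act (fun v y => if y is TU then Forward else push_slot l false y))) s =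
  (s.1, fun y => match y with
     | TI => (nseq k true ++ u, false :: r) | TU => (nseq k true ++ u0, w)
     | TQ b l' => if l' == l then ([::], nseq k false ++ q b) else s.2 y
     | _ => s.2 y end).
Proof.
move=> e1; rewrite (den_for_unary _ e1).
elim: k s u u0 q e1 => [|k IH] s u u0 q e1 e2 e3.
  apply: store_ext => //; case => * /=; rewrite ?e1 ?e2 //.
  by case: eqP => // ->; rewrite e3.
rewrite iterSr (IH _ (true :: u) (true :: u0) (fun b => false :: q b)); first last.
- by move=> b; rewrite /= /upd /= eqxx e3.
- by rewrite /= /upd /= e2.
- by rewrite /= /upd /= e1.
apply: store_ext => //; case => //=; rewrite ?nseq_catS // => b l'.
by rewrite /upd /=; case: eqP => //= _; rewrite nseq_catS.
Qed.

Lemma pad_loop l w s u0 (q : bool -> seq bool) :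
  s.2 TU = (u0, w) -> (forall b, s.2 (TQ b l) = ([::], q b)) ->
  den (For TU predT (act (fun v y => push_slot l false y))) s =
  (s.1, fun y => match y with
     | TU => (catrev w u0, [::])
     | TQ b l' => if l' == l then ([::], nseq (size w) false ++ q b) else s.2 y
     | _ => s.2 y end).
Proof.
rewrite den_for => e1; rewrite e1 [size _]/=.
elim: w s u0 q e1 => [|a w IH] s u0 q e1 e3.
  apply: store_ext => //; case => * /=; rewrite ?e1 ?e2 //.
  by case: eqP => // ->; rewrite e3.
rewrite [size _]/= iterSr (IH _ (a :: u0) (fun b => false :: q b)); first last.
- by move=> b; rewrite /= /upd /= eqxx e3.
- by rewrite /= /upd /= e1.
apply: store_ext => //; case => //= b l'.
by rewrite /upd /=; case: eqP => //= _; rewrite nseq_catS.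
Qed.

Lemma den_read_slot (l : 'I_ar) N s u r o :
  (l < gate_arity G (kind s.1)) = isSome o ->
  (if o is Some w then w < N else true) ->
  s.2 TI = (u, slot_code o ++ r) -> s.2 TU = ([::], nseq N true) ->
  (forall b, (s.2 (TQ b l)).1 = [::]) ->
  den (read_slot d l) s =
  (s.1, fun y => match y with
     | TI => (catrev (slot_code o) u, r)
     | TQ b l' => if l' == l then ([::], catrev (slot_row N o) (s.2 y).2) else s.2 y
     | _ => s.2 y end).
Proof.
move=> hl hw e1 e2 e3; rewrite /read_slot den_seq.
have e3' b : s.2 (TQ b l) = ([::], (s.2 (TQ b l)).2).
  by have := e3 b; case: (s.2 _) => a c /= ->.
have -> : den (If (fun r v => l < gate_arity G (kind r))
         (Seq (For TI id (act (fun v y => if y is TU then Forward else push_slot l false y)))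
              (act (fun v y =>
                 match y with TU | TI => Forward | _ => push_slot l true y end)))
         (skip G d)) s =
  (s.1, fun y => match y with
     | TI => (catrev (slot_code o) u, r)
     | TU => if o is Some w then (nseq w.+1 true, nseq (N - w.+1) true) else s.2 y
     | TQ b l' => if o is Some w then
                    (if l' == l then ([::], true :: nseq w false ++ (s.2 y).2) else s.2 y)
                  else s.2 y
     | _ => s.2 y end).
  rewrite [LHS]/= hl; case: o hl hw e1 => [w|] /= hl hw e1; last first.
    by rewrite -[(_, _)]/(den (skip G d) s) den_skip; apply: store_ext => //; case=> * //=; rewrite e1.
  rewrite /unary -catA /= in e1.
  have eN : nseq N true = nseq w true ++ true :: nseq (N - w.+1) true.
    by rewrite nseq_catS -nseqD subnKC.
  rewrite eN in e2.
  rewrite -/(den (For TI id (act (fun v y => if y is TU then Forward else push_slot l false y))) s).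
  rewrite (wire_loop e1 e2 e3'); apply: store_ext => //; case=> * //=.
  - by rewrite /unary catrevE rev_cat rev_nseq.
  - by rewrite cats0.
  - by case: eqP => [->|].
rewrite den_seq (@pad_loop l (if o is Some w then nseq (N - w.+1) true else nseq N true)
   _ (if o is Some w then nseq w.+1 true else [::])
   (fun b => (if o is Some w then true :: nseq w false else [::]) ++ (s.2 (TQ b l)).2)); first last.
- by move=> b; case: o {hl hw e1} => [w|] /=; rewrite ?eqxx // -e3'.
- by case: o {hl hw e1} => [w|] //=.
apply: store_ext => //; case=> //= *; rewrite /upd /=.
- rewrite e2; case: o {hl e1} hw => [w|] hw; rewrite /rewind /= !catrev_nseq ?cats0 //.
    by rewrite nseq_catS -nseqD catrev_nseq cats0 addSnnS subnK.
  by rewrite catrev_nseq cats0.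
- case: eqP => [->|_] //=; case: o {hl e1} hw => [w|] hw /=; rewrite ?size_nseq //.
    by rewrite catrevE rev_cat rev_cons !rev_nseq cat_rcons -catA.
  by rewrite catrev_nseq.
Qed.

End Parsing.

(** * Correctness of the preparation: gates, random tape and counters *)

Section Preparation.

Variables (m : nat) (G : 'I_m -> gate_kind) (d : nat).

Local Notation ar := (max_arity G).
Local Notation X := (name m ar d).
Local Notation D := (regs m ar).
Local Notation prog := (prog X D).
Implicit Types (s : store X D).

(** Stronger than [fixes]: not even the scanned cell may change. This is the syntactic source of the
    frame condition in [nest_rule]. *)
Fixpoint avoids (x : X) (p : prog) : Prop :=
  match p with
  | Do f => forall r v, (f r v).2 x = Keep
  | Seq p q | If _ p q => avoids x p /\ avoids x q
  | Rewind y => y != x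
  | For y _ p => y != x /\ avoids x p
  end.

Lemma den_avoids x p s : avoids x p -> (den p s).2 x = s.2 x.
Proof.
elim: p s => [f|p IHp q IHq|b p IHp q IHq|y|y P p IHp] s /=.
- by move=> ->.
- by move=> [hp hq]; rewrite IHq ?IHp.
- by move=> [hp hq]; case: ifP => _; [apply: IHp|apply: IHq].
- by rewrite /upd eq_sym => /negPf ->.
- move=> [yx hp]; elim: (rounds _ _) => //= k IH.
  by rewrite /upd eq_sym (negPf yx) IHp.
Qed.

Lemma avoids_rewinds x (P : pred X) : ~~ P x -> avoids x (rewinds P).
Proof.
move=> Px; rewrite /rewinds; have : x \notin enum P by rewrite mem_enum.
by elim: (enum P) => //= y s IH; rewrite in_cons negb_or eq_sym => /andP[? /IH].
Qed.

Lemma avoids_nest x b body : (forall j, x <> TF b j) -> avoids x body -> avoids x (nest b body).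
Proof.
move=> hx fx; rewrite /nest; elim: (enum 'I_d) => //= j s IH.
by do !split=> //; apply/eqP => e; apply: (hx j).
Qed.

Lemma den_slots N (wire : nat -> option nat) (ls : seq 'I_ar) s u r :
  uniq ls ->
  (forall l, l \in ls -> (l < gate_arity G (kind s.1)) = isSome (wire l)) ->
  (forall l, if wire l is Some w then w < N else true) ->
  s.2 TI = (u, flatten [seq slot_code (wire l) | l : 'I_ar <- ls] ++ r) ->
  s.2 TU = ([::], nseq N true) -> (forall b l, (s.2 (TQ b l)).1 = [::]) ->
  den (foldr (fun l => Seq (read_slot d l)) (skip G d) ls) s =
  (s.1, fun y => match y with
     | TI => (catrev (flatten [seq slot_code (wire l) | l : 'I_ar <- ls]) u, r)
     | TQ b l => if l \in ls then ([::], catrev (slot_row N (wire l)) (s.2 y).2) else s.2 y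
     | _ => s.2 y end).
Proof.
elim: ls s u => [|l ls IH] s u.
  by move=> *; rewrite [foldr _ _ _]/= den_skip; apply: store_ext => //; case.
rewrite [uniq _]/= => /andP[nl ul] hk hw; rewrite [flatten _]/= -catA => e1 e2 e3.
rewrite [foldr _ _ _]/= den_seq (den_read_slot _ (hw l) e1 e2) ?hk ?mem_head //.
rewrite (IH _ (catrev (slot_code (wire l)) u)) //=; first last.
- by move=> b l'; case: eqP => // ->.
- by move=> l' hl'; apply: hk; rewrite in_cons hl' orbT.
apply: store_ext => //; case=> //= [|b l'].
  by rewrite !catrevE rev_cat -catA.
rewrite in_cons; case: eqP => [->|] //=.
by rewrite (negPf nl).
Qed.

Lemma kind_loop t s u r : s.2 TI = (u, nseq t true ++ false :: r) ->
  den (For TI id (Do (fun r v => (set_kind (inord (minn (kind r).+1 m)) r, fun=> Keep)))) s =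
  (set_kind (inord (minn (kind s.1 + t) m)) s.1,
   fun y => match y with TI => (nseq t true ++ u, false :: r) | _ => s.2 y end).
Proof.
move=> e1; rewrite (den_for_unary _ e1); elim: t s u e1 => [|t IH] s u e1.
  apply: store_ext => /=; last by case=> *; rewrite ?e1.
  rewrite addn0 (minn_idPl _); last by rewrite -ltnS ltn_ord.
  by rewrite inord_val; case: s.1.
rewrite iterSr (IH _ (true :: u)); last by rewrite /= /upd /= e1.
apply: store_ext => /=; last by case=> //=; rewrite nseq_catS.
rewrite /set_kind /=; congr Regs; congr (inord _); rewrite inordK; lia.
Qed.

Definition wires N (g : gate G N) : seq nat := [seq val j | j <- tagged g].

Lemma size_wires N (g : gate G N) : size (wires g) = arity (G (tag g)).
Proof. by rewrite size_map size_tuple. Qed.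

Lemma arity_bound i : arity (G i) <= ar.
Proof. exact: (leq_bigmax i). Qed.

Lemma gate_arity_tag (i : 'I_m) : gate_arity G i = arity (G i).
Proof. by rewrite /gate_arity valK. Qed.

(** Slots beyond the arity have empty codes, so reading all [ar] slots consumes exactly the wires
    that the encoding lists. *)
Lemma onth_slots N (g : gate G N) :
  flatten [seq slot_code (onth (wires g) l) | l : 'I_ar <- enum 'I_ar]
  = flatten [seq unary (val j) | j <- tagged g].
Proof.
have -> : [seq slot_code (onth (wires g) l) | l : 'I_ar <- enum 'I_ar]
    = [seq slot_code (onth (wires g) l) | l <- iota 0 ar].
  by rewrite -val_enum_ord -map_comp.
have : size (wires g) <= ar by rewrite size_wires arity_bound.
rewrite [in RHS](_ : [seq unary (val j) | j <- tagged g] = map unary (wires g)); last first.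
  by rewrite /wires -map_comp.
elim: (wires g) ar => [|a w IH] k /=; first by move=> _; elim: k (0) => //= k IHk i; rewrite onth0n IHk.
case: k => // k; rewrite ltnS => /IH <- /=.
by congr (_ ++ flatten _); rewrite (iotaDl 1 0) -map_comp.
Qed.

Lemma den_read_gate N (g : gate G N) s u r :
  s.2 TI = (u, true :: encode_gate g ++ r) -> s.2 TU = ([::], nseq N true) ->
  (forall b l, (s.2 (TQ b l)).1 = [::]) -> (s.2 TG).1 = [::] ->
  (forall i, (s.2 (TT i)).1 = [::]) ->
  den (read_gate G d) s =
  (set_kind (inord (tag g)) s.1, fun y => match y with
     | TI => (catrev (true :: encode_gate g) u, r)
     | TQ b l => ([::], catrev (slot_row N (onth (wires g) l)) (s.2 y).2)
     | TG => ([::], true :: (s.2 y).2)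
     | TT i => ([::], (i == tag g) :: (s.2 y).2)
     | _ => s.2 y end).
Proof.
move=> e1 e2 e3 e4 e5; rewrite /read_gate !den_seq.
rewrite /encode_gate /= -!catA in e1.
have kt : kind (set_kind (inord (tag g)) s.1) = tag g :> nat.
  by rewrite /= inordK // ltnS ltnW.
rewrite (@kind_loop (tag g) _ (true :: u)
  (flatten [seq unary (val j) | j <- tagged g] ++ r)); last first.
  by rewrite /= e1.
set kr := set_kind _ _.
have -> : kr = set_kind (inord (tag g)) s.1.
  rewrite /kr /set_kind /=; congr Regs; congr (inord _).
  by rewrite add0n; apply/minn_idPl/ltnW.
rewrite [den (act _) _]/=.
rewrite (@den_slots N (fun l => onth (wires g) l) _ _ (false :: nseq (tag g) true ++ true :: u) r)
  ?enum_uniq //=; first last.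
- by rewrite onth_slots.
- move=> l; case E: (onth _ _) => [w|] //.
  have lw : l < size (wires g) by rewrite -onthTE E.
  have <- : nth 0 (wires g) l = w by rewrite -odflt_onth E.
  by have := mem_nth 0 lw; move=> /mapP[j _ ->]; exact: ltn_ord.
- move=> l _; rewrite inordK; last by rewrite ltnS ltnW.
  by rewrite gate_arity_tag -size_wires onthTE.
apply: store_ext => //; case=> //=; rewrite ?e4 ?onth_slots //.
- by rewrite /encode_gate /unary !catrevE !rev_cat rev_nseq /= -!catA.
- by move=> b l; rewrite mem_enum.
- by move=> i; rewrite e5 inordK // ltnS ltnW.
Qed.

Definition slot_stack N (l : nat) (E : seq (gate G N)) (q : seq bool) : seq bool :=
  foldr (fun g => catrev (slot_row N (onth (wires g) l))) q E.

Definition kind_stack N (i : 'I_m) (E : seq (gate G N)) (q : seq bool) : seq bool :=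
  [seq i == tag g | g <- E] ++ q.

Lemma den_if b (p q : prog) s :
  den (If b p q) s = if b s.1 (view_of s) then den p s else den q s.
Proof. by []. Qed.

Lemma at_left_end (z : zipper) : z.1 = [::] -> z = ([::], z.2).
Proof. by case: z => u v /= ->. Qed.

Lemma den_read_gates N (C : circuit G N) s h0 h u r :
  s.2 TI = (u, flatten [seq true :: encode_gate g | g <- C] ++ false :: r) ->
  s.2 TU = ([::], nseq N true) -> s.2 TH = (h0, h) -> size C <= size h ->
  (forall b l, (s.2 (TQ b l)).1 = [::]) -> (s.2 TG).1 = [::] ->
  (forall i, (s.2 (TT i)).1 = [::]) ->
  exists k u', den (read_gates G d) s =
  (set_kind k s.1, fun y => match y with
     | TI => (u', false :: r)
     | TH => (catrev h h0, [::])
     | TQ b l => ([::], slot_stack l (rev C) (s.2 y).2)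
     | TG => ([::], nseq (size C) true ++ (s.2 y).2)
     | TT i => ([::], kind_stack i (rev C) (s.2 y).2)
     | _ => s.2 y end).
Proof.
rewrite /read_gates den_for => e1 e2 e3; rewrite e3 [(_, _).2]/=.
set F := (fun s => _).
elim: h C s h0 u e1 e2 e3 => [|a h IH] [|g C] s h0 u e1 e2 e3 // hs e4 e5 e6.
- exists (kind s.1), u; apply: store_ext; first by rewrite /=; case: s.1.
  by case=> //= *; first [by rewrite e1|by rewrite e3|exact: at_left_end].
- have [|||||||k [u' E]] := IH [::] (forward TH s) (a :: h0) u.
  1-7: by rewrite /forward /upd /= ?e3.
  exists k, u'.
  have -> : iter (size (a :: h)) F s = iter (size h) F (forward TH s).
    rewrite [size _]/= iterSr; congr (iter _ _ _); rewrite /F den_if.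
    by rewrite (_ : (view_of s TI == Some true) = false) ?den_skip // /view_of e1.
  by rewrite E; apply: store_ext => //; case=> //=.
- have eb : F s = (set_kind (inord (tag g)) s.1, fun y => match y with
     | TI => (catrev (true :: encode_gate g) u,
              flatten [seq true :: encode_gate g | g <- C] ++ false :: r)
     | TH => (a :: h0, h)
     | TQ b l => ([::], catrev (slot_row N (onth (wires g) l)) (s.2 y).2)
     | TG => ([::], true :: (s.2 y).2)
     | TT i => ([::], (i == tag g) :: (s.2 y).2)
     | _ => s.2 y end).
    rewrite /F den_if (_ : (view_of s TI == Some true) = true); last by rewrite /view_of e1.
    rewrite (den_read_gate (g := g) (u := u) (r := flatten [seq true :: encode_gate g | g <- C] ++ false :: r)
      _ e2 e4 e5 e6); last by rewrite e1 /= -catA.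
    by apply: store_ext => //; case=> //=; rewrite /upd /= e3.
  have [|||||||k [u' E]] := IH C (F s) (a :: h0) (catrev (true :: encode_gate g) u).
  1-7: by rewrite ?eb.
  exists k, u'.
  have -> : iter (size (a :: h)) F s = iter (size h) F (F s) by rewrite -iterSr.
  rewrite E eb; apply: store_ext => //; case=> //=.
  - by rewrite nseq_catS.
  - by move=> b l; rewrite rev_cons /slot_stack -cats1 foldr_cat.
  - by move=> i; rewrite /= rev_cons /kind_stack map_rcons cat_rcons.
Qed.

Lemma random_loop w s u a : s.2 TU = (u, w) -> s.2 TR = (a, [::]) ->
  den (For TU predT
        (let p := act (fun v y => if y is TR then Append true else Keep) in
         Seq p (Seq p (Seq p p)))) s =
  (s.1, fun y => match y with
     | TU => (catrev w u, [::]) | TR => (nseq (4 * size w) true ++ a, [::])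
     | _ => s.2 y end).
Proof.
rewrite den_for => e1; rewrite e1 [(_, _).2]/=.
elim: w s u a e1 => [|b w IH] s u a e1 e2.
  by apply: store_ext => //; case => * /=; rewrite ?e1 ?e2.
rewrite [size _]/= iterSr (IH _ (b :: u) ([:: true; true; true; true] ++ a)); first last.
- by rewrite /= /upd /= e2.
- by rewrite /= /upd /= e1.
apply: store_ext => //; case => //.
have -> : 4 * size (b :: w) = (4 * size w).+4 by rewrite /= mulnS.
by rewrite -!nseq_catS.
Qed.

Lemma den_push_random N s a : s.2 TU = ([::], nseq N true) -> s.2 TR = (a, [::]) ->
  den (push_random G d) s =
  (s.1, fun y => if y is TR then (nseq (4 * N) true ++ a, [::]) else s.2 y).
Proof.
move=> e1 e2; rewrite /push_random den_seq (random_loop e1 e2).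
apply: store_ext => //; case=> //=; rewrite /upd /= ?size_nseq //.
by rewrite /rewind /= catrevK e1.
Qed.

Lemma den_push_counters s a b : s.2 TA = (a, [::]) -> s.2 TB = (b, [::]) ->
  den (push_counters G d) s =
  (s.1, fun y => match y with
     | TA => (true :: true :: a, [::]) | TB => (true :: true :: b, [::]) | _ => s.2 y end).
Proof. by move=> e1 e2; apply: store_ext => //; case=> *; rewrite /= ?e1 ?e2. Qed.

Definition prepared N (K : seq bool) (C : circuit G N) (uI uH : zipper) (y : X) : zipper :=
  match y with
  | TI => uI
  | TH => uH
  | TU => ([::], nseq N true)
  | TK => ([::], rev K)
  | TM => ([::], false :: behead (rev K))
  | TV | TZ | TX | TJ | TS | TW | TO => ([::], nseq N false)
  | TA | TB => ([::], nseq (2 * N.+1 ^ d) true)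
  | TR => ([::], nseq (4 * N * N.+1 ^ d) true)
  | TG => ([::], nseq (size C) true)
  | TF _ _ => ([::], nseq N.+1 true)
  | TQ _ l => ([::], slot_stack l (rev C) [::])
  | TT i => ([::], kind_stack i (rev C) [::])
  end.

Lemma den_prepare n (C : circuit G n.+1) (K : {set 'I_n.+1}) (d0 : D) :
  exists k u h, den (prepare G d) (start_state TI d0 (encode C K)) =
    (set_kind k d0,
     prepared [seq j \in K | j <- enum 'I_n.+1] C (u, [:: false]) h).
Proof.
set N := n.+1; set kk := [seq _ | j <- _].
pose gs := flatten [seq true :: encode_gate g | g <- C].
have sk : size kk = N by rewrite size_map -cardE card_ord.
have we : encode C K = nseq N true ++ false :: (kk ++ gs ++ [:: false]).
  by rewrite /encode /unary -catA.
have prepareE s : den (prepare G d) s =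
    den (rewinds (fun y => match y with TR | TA | TB => true | _ => false end))
      (den (nest true (push_counters G d)) (den (nest false (push_random G d))
        (den (read_gates G d) (den (read_mask G d) (den (read_size G d) s))))) by [].
rewrite we prepareE (@den_read_size m G d d0 N (kk ++ gs ++ [:: false])).
rewrite (den_read_mask (k := kk) (N := n) (u := false :: nseq N true) (r := gs ++ [:: false])) //;
  last by case.
set w := nseq N true ++ _.
set s0 := (X in den (read_gates G d) X).
(* Each gate occupies at least one symbol of the input, whose length is therefore enough fuel for
   the gate loop. *)
have hs : size C <= size (nseq (size w) true).
  rewrite size_nseq /w size_cat [size (_ :: _)]/= !size_cat -/gs.
  have : size C <= size gs.
    by rewrite /gs; elim: (C) => //= g C' IH; rewrite size_cat ltnS (leq_trans IH) // leq_addl.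
  lia.
have [k [u E]] := @den_read_gates N C s0 [::] _ _ [::] erefl erefl erefl hs
  (fun _ _ => erefl) erefl (fun=> erefl).
rewrite E {E}.
pose r1 := set_kind k d0.
set s1 := (set_kind _ _, _).
pose P1 i (s : store X D) := s.1 = r1 /\
  forall y, (forall j, y <> TF false j) ->
    s.2 y = if y is TR then (nseq (4 * N * i) true, [::]) else s1.2 y.
have [|||||[h1 h2] h3] := @nest_rule _ G d false (push_random G d) P1 N.+1 s1.
- move=> i s s' e1 e2 [p1 p2]; split; first by rewrite -e1.
  by move=> y hy; rewrite -e2 // p2.
- move=> i s [p1 p2]; rewrite (@den_push_random N s (nseq (4 * N * i) true)) ?p2 //.
  split=> // y hy; transitivity (if y is TR then
      (nseq (4 * N) true ++ nseq (4 * N * i) true, [::]) else s.2 y); first by case: (y).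
  by rewrite -nseqD -mulnS; move: (p2 y hy); case: (y).
- by move=> s j; apply: den_avoids; do !split.
- by [].
- by split=> //; case=> //=; rewrite muln0.
set s2 := den (nest false _) s1 in h1 h2 h3 *.
pose P2 i (s : store X D) := s.1 = r1 /\
  forall y, (forall j, y <> TF true j) ->
    s.2 y = match y with TA | TB => (nseq (2 * i) true, [::]) | _ => s2.2 y end.
have e2 y : (forall j, y <> TF false j) ->
    s2.2 y = if y is TR then (nseq (4 * N * N.+1 ^ d) true, [::]) else s1.2 y.
  by move=> hy; rewrite h2.
have [|||||[g1 g2] g3] := @nest_rule _ G d true (push_counters G d) P2 N.+1 s2.
- move=> i s s' e1 e3 [p1 p2]; split; first by rewrite -e1.
  by move=> y hy; rewrite -e3 // p2.
- move=> i s [p1 p2]; rewrite (@den_push_counters s (nseq (2 * i) true) (nseq (2 * i) true)) ?p2 //.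
  by split=> // y hy; rewrite mulnS; move: (p2 y hy); case: (y).
- by move=> s j; apply: den_avoids; do !split.
- by move=> j; rewrite e2.
- by split=> //; case=> //= *; rewrite e2.
set s3 := den (nest true _) s2 in g1 g2 g3 *.
exists k, u, (catrev (nseq (size w) true) [::], [::]).
rewrite den_rewinds; apply: store_ext => //; case=> [||||||||||||||||b j|b l|i].
17: by case: b; rewrite [LHS]/= ?g3 // g2 // h3.
all: by rewrite [LHS]/= ?g2 // ?e2 // /rewind /= ?catrev_nseq ?cats0.
Qed.

End Preparation.

(** * Inverse circuits *)

Section Inverse.

Variables (m : nat) (G : 'I_m -> gate_kind) (N : nat).

Definition unapply_gate (g : gate G N) (w : N.-tuple bool) : N.-tuple bool :=
  let ws := tagged g in
  let y := (gate_perm (G (tag g)))^-1%g [tuple of map (tnth w) ws] in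
  [tuple if j \in ws then nth false y (index j ws) else tnth w j | j < N].

Definition uneval (C : circuit G N) (w : N.-tuple bool) : N.-tuple bool :=
  foldr (@unapply_gate) w C.

(** Distinct wires are what makes a gate invertible: reading the rewritten wires returns exactly the
    bits that were written. *)
Lemma map_tnth_rewritten a (ws : a.-tuple 'I_N) (y : a.-tuple bool) (w : N.-tuple bool) :
  uniq ws ->
  [tuple of map (tnth [tuple if j \in ws then nth false y (index j ws) else tnth w j
     | j < N]) ws] = y.
Proof.
move=> u; apply: eq_from_tnth => i; rewrite tnth_map tnth_mktuple mem_tnth.
by rewrite (tnth_nth (tnth ws i)) index_uniq ?size_tuple // (tnth_nth false).
Qed.

Lemma apply_gateK (g : gate G N) : uniq (tagged g) ->
  cancel (apply_gate g) (unapply_gate g).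
Proof.
move=> u w; rewrite /unapply_gate /apply_gate map_tnth_rewritten // permK.
apply: eq_from_tnth => j; rewrite tnth_mktuple; case: ifP => jw.
  by rewrite (nth_map j) ?index_mem // nth_index.
by rewrite tnth_mktuple jw.
Qed.

Lemma unapply_gateK (g : gate G N) : uniq (tagged g) ->
  cancel (unapply_gate g) (apply_gate g).
Proof.
move=> u w; rewrite /unapply_gate /apply_gate map_tnth_rewritten // permKV.
apply: eq_from_tnth => j; rewrite tnth_mktuple; case: ifP => jw.
  by rewrite (nth_map j) ?index_mem // nth_index.
by rewrite tnth_mktuple jw.
Qed.

Lemma eval_circuitK (C : circuit G N) : wf_circuit C -> cancel (eval_circuit C) (uneval C).
Proof.
rewrite /eval_circuit; elim: C => [|g C IH] //= /andP[ug wC] w.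
by rewrite [LHS]/= -/(uneval C _) IH // apply_gateK.
Qed.

Lemma unevalK (C : circuit G N) : wf_circuit C -> cancel (uneval C) (eval_circuit C).
Proof.
rewrite /eval_circuit; elim: C => [|g C IH] //= /andP[ug wC] w.
by rewrite -/(uneval C _) unapply_gateK // IH.
Qed.

End Inverse.

(** * Words as a group of exponent two, and their characters *)

Section Words.

Import Order.TTheory GRing.Theory Num.Theory.
Local Open Scope ring_scope.

Variable N : nat.
Local Notation word := (N.-tuple bool).

Definition xorw (v s : word) : word := [tuple tnth v j (+) tnth s j | j < N].

Lemma xorwA : associative xorw.
Proof. by move=> u v s; apply: eq_from_tnth => j; rewrite !tnth_mktuple addbA. Qed.

Lemma xorwK v s : xorw (xorw v s) s = v.
Proof. by apply: eq_from_tnth => j; rewrite !tnth_mktuple addbK. Qed.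

Lemma xorwKl v s : xorw v (xorw v s) = s.
Proof. by apply: eq_from_tnth => j; rewrite !tnth_mktuple addKb. Qed.

Definition maskw (P : pred 'I_N) (s : word) : word := [tuple P j && tnth s j | j < N].

Definition supported (P : pred 'I_N) (s : word) : bool := [forall j, tnth s j ==> P j].

Lemma supported_xor P s t : supported P s -> supported P t -> supported P (xorw s t).
Proof.
move=> /forallP hs /forallP ht; apply/forallP => j; rewrite tnth_mktuple.
by have := hs j; have := ht j; case: (tnth s j); case: (tnth t j).
Qed.

Variable R : realType.

(** The character (-1)^(x.w), with the inner product restricted to the wires in [P]. *)
Definition sgn (P : pred 'I_N) (x w : word) : R :=
  \prod_(j | P j) (-1) ^+ (tnth x j && tnth w j).

Lemma sgn_xorr P x w w' : sgn P x (xorw w w') = sgn P x w * sgn P x w'.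
Proof.
rewrite -big_split /=; apply: eq_bigr => j _; rewrite tnth_mktuple.
by case: (tnth x j); case: (tnth w j); case: (tnth w' j);
  rewrite ?expr0 ?expr1 ?mulr1 ?mul1r ?mulrNN ?mulr1.
Qed.

Lemma sgnC P x w : sgn P x w = sgn P w x.
Proof. by apply: eq_bigr => j _; rewrite andbC. Qed.

Lemma sum_words_prod (F : 'I_N -> bool -> R) :
  \sum_(t : word) \prod_j F j (tnth t j) = \prod_j (F j true + F j false).
Proof.
under [RHS]eq_bigr => j _ do rewrite -[_ + _](big_bool (GRing.add) (F j)).
rewrite bigA_distr_bigA /= (reindex (fun t : word => [ffun j => tnth t j])) /=.
  by apply: eq_bigr => t _; apply: eq_bigr => j _; rewrite ffunE.
exists (fun f : {ffun 'I_N -> bool} => [tuple f j | j < N]) => t _.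
  by apply: eq_from_tnth => j; rewrite tnth_mktuple ffunE.
by apply/ffunP => j; rewrite ffunE tnth_mktuple.
Qed.

(** Orthogonality of characters: the sum is a product over the wires, with a factor 1 - 1 at each
    wire of [Q] where [w] is set and 1 + 1 elsewhere. The value is 2^N since [t] runs over all
    words, not only over those supported on [Q]. *)
Lemma sum_sgn (P Q : pred 'I_N) (w : word) : {subset Q <= P} ->
  \sum_(t : word) sgn P (maskw Q t) w
    = if [forall j, Q j ==> ~~ tnth w j] then 2 ^+ N else 0.
Proof.
move=> QP.
transitivity (\sum_(t : word) \prod_j (-1 : R) ^+ (Q j && tnth t j && tnth w j)).
  apply: eq_bigr => t _; rewrite /sgn [LHS]big_mkcond /=; apply: eq_bigr => j _.
  rewrite tnth_mktuple; case: ifP => // Pj.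
  by case Qj: (Q j) => //=; have := QP j Qj; rewrite unfold_in Pj.
rewrite (sum_words_prod (fun j b => (-1) ^+ (Q j && b && tnth w j))).
case: ifPn => [/forallP h|/forallPn[j]].
  rewrite (eq_bigr (fun=> 2)) ?prodr_const ?card_ord // => j _.
  by have := h j; case: (Q j) => //=; case: (tnth w j).
rewrite negb_imply negbK => /andP[Qj wj].
by rewrite (bigD1 j) //= Qj wj /= expr1 expr0 addNr mul0r.
Qed.

End Words.

(** * Outcome probabilities as sums of squares of integers *)

Section Amplitudes.

Import Order.TTheory GRing.Theory Num.Theory.
Local Open Scope ring_scope.

Variables (R : realType) (m : nat) (G : 'I_m -> gate_kind) (n : nat).
Variable C : circuit G n.+1.
Hypothesis wfC : wf_circuit C.
Local Notation word := (n.+1.-tuple bool).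
Local Notation front := (fun j : 'I_n.+1 => j != ord_max).

Definition reached (w : word) : bool := ~~ tnth (uneval C w) ord_max.

Definition amp (x : word) : R :=
  \sum_(w : word | reached w && (tnth w ord_max == tnth x ord_max)) sgn R front x w.

Lemma card_front : #|[pred j : 'I_n.+1 | j != ord_max]| = n.
Proof.
transitivity #|predC1 (ord_max : 'I_n.+1)|; first by apply: eq_card => j; rewrite !inE.
by rewrite cardC1 card_ord.
Qed.

Lemma hadamard_layerE x y : hadamard_layer R x y =
  (if tnth x ord_max == tnth y ord_max then sgn R front x y / Num.sqrt 2 ^+ n else 0)%:C%C.
Proof.
rewrite /hadamard_layer (bigD1 ord_max) //= eqxx /id1.
case: eqP => _; last by rewrite mul0r.
rewrite mul1r (eq_bigr (fun j => ((-1) ^+ (tnth x j && tnth y j) / Num.sqrt 2 : R)%:C%C)).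
  rewrite -rmorph_prod big_split /= prodr_const card_front exprVn.
  by [].
by move=> j /negPf ->.
Qed.

(** The first layer gives weight 2^(-n/2) to every word ending in 0, the circuit moves this weight
    to the reached words, and the second layer adds a character and another factor 2^(-n/2). *)
Lemma hc1q_stateE x : hc1q_state R C x = (amp x / 2 ^+ n)%:C%C.
Proof.
have h0 (y : word) : apply_op (@hadamard_layer R n) (@ket0 R n.+1) y =
    (if tnth y ord_max then 0 else (Num.sqrt 2 ^+ n)^-1)%:C%C.
  pose z : word := [tuple of nseq n.+1 false].
  have z0 j : tnth z j = false by rewrite (tnth_nth false) nth_nseq if_same.
  rewrite /apply_op (bigD1 z) //= big1 => [|y' /negPf nz]; last first.
    by rewrite /ket0 -/z nz mulr0.
  rewrite addr0 /ket0 -/z eqxx mulr1 hadamard_layerE z0.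
  case: (tnth y ord_max) => //; congr (_%:C%C); rewrite /sgn big1 ?mul1r // => j _.
  by rewrite z0 andbF.
have h1 (y : word) : apply_op (circuit_op R C)
     (apply_op (@hadamard_layer R n) (@ket0 R n.+1)) y =
    (if reached y then (Num.sqrt 2 ^+ n)^-1 else 0)%:C%C.
  rewrite [LHS]/apply_op; under eq_bigr => y' _ do rewrite h0.
  rewrite (bigD1 (uneval C y)) //= /circuit_op unevalK // eqxx mul1r.
  rewrite big1 ?addr0 => [|y' ny]; last first.
    by rewrite (_ : y == _ = false) ?mul0r //; apply: contraNF ny => /eqP ->; rewrite eval_circuitK.
  by rewrite /reached; case: (tnth _ _).
rewrite /hc1q_state {1}/apply_op.
under eq_bigr => y _ do rewrite h1 hadamard_layerE -rmorphM.
rewrite -rmorph_sum; congr (_%:C%C); rewrite /amp mulr_suml [RHS]big_mkcond /=.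
apply: eq_bigr => y _; rewrite /= [in RHS]eq_sym.
case: (reached y) => /=; last by rewrite mulr0.
case: eqP => _; last by rewrite mul0r.
by rewrite -mulrA -invfM -exprMn -expr2 sqr_sqrtr ?ler0n.
Qed.

Lemma hc1q_probE (K : {set 'I_n.+1}) z : hc1q_prob R C K z =
  (\sum_(x : word | [seq tnth x j | j <- enum K] == z) amp x ^+ 2) / 4 ^+ n.
Proof.
rewrite /hc1q_prob mulr_suml; apply: eq_bigr => x _; rewrite hc1q_stateE.
rewrite /Normc.normc /= expr0n /= addr0 sqrtr_sqr real_normK ?num_real //.
by rewrite expr_div_n exprAC (_ : 2 ^+ 2 = 4 :> R) // -natrX.
Qed.

(** The integer D: the Fourier coefficient at [x] of the indicator of reached words on the coset v +
    V. *)
Definition coset_sum (P : pred 'I_n.+1) (v x : word) : R :=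
  \sum_(s : word | supported P s && reached (xorw v s)) sgn R front x s.

(* Summing over the unobserved front wires of [x] forces the two words of
   [amp x ^+ 2] to agree there. *)
Lemma sum_amp2 (K : {set 'I_n.+1}) (z : seq bool)
    (M := [pred j : 'I_n.+1 | (j \in K) && (j != ord_max)]) :
  \sum_(x : word | [seq tnth x j | j <- enum K] == z) amp x ^+ 2 =
  \sum_(x : word | [seq tnth x j | j <- enum K] == z)
    \sum_(w : word | reached w && (tnth w ord_max == tnth x ord_max))
      \sum_(s : word | supported M s && reached (xorw w s)) sgn R front x s.
Proof.
pose Q : pred 'I_n.+1 := [pred j | (j \notin K) && (j != ord_max)].
pose A (x w : word) := reached w && (tnth w ord_max == tnth x ord_max).
have flipK (t x : word) : [seq tnth (xorw x (maskw Q t)) j | j <- enum K] = [seq tnth x j | j <- enum K].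
  apply/eq_in_map => j; rewrite mem_enum => jK.
  by rewrite !tnth_mktuple /Q /= jK addbF.
have flipl (t x : word) : tnth (xorw x (maskw Q t)) ord_max = tnth x ord_max.
  by rewrite !tnth_mktuple /Q /= eqxx andbF addbF.
(* Flipping unobserved front bits of [x] changes neither the outcome nor the last bit, so the sum
   equals its average over all such flips; the average over [t] is then a character sum. *)
have avg : \sum_(x : word | [seq tnth x j | j <- enum K] == z) amp x ^+ 2 =
    (2 ^+ n.+1)^-1 * \sum_(t : word) \sum_(x : word | [seq tnth x j | j <- enum K] == z)
      amp (xorw x (maskw Q t)) ^+ 2.
  rewrite [X in _ = _ * X](eq_bigr
    (fun=> \sum_(x : word | [seq tnth x j | j <- enum K] == z) amp x ^+ 2)).
    rewrite sumr_const card_tuple card_bool -[X in _ * X]mulr_natl natrX.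
    by rewrite mulKf // expf_neq0 // pnatr_eq0.
  move=> t _; rewrite [RHS](reindex_inj (h := fun x => xorw x (maskw Q t))) /=; last first.
    by move=> x y /(congr1 (fun u => xorw u (maskw Q t))); rewrite !xorwK.
  by apply: eq_bigl => x; rewrite flipK.
rewrite avg exchange_big /= mulr_sumr; apply: eq_bigr => x _.
transitivity ((2 ^+ n.+1)^-1 * \sum_(t : word) \sum_(w | A x w) \sum_(w' | A x w')
    (sgn R front x (xorw w w') * sgn R front (maskw Q t) (xorw w w'))).
  congr (_ * _); apply: eq_bigr => t _; rewrite expr2 /amp mulr_suml.
  apply: eq_big => [w|w _]; first by rewrite flipl.
  rewrite mulr_sumr; apply: eq_big => [w'|w' _]; first by rewrite flipl.
  rewrite -sgn_xorr sgnC sgn_xorr sgnC; congr (_ * _).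
  by rewrite sgnC.
rewrite exchange_big /= mulr_sumr; apply: eq_bigr => w /andP[_ /eqP wl].
rewrite exchange_big /= mulr_sumr.
rewrite [RHS](reindex_inj (h := xorw w)) /=; last first.
  by move=> a b /(congr1 (xorw w)); rewrite !xorwKl.
rewrite [LHS]big_mkcond [RHS]big_mkcond /=; apply: eq_bigr => w' _; rewrite xorwKl.
rewrite -mulr_sumr sum_sgn; last by move=> j /andP[].
rewrite /A; case rw': (reached w') => /=; last by rewrite andbF.
(* Two words that agree on the last wire and on the unobserved front wires differ by an element of
   V, and conversely. *)
rewrite andbT; have -> : supported M (xorw w w') =
    (tnth w' ord_max == tnth x ord_max) && [forall j, Q j ==> ~~ tnth (xorw w w') j].
  rewrite -wl; apply/forallP/andP => [h|[/eqP e /forallP h] j].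
    split; first by have := h ord_max; rewrite tnth_mktuple /M /= eqxx andbF implybF;
      case: (tnth w _); case: (tnth w' _).
    apply/forallP => j; apply/implyP => /andP[jK _]; apply/negP => hj.
    by have := h j; rewrite hj /M /= (negPf jK).
  apply/implyP => hj; rewrite /M /=; case: (eqVneq j ord_max) => [ej|nj].
    by move: hj; rewrite ej tnth_mktuple e addbb.
  rewrite andbT; apply: contraTT hj => jK.
  by have := h j; rewrite /Q /= jK nj.
case: eqP => _ //=; case: ifP => _; last by rewrite mulr0 mulr0.
by rewrite mulrCA mulVf ?mulr1 // expf_neq0 // pnatr_eq0.
Qed.

(* [v] plays the role of the unobserved qubits and of the last one, [x] that of the
   observed front qubits. *)
Definition outcome (K : {set 'I_n.+1}) (v x : word) : seq bool :=
  [seq (if j == ord_max then tnth v j else tnth x j) | j <- enum K].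

Definition set_last (b : bool) (x : word) : word :=
  [tuple if j == ord_max then b else tnth x j | j < n.+1].

(** Flipping the last bit pairs each word ending in [b] with one that does not, and both have the
    same image under [set_last b]. *)
Lemma sum_set_last (F : word -> R) b :
  \sum_(x : word) F (set_last b x) = 2 * \sum_(x : word | tnth x ord_max == b) F x.
Proof.
have same (x : word) : tnth x ord_max = b -> set_last b x = x.
  by move=> e; apply: eq_from_tnth => j; rewrite tnth_mktuple; case: eqP => [->|].
rewrite (bigID (fun x : word => tnth x ord_max == b)) /= mulr2n mulrDl mul1r; congr (_ + _).
  by apply: eq_bigr => x /eqP /same ->.
pose h (x : word) := set_last (~~ tnth x ord_max) x.
have hK : involutive h.
  move=> x; apply: eq_from_tnth => j; rewrite !tnth_mktuple eqxx negbK.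
  by case: eqP => [->|].
rewrite (reindex_inj (inv_inj hK)) /=; apply: eq_big => x.
  by rewrite tnth_mktuple eqxx; case: b {same}; case: (tnth _ _).
rewrite tnth_mktuple eqxx => hx; congr F; apply: eq_from_tnth => j; rewrite !tnth_mktuple.
by case: eqP => // ->; case: b hx {same}; case: (tnth _ _).
Qed.

(** Expanding the square gives pairs s, s + t in V; the shift w = v + s turns them into the pairs w,
    w + t of [sum_amp2], each once for every s, whence the factor |V|. Elements of V vanish on the
    last wire, so the shift keeps the outcome. The factor 2 is the last bit of [x], which nothing on
    the left reads. *)
Lemma sum_coset2 (K : {set 'I_n.+1}) (z : seq bool)
    (M := [pred j : 'I_n.+1 | (j \in K) && (j != ord_max)]) :
  \sum_(v : word) \sum_(x : word | outcome K v x == z) coset_sum M v x ^+ 2 =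
  2 * #|[set s : word | supported M s]|%:R *
  \sum_(x : word | [seq tnth x j | j <- enum K] == z) amp x ^+ 2.
Proof.
rewrite sum_amp2 -/M.
pose S := [set s : word | supported M s].
pose B w x := \sum_(s : word | supported M s && reached (xorw w s)) sgn R front x s.
have Ml s : supported M s -> tnth s ord_max = false.
  by move=> /forallP /(_ ord_max); rewrite /M /= eqxx andbF implybF => /negPf.
transitivity (\sum_(s | supported M s) \sum_(w : word) \sum_(x : word | outcome K w x == z)
    if reached w then B w x else 0).
  transitivity (\sum_(v : word) \sum_(s | supported M s) \sum_(x : word | outcome K v x == z)
     if reached (xorw v s) then B (xorw v s) x else 0); last first.
    rewrite exchange_big /=; apply: eq_bigr => s hs.
    rewrite [RHS](reindex_inj (h := fun v => xorw v s)) /=; last first.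
      by move=> a b /(congr1 (fun u => xorw u s)); rewrite !xorwK.
    apply: eq_bigr => v _; apply: eq_bigl => x; congr (_ == _).
    rewrite /outcome; apply: eq_map => j; case: eqP => // ->.
    by rewrite tnth_mktuple (Ml s hs) addbF.
  apply: eq_bigr => v _; rewrite exchange_big /=; apply: eq_bigr => x _.
  rewrite expr2 /coset_sum mulr_suml big_mkcondr /=; apply: eq_bigr => s hs.
  case: ifP => // _; rewrite mulr_sumr /B.
  rewrite [RHS](reindex_inj (h := xorw s)) /=; last first.
    by move=> a b /(congr1 (xorw s)); rewrite !xorwKl.
  apply: eq_big => [t|t _]; last by rewrite sgn_xorr.
  rewrite -xorwA xorwKl; congr (_ && _); apply/idP/idP => ht.
    exact: supported_xor.
  by rewrite -(xorwKl s t); apply: supported_xor.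
rewrite (eq_bigl (fun s => s \in S)) => [|s]; last by rewrite inE.
rewrite sumr_const; set T := (X in _ = _ * X).
suff -> : \sum_(w : word) \sum_(x : word | outcome K w x == z) (if reached w then B w x else 0)
    = 2 * T by rewrite -[LHS]mulr_natl mulrCA mulrA.
(* The outcome takes the last bit from [w]. Setting the last bit of [x] to it gives an ordinary
   outcome of [x] and leaves the old last bit free. *)
pose H w x := if ([seq tnth x j | j <- enum K] == z) && reached w then B w x else 0.
transitivity (\sum_(w : word) \sum_(x : word) H w (set_last (tnth w ord_max) x)).
  apply: eq_bigr => w _; rewrite [LHS]big_mkcond /=; apply: eq_bigr => x _.
  rewrite /H; have -> : [seq tnth (set_last (tnth w ord_max) x) j | j <- enum K] = outcome K w x.
    by rewrite /outcome; apply: eq_map => j /=; rewrite /set_last tnth_mktuple; case: eqP => [->|].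
  case: eqP => //= _; case: ifP => // _; apply: eq_bigr => s _.
  by rewrite /sgn; apply: eq_bigr => j /negPf nj; rewrite tnth_mktuple nj.
under eq_bigr => w _ do rewrite sum_set_last.
rewrite -mulr_sumr; congr (_ * _).
rewrite /T [LHS](exchange_big_dep xpredT) //= [RHS]big_mkcond /=.
apply: eq_bigr => x _; rewrite /H; case: eqP => _ /=; last by rewrite big1.
rewrite -big_mkcondr /=; apply: eq_bigl => w.
by rewrite andbC (eq_sym (tnth x _)).
Qed.

End Amplitudes.

(** * Correctness of the inverse run of the circuit *)

Section Attempt.

Variables (m : nat) (G : 'I_m -> gate_kind) (d : nat).

Local Notation ar := (max_arity G).
Local Notation X := (name m ar d).
Local Notation D := (regs m ar).
Local Notation prog := (prog X D).
Implicit Types (s : store X D).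

Definition select (b : bool) (rows word : seq bool) : bool :=
  foldl (fun acc p => if p.1 then p.2 else acc) b (zip rows word).

Lemma head_behead (r : seq bool) k : size r = k.+1 -> r = head false r :: behead r.
Proof. by case: r. Qed.

Lemma size_behead_eq (r : seq bool) k : size r = k.+1 -> size (behead r) = k.
Proof. by case: r => //= a r [->]. Qed.

Lemma read_loop (w : seq bool) s u (uq rows q : 'I_ar -> seq bool) :
  s.2 TW = (u, w) -> (forall l, s.2 (TQ false l) = (uq l, rows l ++ q l)) ->
  (forall l, size (rows l) = size w) ->
  den (For TW predT (Do (fun r v =>
        (set_slots (fun l => if v (TQ false l) == Some true then v TW == Some true
                             else slots r l) r,
         fun y => if y is TQ false _ then Forward else Keep)))) s =
  (set_slots (fun l => select (slots s.1 l) (rows l) w) s.1,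
   fun y => match y with
     | TW => (catrev w u, [::])
     | TQ false l => (catrev (rows l) (uq l), q l)
     | _ => s.2 y end).
Proof.
rewrite den_for => e1; rewrite e1 [(_, _).2]/=.
elim: w s u uq rows e1 => [|b w IH] s u uq rows e1 e2 e3.
  have r0 l : rows l = [::] by apply: size0nil; rewrite e3.
  apply: store_ext => /=.
    by rewrite /set_slots; case: s.1 => a1 a2 a3 a4 a5 f a6 /=; congr Regs;
      apply/ffunP => l; rewrite ffunE /select r0.
  by case=> //= -[] l; rewrite ?e2 ?r0.
have hr l : rows l = head false (rows l) :: behead (rows l).
  exact: head_behead (e3 l).
rewrite [size _]/= iterSr.
rewrite (IH _ (b :: u) (fun l => head false (rows l) :: uq l) (fun l => behead (rows l))); first last.
- by move=> l; apply: size_behead_eq (e3 l).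
- by move=> l; rewrite /= /upd /= e2 hr.
- by rewrite /= /upd /= e1.
apply: store_ext => [|y].
  rewrite /set_slots /=; congr Regs; apply/ffunP => l; rewrite !ffunE.
  rewrite [in RHS]hr /select /= /view_of e1 e2 hr /=.
  by congr foldl; case: (head false (rows l)) => //=; case: b.
case: y => //= -[] l //=.
by rewrite [in RHS]hr.
Qed.

(** The row carries a single mark, so the fold returns the bit under it and forgets the old register
    [b]. *)
Lemma select_slot_row k N (w : seq bool) b : k < N -> size w = N ->
  select b (rev (slot_row N (Some k))) w = nth false (rev w) k.
Proof.
move=> kN sw; rewrite /slot_row /select rev_cat rev_cons !rev_nseq cat_rcons.
rewrite -(cat_take_drop (N - k.+1) w).
have st : size (take (N - k.+1) w) = N - k.+1 by rewrite size_takel // sw leq_subr.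
rewrite zip_cat ?size_nseq // foldl_cat.
have sd : size (drop (N - k.+1) w) = k.+1 by rewrite size_drop sw; lia.
have h0 a j v : foldl (fun acc p => if p.1 then p.2 else acc) a
    (zip (nseq j false) v) = a :> bool.
  by elim: j v a => [|j IH] [|c v] a //=.
rewrite h0; case E: (drop _ w) sd => [|c v] //= [sv].
by rewrite h0 rev_cat nth_cat size_rev /= sv ltnSn rev_cons nth_rcons size_rev sv ltnn eqxx.
Qed.

Fixpoint rewrite_word (f : 'I_ar -> bool) (rows : 'I_ar -> seq bool) (w : seq bool) :=
  if w is b :: w' then
    (if [pick l | head false (rows l)] is Some l then f l else b)
      :: rewrite_word f (fun l => behead (rows l)) w'
  else [::].

Lemma write_loop (w : seq bool) s u (uq rows q : 'I_ar -> seq bool) :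
  s.2 TW = (u, w) -> (forall l, s.2 (TQ true l) = (uq l, rows l ++ q l)) ->
  (forall l, size (rows l) = size w) ->
  den (For TW predT (Do (fun r v => (r, fun y =>
         match y with
         | TQ true _ => Forward
         | TW => if [pick l | v (TQ true l) == Some true] is Some l then Over (slots r l)
                 else Keep
         | _ => Keep
         end)))) s =
  (s.1, fun y => match y with
     | TW => (catrev (rewrite_word (slots s.1) rows w) u, [::])
     | TQ true l => (catrev (rows l) (uq l), q l)
     | _ => s.2 y end).
Proof.
rewrite den_for => e1; rewrite e1 [(_, _).2]/=.
elim: w s u uq rows e1 => [|b w IH] s u uq rows e1 e2 e3.
  have r0 l : rows l = [::] by apply: size0nil; rewrite e3.
  apply: store_ext => //.
  by case=> //= -[] l; rewrite ?e2 ?r0.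
have hr l : rows l = head false (rows l) :: behead (rows l).
  exact: head_behead (e3 l).
rewrite [size _]/= iterSr.
have ep : [pick l | view_of s (TQ true l) == Some true] = [pick l | head false (rows l)].
  by apply: eq_pick => l; rewrite /view_of e2 hr /=; case: (head _ _).
rewrite (IH _ ((if [pick l | head false (rows l)] is Some l then slots s.1 l else b) :: u)
  (fun l => head false (rows l) :: uq l) (fun l => behead (rows l))); first last.
- by move=> l; apply: size_behead_eq (e3 l).
- by move=> l; rewrite /= /upd /= e2 hr.
- by rewrite /= /upd /= ep e1; case: pickP.
apply: store_ext => [|y] //.
case: y => //= -[] l //=.
by rewrite [in RHS]hr.
Qed.

Lemma size_slot_row N o : (if o is Some k then k < N else true) -> size (slot_row N o) = N.
Proof.
case: o => [k|] /=; last by rewrite size_nseq.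
by move=> kN; rewrite size_cat /= !size_nseq; lia.
Qed.

Lemma nth_rewrite_word f rows w p : (forall l, size (rows l) = size w) -> p < size w ->
  nth false (rewrite_word f rows w) p =
  (if [pick l | nth false (rows l) p] is Some l then f l else nth false w p).
Proof.
elim: w rows p => [|b w IH] rows [|p] // hs hp /=.
rewrite IH //; last by move=> l; apply: size_behead_eq (hs l).
by rewrite (eq_pick (Q := fun l => nth false (rows l) p.+1)) // => l; rewrite nth_behead.
Qed.

Lemma size_rewrite_word f rows w : size (rewrite_word f rows w) = size w.
Proof. by elim: w rows => //= b w IH rows; rewrite IH. Qed.

Variable N : nat.
Implicit Types (g : gate G N) (wt : N.-tuple bool).

Lemma wire_bound g l : if onth (wires g) l is Some k then k < N else true.
Proof.
case E: (onth _ _) => [w|] //.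
have lw : l < size (wires g) by rewrite -onthTE E.
have <- : nth 0 (wires g) l = w by rewrite -odflt_onth E.
by have := mem_nth 0 lw; move=> /mapP[j _ ->]; exact: ltn_ord.
Qed.

Lemma nth_slot_row k p : k < N -> p < N ->
  nth false (rev (slot_row N (Some k))) p = (p == N - k.+1).
Proof.
move=> kN pN; have := size_slot_row (o := Some k) kN; rewrite /= => sz.
rewrite nth_rev sz // nth_cat size_nseq.
case: ltnP => h1; first by rewrite nth_nseq h1; apply/esym/eqP; lia.
case E: (N - p.+1 - k) => [|e] /=; first by apply/esym/eqP; lia.
by rewrite nth_nseq if_same; apply/esym/eqP; lia.
Qed.

(** The final registers [f] are left open: the next gate overwrites every slot within its arity
    before using it. *)
Lemma den_undo_gate g wt s (uq q : bool -> 'I_ar -> seq bool) (ut t : 'I_m -> seq bool) :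
  uniq (tagged g) ->
  s.2 TW = ([::], rev wt) ->
  (forall b l, s.2 (TQ b l) = (uq b l, rev (slot_row N (onth (wires g) l)) ++ q b l)) ->
  (forall i, s.2 (TT i) = (ut i, (i == tag g) :: t i)) ->
  exists f, den (undo_gate G d) s =
    (set_slots f s.1, fun y => match y with
     | TW => ([::], rev (unapply_gate g wt))
     | TQ b l => (catrev (rev (slot_row N (onth (wires g) l))) (uq b l), q b l)
     | TT i => ((i == tag g) :: ut i, t i)
     | _ => s.2 y end).
Proof.
move=> ug e1 e2 e3; have [wt' ewt] : exists w, w = unapply_gate g wt by eexists.
rewrite -ewt /undo_gate 4!den_seq.
pose rows (l : 'I_ar) := rev (slot_row N (onth (wires g) l)).
have sr l : size (rows l) = size (rev wt).
  by rewrite !size_rev size_tuple size_slot_row // wire_bound.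
rewrite (read_loop (rows := rows) e1 (e2 false) sr).
set f1 := fun l => select _ _ _.
pose y := (gate_perm (G (tag g)))^-1%g [tuple of map (tnth wt) (tagged g)].
pose f2 (l : 'I_ar) := nth false y l.
set s2 := den (Do _) _.
have -> : s2 = (set_slots f2 s.1, fun y => match y with
     | TW => ([::], rev wt)
     | TQ b l => if b then s.2 y else (catrev (rows l) (uq b l), q b l)
     | TT i => ((i == tag g) :: ut i, t i)
     | _ => s.2 y end).
  rewrite /s2; apply: store_ext => [|x]; last first.
    case: x => //=; rewrite /upd /=; last by move=> i; rewrite e3.
      by rewrite /rewind /= catrevK.
    by case.
  rewrite /= /view_of.
  case: pickP => [i|/(_ (tag g))]; last by rewrite /= /upd /= e3 /= eqxx.
  rewrite /= /upd /= e3 /= => /eqP[/eqP ->].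
  rewrite /set_slots /=; congr Regs; apply/ffunP => l; rewrite !ffunE /f2 /y /unpermute.
  congr (nth _ (val ((_ : {perm _}) _)) _); apply: eq_from_tnth => k; rewrite tnth_mktuple tnth_map.
  have kar : k < ar by apply: (leq_trans (ltn_ord k)); exact: arity_bound.
  rewrite /slot_bit insubT /= ffunE /f1 /rows /=.
  have ew : onth (wires g) k = Some (val (tnth (tagged g) k)).
    rewrite onthE (nth_map 0) ?size_wires ?ltn_ord //.
    rewrite /wires (nth_map (tnth (tagged g) k)) ?size_tuple ?ltn_ord //.
    by rewrite -tnth_nth.
  rewrite ew select_slot_row ?ltn_ord ?size_rev ?size_tuple // revK.
  by rewrite (tnth_nth false).
rewrite (write_loop (u := [::]) (uq := uq true) (rows := rows) (q := q true) _ _ sr) //; last by move=> l /=; apply: e2.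
exists f2; apply: store_ext => // x; case: x => //=; last first.
  by case.
rewrite /upd /= /rewind /= catrevK; congr (_, _).
apply: (@eq_from_nth _ false); first by rewrite size_rewrite_word !size_rev !size_tuple.
move=> p; rewrite size_rewrite_word size_rev size_tuple => pN.
rewrite nth_rewrite_word ?size_rev ?size_tuple //.
(* Cell [p] of a reversed word belongs to wire N - p - 1. *)
have pN' : N - p.+1 < N by lia.
pose j := Ordinal pN'.
rewrite !nth_rev ?size_tuple //.
have nj (v : N.-tuple bool) : nth false v (N - p.+1) = tnth v j by rewrite (tnth_nth false).
rewrite !nj ewt tnth_mktuple.
have rj l : nth false (rows l) p = (onth (wires g) l == Some (val j)).
  rewrite /rows; have := wire_bound g l; case E: (onth _ _) => [k|] kN; last first.
    by rewrite nth_rev ?size_nseq // nth_nseq if_same.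
  rewrite nth_slot_row //; apply/eqP/eqP => [e|[e]]; [congr Some; rewrite /=|rewrite /= in e]; lia.
(* The wires of the gate are distinct, so a slot whose row is marked at this cell is the index of
   [j] among them. *)
case: pickP => [l|none].
  rewrite rj => /eqP El.
  have ls : l < size (tagged g) by rewrite size_tuple -size_wires -onthTE El.
  have ej : nth j (tagged g) l = j.
    apply: val_inj; rewrite -(nth_map j 0) //; move: El.
    by rewrite -/(wires g) -[nth 0 _ _]odflt_onth => ->.
  have jw : j \in tagged g by rewrite -ej mem_nth.
  by rewrite jw ffunE /f2 -[in index j _]ej index_uniq.
case: ifP => // jw.
have il : index j (tagged g) < ar.
  move: (jw); rewrite -index_mem size_tuple => h; apply: (leq_trans h); exact: arity_bound.
have := none (Ordinal il); rewrite rj /= onthE (nth_map 0); last first.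
  by rewrite size_map index_mem.
  by rewrite /wires (nth_map j) ?index_mem // nth_index // eqxx.
by move=> l; rewrite sr size_rev size_tuple.
Qed.

Definition undo_gates (E : seq (gate G N)) (w : N.-tuple bool) : N.-tuple bool :=
  foldl (fun w g => unapply_gate g w) w E.

(** The stacks list the gates of [rev C], and undoing these from the left is the right fold
    [uneval C]. *)
Lemma den_undo_circuit (C : circuit G N) wt s : wf_circuit C ->
  s.2 TW = ([::], rev wt) ->
  s.2 TG = ([::], nseq (size C) true) ->
  (forall b l, s.2 (TQ b l) = ([::], slot_stack l (rev C) [::])) ->
  (forall i, s.2 (TT i) = ([::], kind_stack i (rev C) [::])) ->
  exists f, den (undo_circuit G d) s =
    (set_slots f s.1, fun y => if y is TW then ([::], rev (uneval C wt)) else s.2 y).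
Proof.
move=> wC e1 e2 e3 e4; rewrite /undo_circuit den_seq den_for e2 [(_, _).2]/= size_nseq.
have wE : all (fun g : gate G N => uniq (tagged g)) (rev C) by rewrite all_rev.
set F := fun s => _.
have loop E s0 (w0 : N.-tuple bool) ug (uq : bool -> 'I_ar -> seq bool) (ut : 'I_m -> seq bool) :
    all (fun g : gate G N => uniq (tagged g)) E ->
    s0.2 TW = ([::], rev w0) -> s0.2 TG = (ug, nseq (size E) true) ->
    (forall b l, s0.2 (TQ b l) = (uq b l, slot_stack l E [::])) ->
    (forall i, s0.2 (TT i) = (ut i, kind_stack i E [::])) ->
    exists f, iter (size E) F s0 = (set_slots f s0.1, fun y => match y with
      | TW => ([::], rev (undo_gates E w0))
      | TG => (nseq (size E) true ++ ug, [::])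
      | TQ b l => (catrev (slot_stack l E [::]) (uq b l), [::])
      | TT i => (catrev (kind_stack i E [::]) (ut i), [::])
      | _ => s0.2 y end).
  elim: E s0 w0 ug uq ut => [|g E IH] s0 w0 ug uq ut.
    move=> _ h1 h2 h3 h4; exists (slots s0.1); apply: store_ext => [|y].
      rewrite /= /set_slots; case: s0.1 => a1 a2 a3 a4 a5 f a6 /=; congr Regs.
      by apply/ffunP => l; rewrite ffunE.
    by case: y => //= *; rewrite ?h1 ?h2 ?h3 ?h4.
  rewrite [all _ _]/= => /andP[ug1 wE'] h1 h2 h3 h4.
  have h3' b l : s0.2 (TQ b l) =
      (uq b l, rev (slot_row N (onth (wires g) l)) ++ slot_stack l E [::]).
    by rewrite h3 /= catrevE.
  have [f Ef] := den_undo_gate ug1 h1 h3' h4.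
  have [|||||f' Ef'] := IH (F s0) (unapply_gate g w0) (true :: ug)
     (fun b l => catrev (rev (slot_row N (onth (wires g) l))) (uq b l))
     (fun i => (i == tag g) :: ut i); rewrite ?/F ?Ef //.
    by rewrite /forward /upd /= h2.
  exists f'; rewrite [size _]/= iterSr -/(F s0) Ef'.
  have -> : F s0 = forward TG (den (undo_gate G d) s0) by [].
  rewrite Ef; apply: store_ext => // y; case: y => //=.
  - by rewrite nseq_catS.
  - by move=> b l; rewrite !catrevE rev_cat -catA.
have [|||||f Ef] := loop (rev C) s wt [::] (fun _ _ => [::]) (fun _ => [::]) => //.
  by rewrite size_rev.
rewrite size_rev in Ef; rewrite Ef den_rewinds; exists f; apply: store_ext => // y.
case: y => //=; rewrite /rewind /= ?catrevK ?e2 //.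
- by rewrite /undo_gates foldl_rev.
- by rewrite cats0 catrev_nseq cats0.
- by move=> b l; rewrite catrevK e3.
- by move=> i; rewrite catrevK e4.
Qed.

End Attempt.

(** * Words as reversed lists *)

Fixpoint xor_masked (v m s : seq bool) : seq bool :=
  match v, m, s with
  | a :: v', b :: m', c :: s' => (a (+) (b && c)) :: xor_masked v' m' s'
  | _, _, _ => [::]
  end.

Fixpoint parity_masked (p : bool) (m s z : seq bool) : bool :=
  match m, s, z with
  | b :: m', c :: s', a :: z' => parity_masked (p (+) [&& b, c & a]) m' s' z'
  | _, _, _ => p
  end.

(** Least significant cell first: the last masked cell where the words differ decides, and [g]
    settles a tie. *)
Fixpoint geq_masked (g : bool) (m s x : seq bool) : bool :=
  match m, s, x with
  | b :: m', c :: s', a :: x' => geq_masked (if b && (c != a) then c else g) m' s' x'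
  | _, _, _ => g
  end.

Fixpoint incr (c : bool) (m s : seq bool) : seq bool :=
  match m, s with
  | b :: m', a :: s' =>
      (if b then a (+) c else a) :: incr (if b then c && a else c) m' s'
  | _, _ => [::]
  end.

Fixpoint incr_carry (c : bool) (m s : seq bool) : bool :=
  match m, s with
  | b :: m', a :: s' => incr_carry (if b then c && a else c) m' s'
  | _, _ => c
  end.

Fixpoint mask_value (m s : seq bool) : nat :=
  match m, s with
  | b :: m', a :: s' => if b then a + 2 * mask_value m' s' else mask_value m' s'
  | _, _ => 0
  end.

Lemma mask_value_bound m s : mask_value m s < 2 ^ count id m.
Proof.
elim: m s => [|b m IH] [|a s] //=; first by rewrite expn_gt0.
by case: b => //=; have := IH s; rewrite expnD expn1; case: a; lia.
Qed.

(** The carry out has the weight of the first binary digit beyond the mask, so no value is lost. *)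
Lemma mask_value_incr c m s : size s = size m ->
  mask_value m (incr c m s) + incr_carry c m s * 2 ^ count id m = mask_value m s + c.
Proof.
elim: m s c => [|b m IH] [|a s] c //=; first by rewrite muln1.
move=> [/IH e]; case: b => /=; last exact: e.
by rewrite expnD expn1; have := e (c && a); case: a; case: c => /=; lia.
Qed.

Definition under (m s : seq bool) : bool := all2 (fun b a => a ==> b) m s.

Lemma under_size m s : under m s -> size s = size m.
Proof. by elim: m s => [|b m IH] [|a s] //= /andP[_ /IH ->]. Qed.

Lemma incr_under c m s : under m s -> under m (incr c m s).
Proof.
elim: m s c => [|b m IH] [|a s] c //= /andP[h1 /IH h2].
by case: b h1 => /= h1; rewrite h2 andbT ?implybT.
Qed.

Lemma mask_value_inj m s t : under m s -> under m t ->
  mask_value m s = mask_value m t -> s = t.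
Proof.
elim: m s t => [|b m IH] [|a s] [|c t] //= /andP[h1 h2] /andP[h3 h4].
case: b h1 h3 => /= h1 h3 e.
  have ac : a = c by case: (a) (c) e => [] [] //=; lia.
  by rewrite ac (IH s t) //; move: e; rewrite ac; lia.
by rewrite (IH s t) //; case: (a) (c) h1 h3 => [] [].
Qed.

Lemma under0 m : under m (nseq (size m) false).
Proof. by elim: m => //= b m ->; rewrite andbT. Qed.

Lemma mask_value0 m : mask_value m (nseq (size m) false) = 0.
Proof. by elim: m => //= b m ->; case: b. Qed.

Lemma geq_maskedE g m s x : size s = size m -> size x = size m ->
  geq_masked g m s x =
  (if mask_value m s == mask_value m x then g else mask_value m x < mask_value m s).
Proof.
elim: m s x g => [|b m IH] [|a s] [|c x] g //= [hs] [hx].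
rewrite IH //; case: b => //=; case: a; case: c => //=.
all: by case: (ltngtP (mask_value m s) (mask_value m x)) => h //=;
  repeat case: ifP => //; lia.
Qed.

Definition counter (m : seq bool) (t : nat) : seq bool :=
  iter t (incr true m) (nseq (size m) false).

Lemma counter_under m t : under m (counter m t).
Proof. by elim: t => [|t IH]; [exact: under0|exact: incr_under]. Qed.

Lemma size_counter m t : size (counter m t) = size m.
Proof. exact/under_size/counter_under. Qed.

Lemma counter_value m t : t < 2 ^ count id m -> mask_value m (counter m t) = t.
Proof.
elim: t => [|t IH] ht; first exact: mask_value0.
have := mask_value_incr true (size_counter m t); rewrite IH ?(ltnW ht) //.
rewrite /counter iterS -/(counter m t).
have := mask_value_bound m (incr true m (counter m t)).
by case: (incr_carry _ _ _) => /=; lia.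
Qed.

Lemma counter_carry m t : t < 2 ^ count id m ->
  incr_carry true m (counter m t) = (t.+1 == 2 ^ count id m).
Proof.
move=> ht; have := mask_value_incr true (size_counter m t); rewrite counter_value //.
have := mask_value_bound m (incr true m (counter m t)).
by case: (incr_carry _ _ _) => /=; case: eqP; lia.
Qed.

(** The last increment overflows and leaves the value 0, and under the mask a word is determined by
    its value. Hence an attempt need not reset the counter. *)
Lemma counter_period m : counter m (2 ^ count id m) = counter m 0.
Proof.
have p : 0 < 2 ^ count id m by rewrite expn_gt0.
apply: (mask_value_inj (m := m)); [exact: counter_under..|].
rewrite [RHS]counter_value //.
have -> : counter m (2 ^ count id m) = incr true m (counter m (2 ^ count id m).-1).
  by rewrite -[in LHS](prednK p).
have ht : (2 ^ count id m).-1 < 2 ^ count id m by rewrite prednK.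
have := mask_value_incr true (size_counter m (2 ^ count id m).-1).
by rewrite counter_carry // counter_value // prednK // eqxx; lia.
Qed.

Lemma mask_value_counter m s : under m s -> counter m (mask_value m s) = s.
Proof.
move=> us; apply: (mask_value_inj (m := m)) => //; first exact: counter_under.
by rewrite counter_value // mask_value_bound.
Qed.

(** * Correctness of the sweep, the counter and the decision *)

Section Sweeps.

Variables (m : nat) (G : 'I_m -> gate_kind) (d : nat).

Local Notation ar := (max_arity G).
Local Notation X := (name m ar d).
Local Notation D := (regs m ar).
Local Notation prog := (prog X D).
Implicit Types (s : store X D).

Definition set_flags (p g h : bool) (r : D) : D :=
  Regs p g h (carry r) (fin r) (slots r) (kind r).

Lemma sweep_loop (w v mk c z x j o : seq bool) s (uU uV uM uS uZ uX uJ uW : seq bool) :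
  s.2 TU = (uU, w) -> s.2 TV = (uV, v) -> s.2 TM = (uM, mk) -> s.2 TS = (uS, c) ->
  s.2 TZ = (uZ, z) -> s.2 TX = (uX, x) -> s.2 TJ = (uJ, j) -> s.2 TW = (uW, o) ->
  size v = size w -> size mk = size w -> size c = size w -> size z = size w ->
  size x = size w -> size j = size w -> size o = size w ->
  den (For TU predT (Do (fun r v =>
        let k := v TM == Some true in
        let s := v TS == Some true in
        (Regs (par r (+) [&& k, s & v TZ == Some true])
           (if k && (s != (v TX == Some true)) then s else ge1 r)
           (if k && (s != (v TJ == Some true)) then s else ge2 r)
           (carry r) (fin r) (slots r) (kind r),
         fun y => match y with
         | TW => OverF ((v TV == Some true) (+) (k && s))
         | TV | TS | TM | TZ | TX | TJ => Forward
         | _ => Keep end)))) s =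
  (set_flags (parity_masked (par s.1) mk c z) (geq_masked (ge1 s.1) mk c x)
     (geq_masked (ge2 s.1) mk c j) s.1,
   fun y => match y with
     | TU => (catrev w uU, [::]) | TV => (catrev v uV, [::]) | TM => (catrev mk uM, [::])
     | TS => (catrev c uS, [::]) | TZ => (catrev z uZ, [::]) | TX => (catrev x uX, [::])
     | TJ => (catrev j uJ, [::]) | TW => (catrev (xor_masked v mk c) uW, [::])
     | _ => s.2 y end).
Proof.
rewrite den_for => e1; rewrite e1 [(_, _).2]/=.
elim: w v mk c z x j o s uU uV uM uS uZ uX uJ uW e1 => [|a w IH]
  [|a1 v] [|a2 mk] [|a3 c] [|a4 z] [|a5 x] [|a6 j] [|a7 o] s
  uU uV uM uS uZ uX uJ uW e1 e2 e3 e4 e5 e6 e7 e8 // h1 h2 h3 h4 h5 h6 h7.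
  apply: store_ext => /=; first by case: s.1.
  by case=> //.
case: h1 h2 h3 h4 h5 h6 h7 => h1 [h2] [h3] [h4] [h5] [h6] [h7].
rewrite [size _]/= iterSr.
rewrite (IH v mk c z x j o _ (a :: uU) (a1 :: uV) (a2 :: uM) (a3 :: uS) (a4 :: uZ)
  (a5 :: uX) (a6 :: uJ) ((a1 (+) (a2 && a3)) :: uW)) //.
- apply: store_ext => [|y]; last by case: y.
  rewrite /set_flags /= /view_of e3 e4 e5 e6 e7 /=.
  by case: (a2); case: (a3); case: (a4); case: (a5); case: (a6).
- by rewrite /= /upd /= e1.
- by rewrite /= /upd /= e2.
- by rewrite /= /upd /= e3.
- by rewrite /= /upd /= e4.
- by rewrite /= /upd /= e5.
- by rewrite /= /upd /= e6.
- by rewrite /= /upd /= e7.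
- by rewrite /= /upd /= e8 /view_of e2 e3 e4 /=; case: (a1); case: (a2); case: (a3).
Qed.

Lemma size_xor_masked v mk c : size mk = size v -> size c = size v ->
  size (xor_masked v mk c) = size v.
Proof. by elim: v mk c => [|a v IH] [|b mk] [|e c] //= [h1] [h2]; rewrite IH. Qed.

Lemma den_sweep N (v mk c z x j o : seq bool) s :
  s.2 TU = ([::], nseq N true) -> s.2 TV = ([::], v) -> s.2 TM = ([::], mk) ->
  s.2 TS = ([::], c) -> s.2 TZ = ([::], z) -> s.2 TX = ([::], x) -> s.2 TJ = ([::], j) ->
  s.2 TW = ([::], o) ->
  size v = N -> size mk = N -> size c = N -> size z = N -> size x = N -> size j = N ->
  size o = N ->
  den (sweep G d) s =
  (set_flags (parity_masked (head false z) mk c z) (geq_masked true mk c x)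
     (geq_masked true mk c j) s.1,
   fun y => if y is TW then ([::], xor_masked v mk c) else s.2 y).
Proof.
move=> e1 e2 e3 e4 e5 e6 e7 e8 h1 h2 h3 h4 h5 h6 h7; rewrite /sweep !den_seq.
set s1 := den (Do _) s.
have es1 : s1 = (set_flags (head false z) true true s.1, s.2).
  apply: store_ext => //; rewrite /= /view_of e5 /set_flags /=.
  by case: (z) => [|[] z'].
rewrite (sweep_loop (w := nseq N true) (v := v) (mk := mk) (c := c) (z := z) (x := x)
  (j := j) (o := o) (uU := [::]) (uV := [::]) (uM := [::]) (uS := [::]) (uZ := [::])
  (uX := [::]) (uJ := [::]) (uW := [::])) ?es1 ?size_nseq //.
rewrite den_rewinds; apply: store_ext => // y.
by case: y => //=; rewrite /rewind /= ?catrevK ?e1 ?e2 ?e3 ?e4 ?e5 ?e6 ?e7.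
Qed.

Lemma incr_loop (mk c : seq bool) s (uM uS : seq bool) :
  s.2 TM = (uM, mk) -> s.2 TS = (uS, c) -> size c = size mk ->
  den (For TM predT (Do (fun r v =>
        let k := v TM == Some true in
        let s := v TS == Some true in
        (set_carry (if k then carry r && s else carry r) r,
         fun y => if y is TS then OverF (if k then s (+) carry r else s) else Keep)))) s =
  (set_carry (incr_carry (carry s.1) mk c) s.1,
   fun y => match y with
     | TM => (catrev mk uM, [::]) | TS => (catrev (incr (carry s.1) mk c) uS, [::])
     | _ => s.2 y end).
Proof.
rewrite den_for => e1; rewrite e1 [(_, _).2]/=.
elim: mk c s uM uS e1 => [|b mk IH] [|a c] s uM uS e1 e2 // hs.
  apply: store_ext => /=; first by case: s.1.
  by case=> //.
case: hs => hs; rewrite [size _]/= iterSr.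
rewrite (IH c _ (b :: uM) ((if b then a (+) carry s.1 else a) :: uS)) //.
- apply: store_ext => [|y].
    by rewrite /set_carry /= /view_of e1 e2 /=; case: (a); case: (b).
  by case: y => //=; rewrite /view_of e1 e2 /=; case: (a); case: (b).
- by rewrite /= /upd /= e1.
- by rewrite /= /upd /= e2 /view_of e1 e2 /=; case: (b); case: (a).
Qed.

Lemma den_increment (mk c : seq bool) s :
  s.2 TM = ([::], mk) -> s.2 TS = ([::], c) -> size c = size mk ->
  den (increment G d) s =
  (set_carry (incr_carry (carry s.1) mk c) s.1,
   fun y => if y is TS then ([::], incr (carry s.1) mk c) else s.2 y).
Proof.
move=> e1 e2 hs; rewrite /increment den_seq (incr_loop e1 e2 hs) den_rewinds.
apply: store_ext => // y; case: y => //=; rewrite /rewind /= ?catrevK ?e1 //.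
Qed.

Definition steps (k : nat) (z : zipper) : zipper := iter k (do_act Forward) z.

Lemma steps_unary a b k : k <= b ->
  steps k (nseq a true, nseq b true) = (nseq (k + a) true, nseq (b - k) true).
Proof.
elim: k => [|k IH] hk; first by rewrite subn0.
rewrite /steps iterS -/(steps k _) IH ?(ltnW hk) //= -[b - k]prednK ?subn_gt0 //=.
by rewrite subnS.
Qed.

Lemma den_record_term o s : s.2 TW = ([::], o) ->
  den (record_term G d) s =
  (set_carry true s.1, fun y => match y with
    | TA => steps ((head true o == false) && ~~ par s.1) (s.2 y)
    | TB => steps (((head true o == false) && par s.1) + (ge1 s.1 || ge2 s.1)) (s.2 y)
    | _ => s.2 y end).
Proof.
move=> e; apply: store_ext => // y; case: y => //=; rewrite /view_of e.
  by case: o {e} => [|[] o] //=; case: (par _).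
by case: o {e} => [|[] o]; case: (ge1 s.1 || ge2 s.1); case: (par s.1).
Qed.

Lemma load_loop x w (v q : seq bool) s u uv uR :
  x \in [:: TV; TZ; TX; TJ : X] ->
  s.2 TU = (u, w) -> s.2 x = (uv, v) -> s.2 TR = (uR, q) ->
  size v = size w -> size w <= size q ->
  den (For TU predT (act (fun v y =>
         if y == x then OverF (v TR == Some true)
         else if y is TR then Forward else Keep))) s =
  (s.1, fun y => if y == x then (catrev (take (size w) q) uv, [::]) else
     match y with
     | TU => (catrev w u, [::]) | TR => (catrev (take (size w) q) uR, drop (size w) q)
     | _ => s.2 y end).
Proof.
move=> hx; rewrite den_for => e1; rewrite e1 [(_, _).2]/=.
have xU : (TU == x) = false by move: hx; rewrite !inE => /or4P[] /eqP ->.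
have xR : (TR == x) = false by move: hx; rewrite !inE => /or4P[] /eqP ->.
have xU' : (x == TU) = false by rewrite eq_sym.
elim: w v q s u uv uR e1 => [|a w IH] [|b v] q s u uv uR e1 e2 e3 // h1.
  move=> _; apply: store_ext => // y /=; rewrite take0 drop0.
  by case: eqP => [->|_] //; case: y.
case: q e3 => [|c q] // e3 h2; case: h1 => h1; rewrite [size _]/= iterSr.
rewrite (IH v q _ (a :: u) (c :: uv) (c :: uR)) //.
- apply: store_ext => // y; rewrite /= /upd; case: eqP => //= _.
  by case: y => //=; rewrite ?xR ?xU.
- by rewrite /= /upd /= xU e1.
- by rewrite /= /upd xU' eqxx e2 /= /view_of e3 /=; case: (c).
- by rewrite /= /upd /= xR e3.
Qed.

Lemma den_load x N (v q : seq bool) s uR :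
  x \in [:: TV; TZ; TX; TJ : X] ->
  s.2 TU = ([::], nseq N true) -> s.2 x = ([::], v) -> s.2 TR = (uR, q) ->
  size v = N -> N <= size q ->
  den (load x) s =
  (s.1, fun y => if y == x then ([::], take N q) else
     if y is TR then (catrev (take N q) uR, drop N q) else s.2 y).
Proof.
move=> hx e1 e2 e3 h1 h2; rewrite /load den_seq.
rewrite (load_loop hx e1 e2 e3) ?size_nseq // den_rewinds.
have xU : (TU == x) = false by move: hx; rewrite !inE => /or4P[] /eqP ->.
apply: store_ext => // y /=; case: eqP => [->|ne] /=; first by rewrite /rewind /= catrevK.
case: eqP => [->|] /=; last by case: y ne.
by rewrite /rewind /= catrevK e1.
Qed.

Lemma accept_loop (w z o : seq bool) s u uZ uO :
  s.2 TU = (u, w) -> s.2 TZ = (uZ, z) -> s.2 TO = (uO, o) ->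
  size z = size w -> size o = size w ->
  den (For TU predT (act (fun v y =>
         match y with TO => OverF (v TZ == Some true) | TZ => Forward | _ => Keep end))) s =
  (s.1, fun y => match y with
    | TU => (catrev w u, [::]) | TZ => (catrev z uZ, [::]) | TO => (catrev z uO, [::])
    | _ => s.2 y end).
Proof.
rewrite den_for => e1; rewrite e1 [(_, _).2]/=.
elim: w z o s u uZ uO e1 => [|a w IH] [|b z] [|c o] s u uZ uO e1 e2 e3 // h1 h2.
  by apply: store_ext => //; case.
case: h1 h2 => h1 [h2]; rewrite [size _]/= iterSr.
rewrite (IH z o _ (a :: u) (b :: uZ) (b :: uO)) //.
- by apply: store_ext => //; case.
- by rewrite /= /upd /= e1.
- by rewrite /= /upd /= e2.
- by rewrite /= /upd /= e3 /view_of e2 /=; case: (b).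
Qed.

Definition set_fin (b : bool) (r : D) : D :=
  Regs (par r) (ge1 r) (ge2 r) (carry r) b (slots r) (kind r).

Lemma den_accept N (v z o : seq bool) s :
  s.2 TU = ([::], nseq N.+1 true) -> s.2 TV = ([::], v) -> s.2 TZ = ([::], z) ->
  s.2 TO = ([::], o) -> size v = N.+1 -> size z = N.+1 -> size o = N.+1 ->
  den (accept G d) s =
  (set_fin true s.1, fun y => if y is TO then ([::], head false v :: behead z) else s.2 y).
Proof.
move=> e1 e2 e3 e4 h1 h2 h3; rewrite /accept 3!den_seq.
set s1 := den (Do _) s.
have es : s1 = (set_fin true s.1, s.2) by apply: store_ext.
rewrite (accept_loop (w := nseq N.+1 true) (z := z) (o := o) (u := [::]) (uZ := [::])
  (uO := [::])) ?es ?size_nseq // den_rewinds.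
apply: store_ext => // y; case: y => //=.
- by rewrite e1 -[in RHS](catrevK (nseq N.+1 true)).
- by rewrite /rewind /= catrevK e3.
- rewrite /rewind /= catrevK /view_of /= e2.
  by case: (z) h2 => // a z' _; case: (v) h1 => // -[] v' _.
Qed.

Lemma compare_loop s ua a ub b :
  s.2 TA = (nseq ua true, nseq a true) -> s.2 TB = (nseq ub true, nseq b true) ->
  den (For TB predT (act (fun v y => if y is TA then Forward else Keep))) s =
  (s.1, fun y => match y with
    | TA => (nseq (minn a b + ua) true, nseq (a - b) true)
    | TB => (nseq (b + ub) true, [::])
    | _ => s.2 y end).
Proof.
rewrite den_for => e1 e2; rewrite e2 [(_, _).2]/= size_nseq.
elim: b s ua a ub e1 e2 => [|b IH] s ua a ub e1 e2.
  by apply: store_ext => //; case => //=; rewrite minn0 subn0.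
rewrite iterSr (IH _ (minn a 1 + ua) a.-1 ub.+1).
- apply: store_ext => //; case=> //=.
    by congr (nseq _ _, nseq _ _); lia.
  by rewrite addnS.
- by rewrite /= /upd /= e1; case: (a) => //= a'; rewrite min1n.
- by rewrite /= /upd /= e2.
Qed.

Lemma den_decide N (v z o : seq bool) s ua a ub b L :
  s.2 TU = ([::], nseq N.+1 true) -> s.2 TV = ([::], v) -> s.2 TZ = ([::], z) ->
  s.2 TO = ([::], o) -> size v = N.+1 -> size z = N.+1 -> size o = N.+1 ->
  s.2 TA = (nseq ua true, nseq a true) -> s.2 TB = (nseq ub true, nseq b true) ->
  ua + a = L -> ub + b = L ->
  den (decide G d) s =
  (set_fin (fin s.1 || (ub <= ua)) s.1, fun y => match y with
    | TO => ([::], if (ub <= ua) && ~~ fin s.1 then head false v :: behead z else o)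
    | TA | TB => ([::], nseq L true)
    | _ => s.2 y end).
Proof.
move=> e1 e2 e3 e4 h1 h2 h3 e5 e6 hA hB; rewrite /decide 2!den_seq.
rewrite (compare_loop e5 e6); set s1 := (_, _).
(* Both counter tapes have length [L], so the head that has advanced further has fewer cells ahead:
   [a <= b] is the same as [ub <= ua]. *)
have ea : (view_of s1 TA == None) = (ub <= ua).
  rewrite /view_of /s1 /scan /=; case E: (a - b) => [|k]; apply/esym.
    by rewrite eqxx; lia.
  by apply/negbTE; rewrite -ltnNge; lia.
have -> : den (If (fun r v => (v TA == None) && ~~ fin r) (accept G d) (skip G d)) s1 =
  (set_fin (fin s.1 || (ub <= ua)) s.1,
   fun y => if y is TO then ([::], if (ub <= ua) && ~~ fin s.1
     then head false v :: behead z else o) else s1.2 y).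
  rewrite den_if ea; case: ifP => [/andP[-> /negPf ff]|].
    by rewrite (@den_accept N v z o) // /s1 /= orbT.
  rewrite den_skip => nf; apply: store_ext => [|y]; last by case: y; rewrite /= ?e4.
  rewrite /s1 /set_fin /=; have -> : fin s.1 || (ub <= ua) = fin s.1.
    by case: (fin s.1) nf; case: (ub <= ua).
  by case: s.1.
rewrite den_rewinds; apply: store_ext => // y; case: y => //=;
  rewrite /rewind /= catrev_nseq -?nseqD ?cats0; congr (_, nseq _ _); lia.
Qed.

End Sweeps.

(** * Correctness of one attempt and of the loop over the attempts *)

Section Sampling.

Variables (m : nat) (G : 'I_m -> gate_kind) (d n : nat).

Local Notation ar := (max_arity G).
Local Notation X := (name m ar d).
Local Notation D := (regs m ar).
Local Notation prog := (prog X D).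
Local Notation N := n.+1.
Implicit Types (s : store X D).

Variables (C : circuit G N) (wC : wf_circuit C) (mk : seq bool).
Hypothesis size_mk : size mk = N.
Local Notation k := (count id mk).
Hypothesis fuel : 2 ^ k <= N.+1 ^ d.

Definition rev_word (l : seq bool) : N.-tuple bool := [tuple nth false (rev l) j | j < N].

Lemma rev_wordK l : size l = N -> rev (rev_word l) = l.
Proof.
move=> sl; rewrite -[RHS]revK; congr rev; apply: (@eq_from_nth _ false).
  by rewrite size_tuple size_rev sl.
move=> i; rewrite size_tuple => iN.
have -> : i = val (Ordinal iN) by [].
by rewrite -tnth_nth tnth_mktuple.
Qed.

Lemma head_rev_word b (w : N.-tuple bool) : head b (rev w) = tnth w ord_max.
Proof.
by rewrite -nth0 nth_rev ?size_tuple // subn1 /= (tnth_nth b).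
Qed.

(** The value f(v + s), where s is the element of V on the counter. *)
Definition hit (v c : seq bool) : bool := reached C (rev_word (xor_masked v mk c)).
Definition odd_term (z c : seq bool) : bool := parity_masked (head false z) mk c z.
Definition above (x j c : seq bool) : bool :=
  geq_masked true mk c x || geq_masked true mk c j.

Definition static s : Prop :=
  [/\ s.2 TU = ([::], nseq N true), s.2 TM = ([::], mk),
      s.2 TG = ([::], nseq (size C) true),
      (forall b l, s.2 (TQ b l) = ([::], slot_stack l (rev C) [::])) &
      (forall i, s.2 (TT i) = ([::], kind_stack i (rev C) [::]))].

Lemma den_term s v c z x j o : static s ->
  s.2 TV = ([::], v) -> s.2 TS = ([::], c) -> s.2 TZ = ([::], z) ->
  s.2 TX = ([::], x) -> s.2 TJ = ([::], j) -> s.2 TW = ([::], o) ->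
  size v = N -> size c = N -> size z = N -> size x = N -> size j = N -> size o = N ->
  exists r o', [/\ size o' = N, fin r = fin s.1, carry r = incr_carry true mk c &
    den (term G d) s = (r, fun y => match y with
      | TW => ([::], o')
      | TS => ([::], incr true mk c)
      | TA => steps (hit v c && ~~ odd_term z c) (s.2 y)
      | TB => steps ((hit v c && odd_term z c) + above x j c) (s.2 y)
      | _ => s.2 y end)].
Proof.
move=> [e1 e2 e3 e4 e5] f1 f2 f3 f4 f5 f6 h1 h2 h3 h4 h5 h6.
rewrite /term 3!den_seq.
have sx : size (xor_masked v mk c) = N by rewrite size_xor_masked ?h1.
pose w := rev_word (xor_masked v mk c).
have := den_sweep e1 f1 e2 f2 f3 f4 f5 f6 h1 size_mk h2 h3 h4 h5 h6.
move: (den (sweep G d) s) => s1 es1.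
have g1 : s1.2 TW = ([::], rev w) by rewrite es1 rev_wordK.
have g2 : s1.2 TG = ([::], nseq (size C) true) by rewrite es1.
have g3 b l : s1.2 (TQ b l) = ([::], slot_stack l (rev C) [::]) by rewrite es1 /= e4.
have g4 i : s1.2 (TT i) = ([::], kind_stack i (rev C) [::]) by rewrite es1 /= e5.
have [f] := den_undo_circuit wC g1 g2 g3 g4.
move: (den (undo_circuit G d) s1) => s2 es2.
have g5 : s2.2 TW = ([::], rev (uneval C w)) by rewrite es2.
have := den_record_term g5; move: (den (record_term G d) s2) => s3 es3.
have g6 : s3.2 TM = ([::], mk) by rewrite es3 [LHS]/= es2 [LHS]/= es1.
have g7 : s3.2 TS = ([::], c) by rewrite es3 [LHS]/= es2 [LHS]/= es1.
have hc : size c = size mk by rewrite h2 size_mk.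
have := den_increment g6 g7 hc; move: (den (increment G d) s3) => s4 es4.
have hh : (head true (rev (uneval C w)) == false) = hit v c.
  by rewrite head_rev_word eqbF_neg.
have p2 : par s2.1 = odd_term z c by rewrite es2 es1.
have q2 : ge1 s2.1 || ge2 s2.1 = above x j c by rewrite es2 es1.
have r2 : fin s2.1 = fin s.1 by rewrite es2 es1.
exists s4.1, (rev (uneval C w)); split.
- by rewrite size_rev size_tuple.
- by rewrite es4 es3.
- by rewrite es4 es3.
- apply: store_ext => // y; rewrite es4 es3 hh p2 q2 {es4 es3 p2 q2 r2 g6 g7}.
  by case: y => [||||||||||||||||b i|b l|i] //=; rewrite es2 //= es1.
Qed.

Definition plus_count v z := \sum_(t < 2 ^ k) (hit v (counter mk t) && ~~ odd_term z (counter mk t)).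
Definition minus_count v z := \sum_(t < 2 ^ k) (hit v (counter mk t) && odd_term z (counter mk t)).
Definition above_count x j := \sum_(t < 2 ^ k) (above x j (counter mk t)).

Lemma steps_add a b z : steps a (steps b z) = steps (a + b) z.
Proof. by rewrite /steps iterD. Qed.

(** The invariant after [t] rounds speaks of the first min(t, 2^k) terms, and [carry] is set exactly
    from 2^k rounds on; the hypothesis on the fuel guarantees that all terms are reached. *)
Lemma den_enumerate s v z x j o : static s -> carry s.1 = false ->
  (forall i, s.2 (TF true i) = ([::], nseq N.+1 true)) ->
  s.2 TV = ([::], v) -> s.2 TS = ([::], counter mk 0) -> s.2 TZ = ([::], z) ->
  s.2 TX = ([::], x) -> s.2 TJ = ([::], j) -> s.2 TW = ([::], o) ->
  size v = N -> size z = N -> size x = N -> size j = N -> size o = N ->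
  exists o', size o' = N /\
  let s' := den (nest true (If (fun r v => ~~ carry r) (term G d) (skip G d))) s in
  fin s'.1 = fin s.1 /\
  forall y, s'.2 y = match y with
      | TW => ([::], o')
      | TA => steps (plus_count v z) (s.2 y)
      | TB => steps (minus_count v z + above_count x j) (s.2 y)
      | _ => s.2 y end.
Proof.
move=> st c0 eF f1 f2 f3 f4 f5 f6 h1 h3 h4 h5 h6.
pose a t := (hit v (counter mk t) && ~~ odd_term z (counter mk t)) : nat.
pose b t := ((hit v (counter mk t) && odd_term z (counter mk t)) + above x j (counter mk t)).
pose P t (s' : store X D) := [/\ fin s'.1 = fin s.1, carry s'.1 = (2 ^ k <= t) &
  exists2 o', size o' = N & forall y, (forall i, y <> TF true i) ->
    s'.2 y = match y with
      | TW => ([::], o')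
      | TS => ([::], counter mk (minn t (2 ^ k)))
      | TA => steps (\sum_(i < minn t (2 ^ k)) a i) (s.2 y)
      | TB => steps (\sum_(i < minn t (2 ^ k)) b i) (s.2 y)
      | _ => s.2 y end].
have [|||||[p1 p2 [o' ho p3]] p4] := @nest_rule _ G d true
    (If (fun r v => ~~ carry r) (term G d) (skip G d)) P N.+1 s.
- move=> t s1 s2 es1 es2 [q1 q2 [o' ho q3]]; split; rewrite -?es1 //.
  by exists o' => // y hy; rewrite -es2 // q3.
- move=> t s1 [q1 q2 [o' ho q3]]; rewrite den_if q2 -ltnNge; case: ltnP => ht; last first.
    rewrite den_skip; split=> //; first by rewrite q2; lia.
    exists o' => // y hy; rewrite q3 //.
    by have -> : minn t.+1 (2 ^ k) = minn t (2 ^ k) by lia.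
  have em : minn t (2 ^ k) = t by lia.
  have em1 : minn t.+1 (2 ^ k) = t.+1 by lia.
  rewrite em in q3.
  have st1 : static s1.
    case: st => g1 g2 g3 g4 g5; split=> [||| b0 l|i]; by rewrite q3.
  have g1 : s1.2 TV = ([::], v) by rewrite q3.
  have g2 : s1.2 TS = ([::], counter mk t) by rewrite q3.
  have g3 : s1.2 TZ = ([::], z) by rewrite q3.
  have g4 : s1.2 TX = ([::], x) by rewrite q3.
  have g5 : s1.2 TJ = ([::], j) by rewrite q3.
  have g6 : s1.2 TW = ([::], o') by rewrite q3.
  have hc : size (counter mk t) = N by rewrite size_counter.
  have [r [o2 [ho2 r1 r2 ->]]] := den_term st1 g1 g2 g3 g4 g5 g6 h1 hc h3 h4 h5 ho.
  split; first by rewrite /= r1.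
    by rewrite [LHS]r2 counter_carry // eqn_leq ht.
  exists o2 => // y hy; rewrite em1 !big_ord_recr.
  have := q3 y hy; case: y hy => //= _ ->; rewrite steps_add addnC //.
- move=> s1 i; apply: den_avoids; split; last by [].
  by do !split=> //; apply: avoids_rewinds.
- exact: eF.
- split=> //; first by rewrite c0; apply/esym/negbTE; rewrite -ltnNge expn_gt0.
  exists o => // y hy; rewrite min0n !big_ord0.
  by case: y hy.
exists o'; split=> //; split=> // y.
rewrite (minn_idPr fuel) in p3.
case: y => [||||||||||||||||b0 i|b0 l|i].
17: case: b0; [by rewrite p4 eF | by rewrite p3].
all: rewrite p3 // ?f2 ?counter_period //.
by rewrite /b big_split.
Qed.

(** With P and Q the numbers of positive and negative terms, [above_count] is 2^k - min(x, j), so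
    the condition says that both random numbers are at least 2^k - (P - Q). As min(x, j) < 2^k, it
    forces P > Q. Counting in unary replaces all arithmetic on D. *)
Definition accepting (v z x j : seq bool) : bool :=
  minus_count v z + above_count x j <= plus_count v z.

Definition ready s : Prop :=
  [/\ static s, (forall i, s.2 (TF true i) = ([::], nseq N.+1 true)),
      s.2 TS = ([::], counter mk 0) &
      (s.2 TA = ([::], nseq (2 * N.+1 ^ d) true) /\
       s.2 TB = ([::], nseq (2 * N.+1 ^ d) true))] /\
  (forall y, y \in [:: TV; TZ; TX; TJ; TW : X] -> exists2 v, size v = N & s.2 y = ([::], v)).

Lemma counts_le v z x j : plus_count v z <= 2 * N.+1 ^ d /\
  minus_count v z + above_count x j <= 2 * N.+1 ^ d.
Proof.
have le (f : nat -> bool) : \sum_(t < 2 ^ k) f t <= 2 ^ k.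
  rewrite -[X in _ <= X]card_ord -sum1_card; apply: leq_sum => t _; exact: leq_b1.
have l1 := le (fun t => hit v (counter mk t) && ~~ odd_term z (counter mk t)).
have l2 := le (fun t => hit v (counter mk t) && odd_term z (counter mk t)).
have l3 := le (fun t => above x j (counter mk t)).
rewrite /plus_count /minus_count /above_count; lia.
Qed.

Lemma den_attempt s uR q o (v := take N q) (z := take N (drop N q))
    (x := take N (drop N (drop N q))) (j := take N (drop N (drop N (drop N q)))) :
  ready s -> s.2 TR = (uR, q) -> 4 * N <= size q -> s.2 TO = ([::], o) -> size o = N ->
  let s' := den (attempt G d) s in
  [/\ ready s', fin s'.1 = fin s.1 || accepting v z x j,
      s'.2 TO = ([::], if accepting v z x j && ~~ fin s.1 then head false v :: behead z else o),
      exists uR', s'.2 TR = (uR', drop (4 * N) q) &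
      (s'.2 TI = s.2 TI /\ s'.2 TK = s.2 TK)].
Proof.
move=> [[st eF eS [eA eB]] wds] eR sq eO so.
have [st1 st2 st3 st4 st5] := st.
have [v0 hv0 ev0] := wds TV isT; have [z0 hz0 ez0] := wds TZ isT.
have [x0 hx0 ex0] := wds TX isT; have [j0 hj0 ej0] := wds TJ isT.
have [w0 hw0 ew0] := wds TW isT.
have -> : den (attempt G d) s = den (decide G d)
    (den (nest true (If (fun r v => ~~ carry r) (term G d) (skip G d)))
      (den (Do (fun r v => (set_carry false r, fun=> Keep)))
        (den (load TJ) (den (load TX) (den (load TZ) (den (load TV) s)))))) by [].
have h1 : N <= size q by lia.
have h2 : N <= size (drop N q) by rewrite size_drop; lia.
have h3 : N <= size (drop N (drop N q)) by rewrite !size_drop; lia.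
have h4 : N <= size (drop N (drop N (drop N q))) by rewrite !size_drop; lia.
have sv : size v = N by rewrite size_takel.
have sz : size z = N by rewrite size_takel.
have sx : size x = N by rewrite size_takel.
have sj : size j = N by rewrite size_takel.
have := @den_load _ G d TV N v0 q s uR isT st1 ev0 eR hv0 h1.
move: (den (load TV) s) => s1 es1.
have a1 : s1.2 TU = ([::], nseq N true) by rewrite es1.
have a2 : s1.2 TZ = ([::], z0) by rewrite es1.
have a3 : s1.2 TR = (catrev v uR, drop N q) by rewrite es1.
have := @den_load _ G d TZ N z0 _ s1 _ isT a1 a2 a3 hz0 h2.
move: (den (load TZ) s1) => s2 es2.
have b1 : s2.2 TU = ([::], nseq N true) by rewrite es2.
have b2 : s2.2 TX = ([::], x0) by rewrite es2 [LHS]/= es1.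
have b3 : s2.2 TR = (catrev z (catrev v uR), drop N (drop N q)) by rewrite es2.
have := @den_load _ G d TX N x0 _ s2 _ isT b1 b2 b3 hx0 h3.
move: (den (load TX) s2) => s3 es3.
have c1 : s3.2 TU = ([::], nseq N true) by rewrite es3.
have c2 : s3.2 TJ = ([::], j0) by rewrite es3 [LHS]/= es2 [LHS]/= es1.
have c3 : s3.2 TR = (catrev x (catrev z (catrev v uR)), drop N (drop N (drop N q))).
  by rewrite es3.
have := @den_load _ G d TJ N j0 _ s3 _ isT c1 c2 c3 hj0 h4.
move: (den (load TJ) s3) => s4 es4.
have {es1 es2 es3 es4 a1 a2 a3 b1 b2 b3 c1 c2 c3} [r4 es4] :
  s4.1 = s.1 /\ forall y, s4.2 y = match y with
    | TV => ([::], v) | TZ => ([::], z) | TX => ([::], x) | TJ => ([::], j)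
    | TR => (catrev j (catrev x (catrev z (catrev v uR))), drop (4 * N) q)
    | _ => s.2 y end.
  split; first by rewrite es4 es3 es2 es1.
  have ed : drop N (drop N (drop N (drop N q))) = drop (4 * N) q.
    by rewrite !drop_drop; congr drop; lia.
  rewrite es4 -ed; case=> [||||||||||||||||b i|b l|i] //; rewrite [LHS]/= es3 //;
    rewrite [LHS]/= es2 //; by rewrite [LHS]/= es1.
have := erefl (den (Do (fun (r : D) (_ : view X) => (set_carry false r, fun=> Keep))) s4).
move: {2 3}(den (Do _) s4) => s5 es5.
have {es5} [r5 es5] : s5.1 = set_carry false s.1 /\ forall y, s5.2 y = s4.2 y.
  by rewrite -es5; split=> //=; rewrite r4.
have t1 : static s5 by split=> [||| b l|i]; rewrite es5 es4.
have t2 i : s5.2 (TF true i) = ([::], nseq N.+1 true) by rewrite es5 es4.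
have t3 : s5.2 TV = ([::], v) by rewrite es5 es4.
have t4 : s5.2 TS = ([::], counter mk 0) by rewrite es5 es4.
have t5 : s5.2 TZ = ([::], z) by rewrite es5 es4.
have t6 : s5.2 TX = ([::], x) by rewrite es5 es4.
have t7 : s5.2 TJ = ([::], j) by rewrite es5 es4.
have t8 : s5.2 TW = ([::], w0) by rewrite es5 es4.
have t9 : carry s5.1 = false by rewrite r5.
have [o' [ho']] := den_enumerate t1 t9 t2 t3 t4 t5 t6 t7 t8 sv sz sx sj hw0.
move: (den (nest true _) s5) => s6 s6E; case: s6E => r6 es6.
have [l1 l2] := counts_le v z x j.
have e0 : ([::], nseq (2 * N.+1 ^ d) true) = (nseq 0 true, nseq (2 * N.+1 ^ d) true) by [].
have k1 : s6.2 TU = ([::], nseq N true) by rewrite es6 es5 es4.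
have k2 : s6.2 TV = ([::], v) by rewrite es6 es5 es4.
have k3 : s6.2 TZ = ([::], z) by rewrite es6 es5 es4.
have k4 : s6.2 TO = ([::], o) by rewrite es6 es5 es4.
have k5 : s6.2 TA = (nseq (plus_count v z) true, nseq (2 * N.+1 ^ d - plus_count v z) true).
  by rewrite es6 es5 es4 eA e0 steps_unary // addn0.
have k6 : s6.2 TB = (nseq (minus_count v z + above_count x j) true,
    nseq (2 * N.+1 ^ d - (minus_count v z + above_count x j)) true).
  by rewrite es6 es5 es4 eB e0 steps_unary // addn0.
have := den_decide k1 k2 k3 k4 sv sz so k5 k6 (subnKC l1) (subnKC l2).
move: (den (decide G d) s6) => s7 es7.
have f6 : fin s6.1 = fin s.1 by rewrite r6 r5.
have E y : y \notin [:: TO; TA; TB : X] -> s7.2 y = match y with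
    | TW => ([::], o') | _ => s4.2 y end.
  by rewrite es7; case: y => // *; rewrite /= es6 ?es5.
rewrite -/(accepting v z x j) in es7.
split.
- split; first split.
  + by split=> [||| b l|i]; rewrite E // es4.
  + by move=> i; rewrite E // es4.
  + by rewrite E // es4.
  + by rewrite es7.
  + move=> y; rewrite !inE => /or4P[/eqP->|/eqP->|/eqP->|/orP[]/eqP->]; rewrite E ?es4 //.
    * by exists v.
    * by exists z.
    * by exists x.
    * by exists j.
    * by exists o'.
- by rewrite es7 /= f6.
- by rewrite es7 /= f6.
- by eexists; rewrite E // es4.
- by rewrite !E // !es4.
Qed.

(** The first accepting attempt fixes the outcome. The zero word stands in as long as none has
    accepted, and is the only source of error. *)
Fixpoint outcome_after (t : nat) (q : seq bool) : bool * seq bool :=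
  if t is t'.+1 then
    let: (f, o) := outcome_after t' q in
    let q' := drop (4 * N * t') q in
    let v := take N q' in
    let z := take N (drop N q') in
    let x := take N (drop N (drop N q')) in
    let j := take N (drop N (drop N (drop N q'))) in
    (f || accepting v z x j,
     if accepting v z x j && ~~ f then head false v :: behead z else o)
  else (false, nseq N false).

Lemma size_outcome_after t q : 4 * N * t <= size q -> size (outcome_after t q).2 = N.
Proof.
elim: t => [|t IH] /=; first by rewrite size_nseq.
move=> hs; have := IH ltac:(lia); case: (outcome_after t q) => f o /= so.
by case: ifP => // _; rewrite /= size_behead size_takel // !size_drop; lia.
Qed.

Lemma attempt_avoids i : avoids (TF false i) (attempt G d).
Proof.
have hl (y : X) : y \in [:: TV; TZ; TX; TJ : X] -> avoids (TF false i) (load y).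
  rewrite !inE => hy; have ny : TF false i <> y by move: hy => /or4P[] /eqP ->.
  split; last by apply: avoids_rewinds; rewrite /= orbF; apply/eqP.
  split=> // r v /=; case: eqP => // e; by case: (ny e).
apply: conj; first by do 3 (apply: conj; first exact: hl); apply: hl.
apply: conj; first by [].
apply: conj.
  apply: avoids_nest => //; apply: conj; last by [].
  apply: conj; last apply: conj; last apply: conj.
  - by do !apply: conj => //; apply: avoids_rewinds.
  - by do !apply: conj => //; apply: avoids_rewinds.
  - by do !apply: conj.
  - by do !apply: conj => //; apply: avoids_rewinds.
apply: conj; first by [].
apply: conj; last exact: avoids_rewinds.
apply: conj; last by [].
apply: conj; first by [].
apply: conj; first by [].
by apply: conj; first exact: avoids_rewinds.
Qed.

Lemma den_print (kk o u : seq bool) s : s.2 TK = ([::], kk) -> s.2 TO = ([::], o) ->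
  s.2 TI = (u, [::]) -> size o = size kk ->
  ((den (print G d) s).2 TI).2 = rev (mask kk o).
Proof.
move=> e1 e2 e3 hs; rewrite /print den_for e1 [(_, _).2]/=.
have loop uk uo r s0 : s0.2 TK = (uk, kk) -> s0.2 TO = (uo, o) -> (s0.2 TI).2 = r ->
   ((iter (size kk) (fun s => forward TK (den (act (fun v y =>
    match y with
    | TI => if v TK == Some true then Push (v TO == Some true) else Keep
    | TO => Forward
    | _ => Keep
    end)) s)) s0).2 TI).2 = catrev (mask kk o) r.
  elim: kk o uk uo r s0 hs {e1 e2} => [|a kk IH] [|b o] uk uo r s0 // hs f1 f2 f3.
  case: hs => hs; rewrite [size _]/= iterSr.
  rewrite (IH o (a :: uk) (b :: uo) (if a then b :: r else r)) //.
  - by case: (a).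
  - by rewrite /= /upd /= f1.
  - by rewrite /= /upd /= f2.
  - by rewrite /= /upd /= /view_of f1 f2 /= ; case: (a) => //=; rewrite f3; case: (b).
by rewrite (loop [::] [::] [::]) // e3.
Qed.

Lemma ready_insensitive : insensitive (d := d) false ready.
Proof.
move=> s s' e1 e2 [[[a1 a2 a3 a4 a5] b1 b2 [b3 b4]] w].
split; first split; [split|..]; try by (move=> *; rewrite -e2).
  by split; rewrite -e2.
move=> y hy; have [v hv e] := w y hy; exists v => //; rewrite -e2 //.
by move: hy {e}; rewrite !inE => /or4P[/eqP->|/eqP->|/eqP->|/orP[]/eqP->].
Qed.

Lemma den_sample s (kk rho : seq bool) uI :
  ready s -> fin s.1 = false -> s.2 TK = ([::], kk) -> s.2 TO = ([::], nseq N false) ->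
  (forall i, s.2 (TF false i) = ([::], nseq N.+1 true)) -> s.2 TI = uI ->
  s.2 TR = (catrev rho [::], [::]) -> size kk = N -> size rho = 4 * N * N.+1 ^ d ->
  ((den (sample G d) s).2 TI).2 = rev (mask kk (outcome_after (N.+1 ^ d) rho).2).
Proof.
move=> rs fs eK eO eF eI eR sk sr; rewrite /sample den_seq.
set s1 := den (Seq _ _) s.
have sampleE : s1 = den (For TI predT (skip G d)) (den (nest false (attempt G d))
  (den (Rewind D TR) s)) by [].
(* Guarded by the bound on [t], because [nest_rule] asks for every round while the random bits last
   for (N+1)^d attempts only. *)
pose P t (s' : store X D) := t <= N.+1 ^ d -> [/\ ready s', fin s'.1 = (outcome_after t rho).1,
  s'.2 TO = ([::], (outcome_after t rho).2),
  exists u, s'.2 TR = (u, drop (4 * N * t) rho) & s'.2 TI = uI /\ s'.2 TK = ([::], kk)].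
have [|||||h h'] := @nest_rule _ G d false (attempt G d) P N.+1 (den (Rewind D TR) s).
- move=> t s2 s3 es1 es2 h ht; have [q1 q2 q3 [u' q4] [q5 q6]] := h ht.
  split; rewrite -?es1 -?es2 //; first exact: ready_insensitive q1.
  by exists u'.
- move=> t s2 h ht; have [q1 q2 q3 [u' q4] [q5 q6]] := h (ltnW ht).
  have hs : 4 * N * t + 4 * N <= size rho by rewrite sr -(mulnSr (4 * N) t) leq_mul.
  have sd : 4 * N <= size (drop (4 * N * t) rho) by rewrite size_drop; lia.
  have so : size (outcome_after t rho).2 = N by apply: size_outcome_after; lia.
  have [p1 p2 p3 [u2 p4] [p5 p6]] := den_attempt q1 q4 sd q3 so.
  split=> //.
  + by rewrite p2 q2 /=; case: (outcome_after t rho).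
  + by rewrite p3 q2 /=; case: (outcome_after t rho).
  + by exists u2; rewrite p4 drop_drop (mulnSr (4 * N) t) addnC.
  + by rewrite p5 p6.
- by move=> s2 i; apply: den_avoids; apply: attempt_avoids.
- by move=> i; rewrite /= /upd /= eF.
- move=> _; split.
  + case: rs => [[[a1 a2 a3 a4 a5] b1 b2 [b3 b4]] w]; split; first by split; [split|..].
    move=> y hy; have [v hv e] := w y hy; exists v => //; rewrite -e.
    by move: hy {e}; rewrite !inE => /or4P[/eqP->|/eqP->|/eqP->|/orP[]/eqP->].
  + by rewrite /= fs.
  + by rewrite /= /upd /= eO.
  + by exists [::]; rewrite /= /upd /= eR /rewind /= catrevK muln0 drop0.
  + by rewrite /= /upd /= eK eI.
have [p1 p2 p3 _ [p5 p6]] := h (leqnn _).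
have skip_loop s0 v u0 : s0.2 TI = (u0, v) -> exists u1,
    den (For TI predT (skip G d)) s0 = (s0.1, fun y => if y is TI then (u1, [::]) else s0.2 y).
  rewrite den_for => e; rewrite e [(_, _).2]/=.
  elim: v s0 u0 e => [|b v IH] s0 u0 e.
    by exists u0; apply: store_ext => //; case=> //=; rewrite e.
  have [|u1 e1] := IH (forward TI (den (skip G d) s0)) (b :: u0).
    by rewrite den_skip /forward /upd /= e.
  exists u1; rewrite [size _]/= iterSr e1.
  by apply: store_ext => // y; case: y.
case E: uI p5 => [uu vv] p5.
have [u1 e1] := skip_loop _ _ _ p5.
rewrite sampleE e1 (@den_print kk (outcome_after (N.+1 ^ d) rho).2 u1) //.
by rewrite size_outcome_after ?sr ?sk.
Qed.

End Sampling.

Import Order.TTheory GRing.Theory Num.Theory.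

Local Open Scope ring_scope.

(** * Averages over random bits *)

Section Average.

Variable R : realType.

(** Expectation over [n] fair bits. The recursive form makes splitting a word into independent parts
    a plain induction. *)
Fixpoint avg (n : nat) (F : seq bool -> R) : R :=
  if n is n'.+1 then
    (avg n' (fun q => F (true :: q)) + avg n' (fun q => F (false :: q))) / 2
  else F [::].

Lemma avg_ext n F G : (forall q, size q = n -> F q = G q) -> avg n F = avg n G.
Proof.
elim: n F G => [|n IH] F G h /=; first exact: h.
by congr ((_ + _) / _); apply: IH => q hq; apply: h; rewrite /= hq.
Qed.

Lemma avg_const n c : avg n (fun=> c) = c.
Proof. by elim: n => //= n ->; lra. Qed.

Lemma avgD n F G : avg n (fun q => F q + G q) = avg n F + avg n G.
Proof. by elim: n F G => //= n IH F G; rewrite !IH; lra. Qed.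

Lemma avgZ n c F : avg n (fun q => c * F q) = c * avg n F.
Proof. by elim: n F => //= n IH F; rewrite !IH; ring. Qed.

Lemma avg_sum n (I : finType) (F : I -> seq bool -> R) :
  avg n (fun q => \sum_i F i q) = \sum_i avg n (F i).
Proof.
elim: n F => //= n IH F; rewrite !IH -big_split /= mulr_suml.
by apply: eq_bigr.
Qed.

Lemma avg_cat a b F : avg (a + b) F = avg a (fun x => avg b (fun y => F (x ++ y))).
Proof. by elim: a F => //= a IH F; rewrite !IH. Qed.

Lemma sum_tuple_cons n (F : n.+1.-tuple bool -> R) :
  \sum_t F t = \sum_(t : n.-tuple bool) F [tuple of true :: t]
             + \sum_(t : n.-tuple bool) F [tuple of false :: t].
Proof.
rewrite (bigID (fun t => thead t)) /=; congr (_ + _).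
  rewrite (reindex (fun t : n.-tuple bool => [tuple of true :: t])) /=.
    by apply: eq_bigl.
  exists (fun t : n.+1.-tuple bool => [tuple of behead t]) => t; first by move=> _; apply: val_inj.
  by rewrite inE => h; rewrite [RHS]tuple_eta; apply: val_inj; rewrite /= h.
rewrite (reindex (fun t : n.-tuple bool => [tuple of false :: t])) /=.
  by apply: eq_bigl.
exists (fun t : n.+1.-tuple bool => [tuple of behead t]) => t; first by move=> _; apply: val_inj.
by rewrite inE => /negPf h; rewrite [RHS]tuple_eta; apply: val_inj; rewrite /= h.
Qed.

Lemma avg_tuple n F : avg n F = (\sum_(t : n.-tuple bool) F t) / 2 ^+ n.
Proof.
elim: n F => [|n IH] F /=.
  rewrite expr0 divr1 (big_pred1 [tuple]) // => t; apply/esym/eqP; exact: tuple0.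
by rewrite !IH sum_tuple_cons exprS invfM [2^-1 * _]mulrC mulrA !mulrDl.
Qed.

Lemma avg_rev n F : avg n F = (\sum_(t : n.-tuple bool) F (rev t)) / 2 ^+ n.
Proof.
rewrite avg_tuple (reindex_inj (h := fun t : n.-tuple bool => [tuple of rev t])) //.
by move=> s t /(congr1 val) /= /(congr1 rev); rewrite !revK => /val_inj.
Qed.

Lemma sum_double K (h : nat -> R) :
  \sum_(t < 2 * K) h t = \sum_(t < K) (h (1 + 2 * t)%N + h (2 * t)%N).
Proof.
elim: K => [|K IH]; first by rewrite muln0 !big_ord0.
have -> : (2 * K.+1 = (2 * K).+2)%N by lia.
by rewrite !big_ord_recr /= IH -addrA [h (2 * K)%N + _]addrC.
Qed.

(** The masked bits of a uniform word spell a uniform number below 2^k, least significant first; the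
    other bits average out. *)
Lemma avg_mask_value mk (h : nat -> R) :
  avg (size mk) (fun i => h (mask_value mk i))
  = (\sum_(t < 2 ^ count id mk) h t) / 2 ^+ count id mk.
Proof.
elim: mk h => [|[] mk IH] h /=.
- by rewrite expn0 big_ord1 expr0 divr1.
- rewrite (IH (fun t => h (1 + 2 * t)%N)) (IH (fun t => h (0 + 2 * t)%N)) add1n expnS.
  by rewrite sum_double big_split exprS invfM [2^-1 * _]mulrC mulrA !mulrDl.
- by rewrite IH; lra.
Qed.

Lemma avg_slice T a n (F : seq bool -> R) : (a + n <= T)%N ->
  avg T (fun c => F (take n (drop a c))) = avg n F.
Proof.
move=> h; have -> : T = (a + (n + (T - (a + n))))%N by lia.
rewrite avg_cat -[RHS](avg_const a); apply: avg_ext => x hx.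
rewrite avg_cat; apply: avg_ext => y hy.
rewrite -[RHS](avg_const (T - (a + n))); apply: avg_ext => z hz.
by rewrite drop_size_cat // take_size_cat.
Qed.

End Average.

(** * The output distribution of the sampler *)

Section Distribution.

Variables (R : realType) (m : nat) (G : 'I_m -> gate_kind) (n : nat).
Variables (C : circuit G n.+1) (wC : wf_circuit C).
Local Notation N := n.+1.
Local Notation word := (N.-tuple bool).

Section Blocks.

Variable mk : seq bool.

Definition block_accepts (q : seq bool) : bool :=
  accepting C mk (take N q) (take N (drop N q)) (take N (drop N (drop N q)))
    (take N (drop N (drop N (drop N q)))).

Definition block_output (q : seq bool) : seq bool :=
  head false (take N q) :: behead (take N (drop N q)).

Lemma block_cat q q' : (4 * N <= size q)%N ->
  block_accepts (q ++ q') = block_accepts q /\ block_output (q ++ q') = block_output q.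
Proof.
move=> h.
have tk l : (N <= size l)%N -> take N (l ++ q') = take N l by move=> hl; rewrite takel_cat.
have dr l : (N <= size l)%N -> drop N (l ++ q') = drop N l ++ q'.
  by move=> hl; rewrite drop_cat; case: ltnP => // h2;
    rewrite (_ : N - size l = 0)%N ?drop0 ?drop_oversize //; lia.
by rewrite /block_accepts /block_output !dr ?tk ?size_drop //; lia.
Qed.

Lemma outcome_afterS t q : outcome_after C mk t.+1 q =
  let a := block_accepts (drop (4 * N * t) q) in
  let: (f, o) := outcome_after C mk t q in
  (f || a, if a && ~~ f then block_output (drop (4 * N * t) q) else o).
Proof. by []. Qed.

Lemma outcome_after_cat t q q' : (4 * N * t <= size q)%N ->
  outcome_after C mk t (q ++ q') = outcome_after C mk t q.
Proof.
elim: t => [|t IH] // h; rewrite !outcome_afterS IH; last by lia.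
rewrite drop_cat; case: ltnP => h1; last by lia.
by have [|-> ->] := @block_cat (drop (4 * N * t) q) q'; first by rewrite size_drop; lia.
Qed.

(** For general [phi] the induction can absorb the last attempt: averaging over its block turns
    [phi] into another function [psi], to which the hypothesis applies. With acceptance probability
    [al], the attempt numbered i, from 0, is the first to accept with weight (1 - al)^i. *)
Lemma avg_outcome (phi : bool -> seq bool -> R) t
    (al := avg (4 * N) (fun q => (block_accepts q)%:R))
    (be := avg (4 * N) (fun q => (block_accepts q)%:R * phi true (block_output q))) :
  avg (4 * N * t) (fun q => phi (outcome_after C mk t q).1 (outcome_after C mk t q).2)
  = (1 - al) ^+ t * phi false (nseq N false) + (\sum_(i < t) (1 - al) ^+ i) * be.
Proof.
rewrite /be {be}; elim: t phi => [|t IH] phi.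
  by rewrite muln0 /= big_ord0 mul0r addr0 expr0 mul1r.
pose psi f o := avg (4 * N) (fun q =>
  phi (f || block_accepts q) (if block_accepts q && ~~ f then block_output q else o)).
have -> : avg (4 * N * t.+1)
    (fun q => phi (outcome_after C mk t.+1 q).1 (outcome_after C mk t.+1 q).2) =
  avg (4 * N * t) (fun q => psi (outcome_after C mk t q).1 (outcome_after C mk t q).2).
  rewrite mulnSr avg_cat; apply: avg_ext => q1 h1; apply: avg_ext => q2 h2.
  rewrite outcome_afterS outcome_after_cat ?h1 // -h1 drop_size_cat //.
  by case: (outcome_after C mk t q1).
rewrite IH.
(* An accepted outcome is never changed by later attempts. *)
have p1 o : psi true o = phi true o.
  by rewrite -[RHS](avg_const (4 * N)); apply: avg_ext => q _; rewrite andbF.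
have -> : avg (4 * N) (fun q => (block_accepts q)%:R * psi true (block_output q)) =
    avg (4 * N) (fun q => (block_accepts q)%:R * phi true (block_output q)).
  by apply: avg_ext => q _; rewrite p1.
set be := avg _ (fun q => _ * phi true _).
have -> : psi false (nseq N false) = be + (1 - al) * phi false (nseq N false).
  rewrite mulrBl mul1r -[X in _ = _ + (X - _)](avg_const (4 * N)) /al mulrC -mulNr -!avgZ -!avgD.
  apply: avg_ext => q _ /=; case: (block_accepts q) => /=; rewrite ?mul1r ?mul0r; ring.
rewrite big_ord_recr exprSr /=; ring.
Qed.

Lemma avg_block (F : seq bool -> seq bool -> seq bool -> seq bool -> R) :
  avg (4 * N) (fun q => F (take N q) (take N (drop N q)) (take N (drop N (drop N q)))
    (take N (drop N (drop N (drop N q))))) =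
  avg N (fun v => avg N (fun z => avg N (fun x => avg N (fun j => F v z x j)))).
Proof.
have -> : (4 * N = N + (N + (N + N)))%N by lia.
rewrite avg_cat; apply: avg_ext => v hv; rewrite avg_cat; apply: avg_ext => z hz.
rewrite avg_cat; apply: avg_ext => x hx; apply: avg_ext => j hj.
by rewrite !(drop_size_cat, take_size_cat) // take_oversize ?hj.
Qed.

Local Notation k := (count id mk).

Lemma sum_geq K c : (\sum_(t < K) (c <= t))%N = (K - c)%N.
Proof. by elim: K => [|K IH]; rewrite ?big_ord0 // big_ord_recr /= IH; case: leqP; lia. Qed.

Lemma above_countE x j : size x = size mk -> size j = size mk ->
  above_count mk x j = (2 ^ k - minn (mask_value mk x) (mask_value mk j))%N.
Proof.
move=> hx hj; rewrite -sum_geq /above_count; apply: eq_bigr => t _; congr nat_of_bool.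
rewrite /above !geq_maskedE ?size_counter // counter_value //.
by apply/idP/idP; do 2 case: eqP; lia.
Qed.

Lemma plus_count_le v z : (plus_count C mk v z <= 2 ^ k)%N.
Proof.
rewrite -[X in (_ <= X)%N]card_ord -sum1_card; apply: leq_sum => t _; exact: leq_b1.
Qed.

(** The two numbers are independent, and each passes its threshold with probability max(P - Q,
    0)/2^k; the truncated subtraction of naturals is this positive part. *)
Lemma avg_accepting v z : size mk = N ->
  avg N (fun x => avg N (fun j => (accepting C mk v z x j)%:R)) =
  ((plus_count C mk v z - minus_count C mk v z)%N%:R / 2 ^+ k) ^+ 2 :> R.
Proof.
move=> sm; set P := plus_count _ _ _ _; set Q := minus_count _ _ _ _.
pose h t : R := (Q + 2 ^ k <= P + t)%N%:R.
have hP : (P <= 2 ^ k)%N := plus_count_le v z.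
have av : avg N (fun x => h (mask_value mk x)) = (P - Q)%N%:R / 2 ^+ k.
  rewrite -sm avg_mask_value; congr (_ / _).
  rewrite -natr_sum; congr (_%:R).
  rewrite (eq_bigr (fun t : 'I_(2 ^ k) => nat_of_bool (2 ^ k - (P - Q) <= t)%N)).
    rewrite sum_geq; lia.
  by move=> t _; congr nat_of_bool; move: (ltn_ord t) => ht; apply/idP/idP; lia.
rewrite expr2 -av -avgZ; apply: avg_ext => x hx.
rewrite [RHS]mulrC -avgZ; apply: avg_ext => j hj.
rewrite /accepting above_countE ?hx ?hj ?sm // -/P -/Q /h -natrM mulnb; congr (nat_of_bool _)%:R.
have := mask_value_bound mk x; have := mask_value_bound mk j.
by move=> h1 h2; apply/idP/idP; rewrite -?/(_ && _); lia.
Qed.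

End Blocks.

Variable K : {set 'I_N}.
Let M := [pred j : 'I_N | (j \in K) && (j != ord_max)].
Let kk := [seq j \in K | j <- enum 'I_N].
Let mk := false :: behead (rev kk).
Local Notation k := (count id mk).
Local Notation front := (fun j : 'I_N => j != ord_max).

Lemma size_mk : size mk = N.
Proof. by rewrite /= size_behead size_rev size_map size_enum_ord. Qed.

Lemma nth_mk (i : 'I_N) : nth false mk i = M (rev_ord i).
Proof.
have skk : size kk = N by rewrite size_map size_enum_ord.
have e (l : 'I_N) : nth false kk l = (l \in K).
  by rewrite (nth_map ord0) ?size_enum_ord // nth_ord_enum.
case: (posnP i) => [i0|ip].
  rewrite i0 /= (_ : rev_ord i = ord_max) ?eqxx ?andbF //.
  by apply: val_inj; rewrite /= i0 subn1.
have -> : nth false mk i = nth false (rev kk) i.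
  by rewrite /mk -(prednK ip) /= nth_behead.
rewrite nth_rev skk // (_ : N - i.+1 = rev_ord i)%N // e /M /=.
rewrite (_ : rev_ord i != ord_max) ?andbT //.
by apply/eqP => /(congr1 val) /=; have := ltn_ord i; lia.
Qed.

Lemma nth_rev_word (s : word) (i : 'I_N) : nth false (rev s) i = tnth s (rev_ord i).
Proof. by rewrite nth_rev size_tuple // (tnth_nth false). Qed.

Lemma under_nth (a s : seq bool) : size s = size a ->
  reflect (forall i, (i < size a)%N -> nth false s i -> nth false a i) (under a s).
Proof.
elim: a s => [|b a IH] [|c s] //= ; first by move=> _; left.
move=> [hs]; apply: (iffP andP) => [[h1 /(IH _ hs) h2] [|i] hi /=|h].
- by move/(implyP h1).
- exact: h2.
- split; first by apply/implyP; apply: (h 0%N).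
  by apply/(IH _ hs) => i hi; apply: (h i.+1).
Qed.

Lemma under_supported (s : word) : under mk (rev s) = supported M s.
Proof.
apply/under_nth/forallP => [|h j|h i]; first by rewrite size_rev size_tuple size_mk.
  apply/implyP => sj; have := h (rev_ord j); rewrite size_mk ltn_ord nth_rev_word nth_mk rev_ordK.
  by apply.
rewrite size_mk => iN; have /implyP := h (rev_ord (Ordinal iN)).
by rewrite -nth_rev_word -nth_mk.
Qed.

(** The counter visits each element of V exactly once; its inverse sends a word to the number that
    it spells under the mask. *)
Lemma sum_counter (T : nmodType) (F : seq bool -> T) :
  \sum_(t < 2 ^ k) F (counter mk t) = \sum_(s : word | supported M s) F (rev s).
Proof.
have sc t : size (counter mk t) = N by rewrite size_counter size_mk.
rewrite (reindex (fun t : 'I_(2 ^ k) => rev_word n (counter mk t))) /=.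
  apply: eq_big => [t|t _]; last by rewrite rev_wordK.
  by rewrite -under_supported rev_wordK // counter_under.
exists (fun s => Ordinal (mask_value_bound mk (rev s))) => [t _|s].
  apply: val_inj; rewrite -[RHS](@counter_value mk t) //; congr mask_value; exact: rev_wordK.
rewrite inE -under_supported => us.
have -> : counter mk (Ordinal (mask_value_bound mk (rev s))) = rev s.
  by apply: mask_value_counter => //; rewrite size_rev size_tuple.
by apply: val_inj; rewrite -[LHS]revK rev_wordK ?revK // size_rev size_tuple.
Qed.

Lemma card_supported : #|[set s : word | supported M s]| = (2 ^ k)%N.
Proof.
rewrite -[RHS]card_ord -!sum1_card [RHS](sum_counter (fun=> 1%N)).
by apply: eq_bigl => s; rewrite inE.
Qed.

Lemma nth_xor_masked v a s i : size a = size v -> size s = size v -> (i < size v)%N ->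
  nth false (xor_masked v a s) i = nth false v i (+) (nth false a i && nth false s i).
Proof. by elim: v a s i => [|b v IH] [|c a] [|e s] [|i] //= [h1] [h2] h3; apply: IH. Qed.

Lemma hitE (v s : word) : supported M s ->
  hit C mk (rev v) (rev s) = reached C (xorw v s).
Proof.
move=> us; rewrite /hit; congr reached; apply: eq_from_tnth => j; rewrite !tnth_mktuple.
have sx : size (xor_masked (rev v) mk (rev s)) = N.
  by rewrite size_xor_masked ?size_mk ?size_rev ?size_tuple.
rewrite nth_rev ?sx // (_ : N - j.+1 = rev_ord j)%N //.
rewrite nth_xor_masked ?size_mk ?size_rev ?size_tuple // !nth_rev_word nth_mk rev_ordK.
by have /forallP /(_ j) := us; case: (tnth s j) => /= [->|_]; rewrite ?andbF.
Qed.

Lemma parity_maskedE p a s z : size s = size a -> size z = size a ->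
  (-1) ^+ parity_masked p a s z = (-1) ^+ p * \prod_(i < size a)
    (-1) ^+ [&& nth false a i, nth false s i & nth false z i] :> R.
Proof.
elim: a p s z => [|b a IH] p [|c s] [|e z] //=; first by rewrite big_ord0 mulr1.
move=> [h1] [h2]; rewrite IH // big_ord_recl /= mulrA; congr (_ * _).
by rewrite signr_addb.
Qed.

(** Elements of V vanish off M, so the masked parity is the whole front character; the initial
    parity contributes the random sign. *)
Lemma odd_termE (x s : word) : supported M s ->
  (-1) ^+ odd_term mk (rev x) (rev s) = (-1) ^+ tnth x ord_max * sgn R front x s.
Proof.
move=> us; rewrite /odd_term parity_maskedE ?size_mk ?size_rev ?size_tuple // head_rev_word.
congr (_ * _); rewrite /sgn [RHS]big_mkcond (reindex_inj rev_ord_inj).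
apply: eq_bigr => j _; rewrite nth_mk !nth_rev_word rev_ordK.
have /forallP /(_ j) := us; rewrite /M /=.
case: (tnth s j) => /=; rewrite ?andbF ?andbT ?if_same //.
by move=> /andP[-> ->].
Qed.

Lemma count_diff (v x : word) :
  (plus_count C mk (rev v) (rev x))%:R - (minus_count C mk (rev v) (rev x))%:R =
  (-1) ^+ tnth x ord_max * coset_sum R C M v x.
Proof.
rewrite /plus_count /minus_count !natr_sum -sumrB.
pose F c : R := (hit C mk (rev v) c && ~~ odd_term mk (rev x) c)%:R
  - (hit C mk (rev v) c && odd_term mk (rev x) c)%:R.
rewrite (sum_counter F) /coset_sum mulr_sumr big_mkcondr /=; apply: eq_bigr => s us.
rewrite /F hitE //; case: ifP => _ /=; last by rewrite subrr.
by rewrite -odd_termE //; case: (odd_term _ _ _); rewrite ?expr1 ?expr0 ?subr0 ?sub0r.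
Qed.

Lemma mask_output (v x : word) :
  rev (mask (rev kk) (head false (rev v) :: behead (rev x))) = outcome K v x.
Proof.
set o := head _ _ :: _.
have so : size o = N by rewrite /= size_behead size_rev size_tuple.
pose q := [seq (if j == ord_max then tnth v j else tnth x j) | j <- enum 'I_N].
have sq : size q = N by rewrite size_map size_enum_ord.
have nq (i : 'I_N) : nth false q i = if i == ord_max then tnth v i else tnth x i.
  by rewrite (nth_map ord0) ?size_enum_ord // nth_ord_enum.
have -> : o = rev q.
  apply: (@eq_from_nth _ false) => [|i]; first by rewrite size_rev sq.
  rewrite so => iN; rewrite nth_rev sq //.
  rewrite (nq (rev_ord (Ordinal iN))).
  case: i iN => [|i] iN.
    rewrite (_ : rev_ord _ = ord_max) ?eqxx; last by apply: val_inj; rewrite /= subn1.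
    by rewrite /o /= head_rev_word.
  rewrite ifN; last by apply/eqP => /(congr1 val) /=; lia.
  by rewrite /o /= nth_behead (nth_rev_word x (Ordinal iN)).
have skk : size kk = N by rewrite size_map size_enum_ord.
rewrite -rev_mask ?skk ?sq // revK /outcome /q /kk -map_mask -filter_mask enumT.
by congr map; apply: eq_filter.
Qed.

(** Conditionally on acceptance an attempt has exactly the law p. The constant is that of
    [sum_coset2], 2 2^k 4^n, over 2 4^N 4^k, where 4^N counts the pairs v, x, 4^k the pairs of
    numbers, and the 2 is the random sign; with N = n + 1 this is 1/(4 2^k). *)
Lemma avg_block_output (z : seq bool) :
  avg (4 * N) (fun q => (block_accepts mk q)%:R *
    (rev (mask (rev kk) (block_output q)) == z)%:R) =
  hc1q_prob R C K z / (4 * 2 ^+ k).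
Proof.
rewrite (avg_block (fun v x i j => (accepting C mk v x i j)%:R *
  (rev (mask (rev kk) (head false v :: behead x)) == z)%:R)).
transitivity (avg (R := R) N (fun v => avg N (fun x =>
    (rev (mask (rev kk) (head false v :: behead x)) == z)%:R *
    ((plus_count C mk v x - minus_count C mk v x)%N%:R / 2 ^+ k) ^+ 2))).
  apply: avg_ext => v _; apply: avg_ext => x _; rewrite -avg_accepting ?size_mk // -avgZ.
  by apply: avg_ext => i _; rewrite -avgZ; apply: avg_ext => j _; rewrite mulrC.
rewrite avg_rev (eq_bigr (fun v : word => (\sum_(x : word | outcome K v x == z)
   coset_sum R C M v x ^+ 2) / (2 * 2 ^+ N * (2 ^+ k) ^+ 2))).
  rewrite -mulr_suml sum_coset2 card_supported natrX hc1q_probE //.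
  set S := \sum_(x : word | _) _.
  have e4 : (4 : R) ^+ n = 2 ^+ n * 2 ^+ n by rewrite -exprMn -natrM.
  rewrite e4 (exprS _ n); field; by rewrite !expf_neq0 ?pnatr_eq0.
move=> v _; rewrite avg_rev.
pose F (x : word) : R := (outcome K v x == z)%:R *
  ((plus_count C mk (rev v) (rev x) - minus_count C mk (rev v) (rev x))%N%:R) ^+ 2.
have FE (x : word) : F x = (outcome K v x == z)%:R *
    (Num.max 0 ((-1) ^+ tnth x ord_max * coset_sum R C M v x)) ^+ 2.
  rewrite /F -count_diff; congr (_ * _ ^+ 2).
  set P := plus_count _ _ _ _; set Q := minus_count _ _ _ _.
  case: (leqP Q P) => h; first by rewrite natrB // max_r // subr_ge0 ler_nat.
  have -> : (P - Q = 0)%N by lia.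
  by rewrite max_l // subr_le0 ler_nat ltnW.
rewrite (eq_bigr (fun x => F x / (2 ^+ k) ^+ 2)); last first.
  by move=> x _; rewrite mask_output /F expr_div_n mulrA.
rewrite -mulr_suml.
have ol b (x : word) : outcome K v (set_last b x) = outcome K v x.
  by rewrite /outcome; apply: eq_map => j; case: eqP => // /eqP /negPf nj; rewrite tnth_mktuple nj.
have cl b (x : word) : coset_sum R C M v (set_last b x) = coset_sum R C M v x.
  rewrite /coset_sum; apply: eq_bigr => s _; rewrite /sgn; apply: eq_bigr => j /negPf nj.
  by rewrite tnth_mktuple nj.
(* Both signs are paired for one outcome and one D; the squares of the positive parts of D and -D
   add up to D^2. *)
have sF : 2 * \sum_(x : word) F x = \sum_(x : word) (F (set_last true x) + F (set_last false x)).
  rewrite big_split /= !sum_set_last -mulrDr; congr (_ * _).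
  rewrite (bigID (fun x : word => tnth x ord_max)) /=; congr (_ + _); apply: eq_bigl => x.
    by case: (tnth _ _).
  by case: (tnth _ _).
have -> : \sum_(x : word | outcome K v x == z) coset_sum R C M v x ^+ 2 = 2 * \sum_(x : word) F x.
  rewrite sF big_mkcond /=; apply: eq_bigr => x _.
  rewrite !FE !ol !cl !tnth_mktuple eqxx expr1 expr0 mul1r mulN1r -mulrDr.
  case: eqP => _; last by rewrite mul0r.
  rewrite mul1r; set a := coset_sum _ _ _ _ _.
  case: (lerP 0 a) => ha.
    by rewrite max_l ?oppr_le0 // expr0n add0r.
  by rewrite max_r ?oppr_ge0 ?ltW // expr0n addr0 sqrrN.
field; by rewrite !expf_neq0 ?pnatr_eq0.
Qed.

End Distribution.

(** * Acceptance probability and error bound *)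

Section Error.

Variables (R : realType) (m : nat) (G : 'I_m -> gate_kind) (n : nat).
Variables (C : circuit G n.+1) (wC : wf_circuit C) (K : {set 'I_n.+1}).
Local Notation N := n.+1.
Local Notation word := (N.-tuple bool).
Let kk := [seq j \in K | j <- enum 'I_N].
Let mk := false :: behead (rev kk).
Local Notation k := (count id mk).

Lemma card_last b : \sum_(x : word | tnth x ord_max == b) (1 : R) = 2 ^+ n.
Proof.
have := sum_set_last (fun _ : word => 1 : R) b; rewrite sumr_const card_tuple card_bool natrX exprS.
by move=> /mulfI ->; rewrite ?pnatr_eq0.
Qed.

Lemma sum_fibers (T : finType) (l : nat) (h : T -> seq bool) (F : T -> R) :
  (forall x, size (h x) = l) ->
  \sum_(z : l.-tuple bool) \sum_(x | h x == z) F x = \sum_x F x.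
Proof.
move=> hl; rewrite (exchange_big_dep xpredT) //=; apply: eq_bigr => x _.
by rewrite (big_pred1 (Tuple (introT eqP (hl x)))).
Qed.

(** Normalisation follows from [sum_amp2] for the empty set of observed wires, where V is trivial
    and every sign is 1. What remains counts pairs: 2^n reached words, as C is a bijection, and for
    each of them 2^n words [x] with the same last bit. *)
Lemma sum_hc1q_prob : \sum_(z : #|K|.-tuple bool) hc1q_prob R C K z = 1.
Proof.
under eq_bigr => z _ do rewrite hc1q_probE //.
rewrite -mulr_suml sum_fibers; last by move=> x; rewrite size_map -cardE.
suff -> : \sum_(x : word) amp R C x ^+ 2 = 4 ^+ n by rewrite divff // expf_neq0 // pnatr_eq0.
have eT (x : word) : ([seq tnth x j | j <- enum (set0 : {set 'I_N})] == [::]) = true.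
  by rewrite enum_set0.
rewrite (eq_bigl (fun x : word => [seq tnth x j | j <- enum (set0 : {set 'I_N})] == [::]));
  last by move=> x; rewrite eT.
rewrite sum_amp2 //.
pose o : word := [tuple of nseq N false].
have o0 j : tnth o j = false by rewrite (tnth_nth false) nth_nseq if_same.
transitivity (\sum_(x : word) \sum_(w : word | reached C w && (tnth w ord_max == tnth x ord_max)) (1 : R)).
  apply: eq_big => [x|x _]; first by rewrite eT.
  apply: eq_bigr => w /andP[rw _].
  have xo : xorw w o = w by apply: eq_from_tnth => j; rewrite tnth_mktuple o0 addbF.
  rewrite (big_pred1 o) => [|s].
    by rewrite /sgn big1 // => j _; rewrite o0 andbF.
  apply/andP/eqP => [[/forallP hs _]|->]; last first.
    by split; [apply/forallP => j; rewrite o0|rewrite xo].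
  apply: eq_from_tnth => j; rewrite o0; have := hs j; rewrite /= in_set0 /= implybF.
  by move/negPf.
rewrite (exchange_big_dep (fun w => reached C w)) /=; last by move=> x w _ /andP[].
transitivity (\sum_(w | reached C w) (2 ^+ n : R)).
  apply: eq_bigr => w rw; rewrite -(card_last (tnth w ord_max)).
  by apply: eq_bigl => x; rewrite rw /= eq_sym.
rewrite (reindex (eval_circuit C)) /=; last first.
  by exists (uneval C) => x _; [exact: eval_circuitK|exact: unevalK].
transitivity (\sum_(w : word | tnth w ord_max == false) (1 * 2 ^+ n : R)).
  by apply: eq_big => [w|w _]; rewrite ?mul1r // /reached eval_circuitK // eqbF_neg.
by rewrite -mulr_suml card_last -exprMn -natrM.
Qed.

Lemma hc1q_prob_ge0 z : 0 <= hc1q_prob R C K z.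
Proof. by apply: sumr_ge0 => x _; exact: sqr_ge0. Qed.

Lemma size_selected (o : seq bool) : size o = N -> size (rev (mask (rev kk) o)) = #|K|.
Proof.
move=> so; rewrite size_rev size_mask; last by rewrite size_rev size_map size_enum_ord so.
by rewrite count_rev count_map cardE -size_filter enumT.
Qed.

Lemma sum_indicator (l : nat) (u : seq bool) : size u = l ->
  \sum_(z : l.-tuple bool) (u == z)%:R = 1 :> R.
Proof.
move=> su; rewrite (bigD1 (Tuple (introT eqP su))) //= eqxx big1 ?addr0 // => z.
by rewrite -val_eqE /= eq_sym => /negPf ->.
Qed.

(** Summing [avg_block_output] over all outcomes: the indicators add up to 1 on one side, the
    probabilities on the other. *)
Lemma acceptance : avg (R := R) (4 * N) (fun q => (block_accepts C mk q)%:R) = (4 * 2 ^+ k)^-1.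
Proof.
transitivity (\sum_(z : #|K|.-tuple bool) hc1q_prob R C K z / (4 * 2 ^+ k)); last first.
  by rewrite -mulr_suml sum_hc1q_prob div1r.
under eq_bigr => z _ do rewrite -avg_block_output //.
rewrite -avg_sum; apply: avg_ext => q sq.
rewrite -mulr_sumr sum_indicator ?mulr1 // size_selected //.
by rewrite /block_output /= size_behead size_takel // size_drop sq; lia.
Qed.

Lemma geometric (a : R) t : (\sum_(i < t) (1 - a) ^+ i) * a = 1 - (1 - a) ^+ t.
Proof. by elim: t => [|t IH]; rewrite ?big_ord0 ?big_ord_recr ?exprS /= ?mulrDl ?IH; ring. Qed.

Lemma bernoulli (a : R) t : 0 <= a <= 1 -> (1 - a) ^+ t * (1 + t%:R * a) <= 1.
Proof.
move=> /andP[a0 a1]; elim: t => [|t IH]; first by rewrite expr0 mul0r addr0 mulr1.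
apply: le_trans IH; rewrite exprSr -mulrA ler_wpM2l ?exprn_ge0 ?subr_ge0 //.
have t0 : 0 <= t%:R :> R := ler0n R t.
by rewrite -natr1; nra.
Qed.

(** The sampler follows p except with probability (1 - al)^A, where it prints a fixed word. Both
    laws have mass 1, whence the factor 2, and Bernoulli's inequality bounds the power by 1/(1 + A
    al). *)
Lemma sampling_error (A : nat) :
  \sum_(z : #|K|.-tuple bool) `| hc1q_prob R C K z - avg (4 * N * A)
     (fun q => (rev (mask (rev kk) (outcome_after C mk A q).2) == z)%:R) |
  <= 2 / (1 + A%:R / (4 * 2 ^+ k)).
Proof.
set al := (4 * 2 ^+ k)^-1.
have k0 : 0 < 4 * 2 ^+ k :> R by rewrite mulr_gt0 ?exprn_gt0.
have al0 : 0 <= al by rewrite invr_ge0 ltW.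
have al1 : al <= 1.
  rewrite invf_le1 //; apply: (@le_trans _ _ (4 * 1)); first by rewrite mulr1 ler1n.
  by rewrite ler_wpM2l // exprn_ege1 // ler1n.
set be := (1 - al) ^+ A; set e := rev (mask (rev kk) (nseq N false)).
have be0 : 0 <= be by rewrite exprn_ge0 // subr_ge0.
apply: (@le_trans _ _ (\sum_(z : #|K|.-tuple bool) be * (hc1q_prob R C K z + (e == z)%:R))).
  apply: ler_sum => z _.
  rewrite (avg_outcome wC mk (fun _ o => (rev (mask (rev kk) o) == z)%:R)).
  rewrite avg_block_output // acceptance -/al -/be -/e mulrCA geometric.
  have -> : forall p q : R, p - (be * q + p * (1 - be)) = be * (p - q) by move=> p q; ring.
  rewrite normrM (ger0_norm be0) ler_wpM2l //.
  apply: (le_trans (ler_normB _ _)).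
  by rewrite !ger0_norm ?hc1q_prob_ge0.
rewrite -mulr_sumr big_split /= sum_hc1q_prob sum_indicator; last first.
  by rewrite size_selected // size_nseq.
rewrite (_ : 1 + 1 = 2) // mulrC ler_wpM2l // -/al.
have p0 : 0 < 1 + A%:R * al by rewrite ltr_wpDr // mulr_ge0.
by rewrite -[_^-1]mul1r ler_pdivlMr // bernoulli // al0 al1.
Qed.

End Error.

(** * Choice of the exponent of the number of attempts *)

Section Attempts.

Variables (R : realType) (c : R) (r : {poly R}).

(** Since N + 1 >= 2, even the constant can be absorbed into the exponent: B <= 2^B <= (N+1)^B for a
    bound B on the sum of the absolute values of the coefficients. *)
Lemma poly_le_pow : exists e, forall N : nat, (0 < N)%N -> r.[N%:R] <= (N.+1%:R) ^+ e.
Proof.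
pose B := Num.Def.archi_bound (\sum_(i < size r) `|r`_i|).
exists (B + size r)%N => N N0; rewrite horner_coef exprD.
have N1 : 1 <= N.+1%:R :> R by rewrite ler1n.
apply: (@le_trans _ _ (\sum_(i < size r) `|r`_i| * N.+1%:R ^+ size r)).
  apply: ler_sum => i _; apply: (le_trans (ler_norm _)); rewrite normrM.
  apply: ler_wpM2l => //; rewrite ger0_norm ?exprn_ge0 //.
  apply: (@le_trans _ _ (N.+1%:R ^+ i)); first by rewrite lerXn2r ?nnegrE // ler_nat.
  by rewrite ler_weXn2l // ltnW.
rewrite -mulr_suml ler_wpM2r ?exprn_ge0 //.
apply: (@le_trans _ _ (B%:R)).
  by apply: ltW; apply: archi_boundP; apply: sumr_ge0 => i _; exact: normr_ge0.
rewrite -natrX ler_nat; apply: (leq_trans (ltnW (ltn_expl B (ltnSn 1)))).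
by case: B => // B; rewrite leq_exp2r.
Qed.

Lemma pow_card_le : exists a, forall N l : nat, (0 < N)%N ->
  l%:R <= c * (ln N%:R / ln 2) -> (2 ^ l <= N.+1 ^ a)%N.
Proof.
exists (Num.Def.archi_bound `|c|) => N l N0 hl; set a := Num.Def.archi_bound _.
have ca : c <= a%:R.
  by apply: (le_trans (ler_norm c)); apply: ltW; apply: archi_boundP.
have l2 : 0 < ln 2 :> R by rewrite ln_gt0 // ltr1n.
have lN : 0 <= ln N%:R :> R by rewrite ln_ge0 // ler1n.
have : l%:R * ln 2 <= a%:R * ln N%:R :> R.
  apply: (@le_trans _ _ (c * ln N%:R)); last by rewrite ler_wpM2r.
  by rewrite -ler_pdivlMr // -mulrA.
rewrite !mulr_natl -!lnXn ?ltr0n // ler_ln ?posrE ?exprn_gt0 ?ltr0n //.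
rewrite -!natrX ler_nat => h; apply: (leq_trans h).
by case: (a) => // a'; rewrite leq_exp2r.
Qed.

(** One exponent serves both uses of the fuel: enumerating V, and making the error small. The 8
    arises from 2/(A/(4 2^k)) = 8 2^k/A and costs the exponent 3, as 8 = 2^3 <= (N+1)^3. *)
Lemma enough_attempts : exists d, forall N l : nat, (0 < N)%N ->
  l%:R <= c * (ln N%:R / ln 2) ->
  (2 ^ l <= N.+1 ^ d)%N /\ 8 * 2 ^+ l * r.[N%:R] <= (N.+1 ^ d)%N%:R.
Proof.
have [e he] := poly_le_pow; have [a ha] := pow_card_le.
exists (3 + a + e)%N => N l N0 hl; have h := ha N l N0 hl; split.
  by apply: (leq_trans h); rewrite leq_exp2l // addnAC leq_addl.
rewrite natrX [X in _ <= X]exprD.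
apply: (@le_trans _ _ (8 * 2 ^+ l * N.+1%:R ^+ e)).
  by apply: ler_wpM2l; [rewrite mulr_ge0 ?exprn_ge0|exact: he].
apply: ler_wpM2r; first by rewrite exprn_ge0.
rewrite exprD; apply: ler_pM; rewrite ?exprn_ge0 //; last by rewrite -!natrX ler_nat.
by rewrite -natrX ler_nat (@leq_exp2r 2 N.+1 3).
Qed.

End Attempts.

(** * The sampling machine and its output law *)

Section Machine.

Variables (m : nat) (G : 'I_m -> gate_kind) (d : nat).

Definition initial_regs : regs m (max_arity G) :=
  Regs false false false false false [ffun=> false] ord0.

Definition sampler : ptm := machine TI TR initial_regs (prepare G d) (sample G d).

Variables (n : nat) (C : circuit G n.+1) (wC : wf_circuit C) (K : {set 'I_n.+1}).
Local Notation N := n.+1.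
Let kk := [seq j \in K | j <- enum 'I_N].
Let mk := false :: behead (rev kk).
Hypothesis fuel : (2 ^ count id mk <= N.+1 ^ d)%N.

Lemma sampler_coins :
  coins_needed TI TR initial_regs (prepare G d) (encode C K) = (4 * N * N.+1 ^ d)%N.
Proof.
have [k [u [h e]]] := den_prepare d C K initial_regs.
by rewrite /coins_needed e /= size_nseq.
Qed.

Lemma sampler_output rho : size rho = (4 * N * N.+1 ^ d)%N ->
  final_tape TI TR initial_regs (prepare G d) (sample G d) (encode C K) rho =
  rev (mask (rev kk) (outcome_after C mk (N.+1 ^ d) rho).2).
Proof.
move=> sr; have [k [u [h e]]] := den_prepare d C K initial_regs.
rewrite /final_tape /middle_state e.
have skk : size kk = N by rewrite size_map size_enum_ord.
have smk : size mk = N by rewrite /= size_behead size_rev skk.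
apply: (den_sample wC smk fuel (uI := (u, [:: false]))) => //.
- split; last first.
    move=> y; rewrite !inE => hy; exists (nseq N false); first by rewrite size_nseq.
    by move: hy => /or4P[|||/orP[]] /eqP ->.
  have c0 : counter mk 0 = nseq N false by rewrite -[in RHS]smk.
  by split; rewrite // c0.
- by rewrite size_rev.
Qed.

End Machine.

Theorem theorem6 (R : realType) (m : nat) (G : 'I_m -> gate_kind)
    (c : R) (r : {poly R}) :
  0 < c ->
  (forall N : nat, (0 < N)%N -> 0 < r.[N%:R]) ->
  exists (M : ptm) (T : {poly nat}),
    runs_in_time M (horner T) /\
    forall (n : nat) (C : circuit G n.+1) (K : {set 'I_n.+1}),
      wf_circuit C ->
      #|K|%:R <= c * (ln n.+1%:R / ln 2) ->
      outputs_in M (horner T) (encode C K) (fun z => size z == #|K|) /\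
      \sum_(z : #|K|.-tuple bool)
        `| hc1q_prob R C K z - output_prob R M (horner T) (encode C K) z |
        <= 1 / r.[n.+1%:R].
Proof.
move=> _ r0; have [d hd] := enough_attempts c r.
have [T hT] := machine_poly TI TR (initial_regs G) (polytime_prepare G d) (polytime_sample G d).
pose a w := time (prepare G d) (start_state TI (initial_regs G) w).
pose b w := coins_needed TI TR (initial_regs G) (prepare G d) w.
have ab w : (a w + (b w).+1 <= T.[size w])%N.
  by apply: leq_trans (hT w (nseq (b w) true) _); rewrite ?leq_addr // size_nseq.
have sub w (coins : (T.[size w]).-tuple bool) : size (take (b w) (drop (a w) coins)) = b w.
  by rewrite size_takel // size_drop size_tuple; have := ab w; lia.
have runs w (coins : (T.[size w]).-tuple bool) :
    halted (run (sampler G d) w coins) /\ output (run (sampler G d) w coins) =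
    final_tape TI TR (initial_regs G) (prepare G d) (sample G d) w
      (take (b w) (drop (a w) coins)).
  apply: machine_run; [exact: wf_prepare|exact: wf_sample|].
  by rewrite size_tuple; apply: hT; exact: sub.
exists (sampler G d), T; split=> [w coins|n C K wC hK]; first by have [] := runs w coins.
set w := encode C K; pose N := n.+1.
have [fuel big] := hd N _ (ltn0Sn n) hK.
pose kk := [seq j \in K | j <- enum 'I_N]; pose mk := false :: behead (rev kk).
have skk : size kk = N by rewrite size_map size_enum_ord.
(* The mask omits the last wire, so the dimension of V may be one less than the number of observed
   qubits. *)
have kK : (count id mk <= #|K|)%N.
  have <- : count id kk = #|K| by rewrite count_map cardE -size_filter enumT.
  by rewrite -(count_rev _ kk) /mk; case: (rev kk) => //= x l; rewrite leq_addl.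
have fuel' : (2 ^ count id mk <= N.+1 ^ d)%N.
  by apply: leq_trans fuel; rewrite leq_exp2l.
have bw : b w = (4 * N * N.+1 ^ d)%N := sampler_coins d C K.
pose out q := rev (mask (rev kk) (outcome_after C mk (N.+1 ^ d) q).2).
have outE (coins : (T.[size w]).-tuple bool) :
    output (run (sampler G d) w coins) = out (take (b w) (drop (a w) coins)).
  by have [_ ->] := runs w coins; rewrite sampler_output // sub.
have size_mk' : size mk = N := size_mk K.
split=> [coins|].
  rewrite outE size_selected //; apply: (size_outcome_after wC size_mk' fuel').
  by rewrite sub bw.
(* The output depends only on the slice of coins that filled the random tape; averaging over the
   remaining tosses changes nothing. *)
have probE z : output_prob R (sampler G d) (horner T) w z =
    avg (4 * N * N.+1 ^ d) (fun q => (out q == z)%:R).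
  rewrite -bw -(avg_slice (T := T.[size w]) (a := a w)); last by have := ab w; lia.
  rewrite avg_tuple /output_prob; congr (_ / _); rewrite -sum1_card natr_sum big_mkcond /=.
  by apply: eq_bigr => coins _; rewrite inE outE; case: eqP.
under eq_bigr => z _ do rewrite probE.
apply: (le_trans (sampling_error R wC K (N.+1 ^ d))).
have rN : 0 < r.[N%:R] := r0 N (ltn0Sn n).
rewrite -/kk -/mk; set k := count id mk.
have k0 : 0 < 2 ^+ k :> R by rewrite exprn_gt0.
have kK' : 2 ^+ k <= 2 ^+ #|K| :> R by rewrite ler_weXn2l // ler1n.
have : 8 * 2 ^+ k * r.[N%:R] <= (N.+1 ^ d)%N%:R.
  by apply: le_trans big; rewrite ler_wpM2r ?(ltW rN) // ler_wpM2l.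
set A := (N.+1 ^ d)%N%:R => hA; have A0 : 0 <= A :> R := ler0n _ _.
have p0 : 0 < 1 + A / (4 * 2 ^+ k) by rewrite ltr_wpDr // divr_ge0 // mulr_ge0 // ltW.
rewrite ler_pdivrMr // mulrC mulrA ler_pdivlMr // mulr1.
(* The summand 1 from Bernoulli's inequality is dropped; 8 2^k r(N) <= A already gives the bound. *)
apply: (@le_trans _ _ (A / (4 * 2 ^+ k))); last by rewrite lerDr.
rewrite ler_pdivlMr ?mulr_gt0 //; apply: le_trans hA.
by rewrite le_eqVlt; apply/orP; left; apply/eqP; ring.
Qed.
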